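(* Let $q$ be a prime and let $\pi_1,\pi_2,\pi_3$ be irreducible tempered unitary representations of $GL_2(\mathbb Q_q)$ with central characters $\omega_1,\omega_2,\omega_3$ satisfying $\omega_1\omega_2\omega_3=1$. Suppose $\pi_1$ is an unramified principal series, and $\pi_2,\pi_3$ are both principal series of conductor exponent $1$ (so each is of the form $\pi(\chi_1,\chi_2)$ with one of $\chi_1,\chi_2$ of conductor exponent $1$ and the other unramified). Then $$I^*(\pi_1,\pi_2,\pi_3)=q^{-1}\qquad\text{and}\qquad \mathcal E_q=(1+q^{-1})^{-2}.$$
   Context: Let $G=GL_2(\mathbb Q_q)$ with center $Z$, and Haar measure on $Z\backslash G$ giving $PGL_2(\mathbb Z_q)$ volume $1$. For a representation of conductor exponent $c$, a newvector is a nonzero vector in the one-dimensional space fixed by $K_2(q^c)=\{\begin{pmatrix}a&b\\c'&d\end{pmatrix}\in GL_2(\mathbb Z_q): c'\in q^c\mathbb Z_q,\ d\in1+q^c\mathbb Z_q\}$ (for $c=0$, a spherical vector). Let $x_i\in\pi_i$ be a newvector, and $\langle\cdot,\cdot\rangle$ an invariant inner product on each $\pi_i$. Here (as $\pi_2$ and $\pi_3$ have equal conductor) $$I(\pi_1,\pi_2,\pi_3)=\int_{Z\backslash G}\frac{\langle gx_1,x_1\rangle}{\langle x_1,x_1\rangle}\frac{\langle gx_2,x_2\rangle}{\langle x_2,x_2\rangle}\frac{\langle gx_3,x_3\rangle}{\langle x_3,x_3\rangle}\,dg,$$ $$I^*(\pi_1,\pi_2,\pi_3)=\frac{L(\mathrm{ad}\,\pi_1,1)L(\mathrm{ad}\,\pi_2,1)L(\mathrm{ad}\,\pi_3,1)}{L(\pi_1\times\pi_2\times\pi_3,1/2)\,\zeta_q(2)^2}\,I(\pi_1,\pi_2,\pi_3),$$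 with $\zeta_q(s)=(1-q^{-s})^{-1}$, $L(\mathrm{ad}\,\pi,s)$ the local trace-zero adjoint $L$-factor and $L(\pi_1\times\pi_2\times\pi_3,s)$ the local triple product $L$-factor. $\mathcal E_q=\prod_{i=1}^3 L^H_q(\mathrm{ad}\,\pi_i,1)/L(\mathrm{ad}\,\pi_i,1)$, where for $\pi$ of conductor exponent $c$ and central character of conductor exponent $c_\omega$: $L^H_q(\mathrm{ad}\,\pi,1)=L(\mathrm{ad}\,\pi,1)$ if $c=0$; $=(1-q^{-2})^{-1}(1+q^{-1})^{-1}$ if $c=1$, $c_\omega=0$; $=(1-q^{-2})^{-1}$ if $c\ge1$ and $c_\omega=c$; $=(1+q^{-1})^{-1}$ otherwise. *)

(* Defs.v *)
From HB Require Import structures.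
From mathcomp Require Import all_boot all_order all_algebra.
From mathcomp Require Import all_classical all_reals all_analysis.
From mathcomp Require Import complex.

Set Implicit Arguments.
Unset Strict Implicit.
Unset Printing Implicit Defensive.

Import Order.TTheory GRing.Theory Num.Theory.

Local Open Scope classical_set_scope.
Local Open Scope ring_scope.

(* Representations have coefficients in C = R[i], with R any realType. *)

(* A model of Q_q: a completion of the rationals for the q-adic absolute
   value, normalized by |q| = 1/q.  The values |p| = 1 at the other primes p
   and characteristic 0 follow from these axioms (Bezout), so any two models
   are uniquely isometric. *)
Record padicField (R : realType) (q : nat) := PadicField {
  padic_sort :> fieldType;
  padic_abs : padic_sort -> R;
  padic_abs_ge0 : forall x, 0 <= padic_abs x;
  padic_abs_eq0 : forall x, padic_abs x = 0 <-> x = 0;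
  padic_absM : forall x y, padic_abs (x * y) = padic_abs x * padic_abs y;
  padic_absD : forall x y,
    padic_abs (x + y) <= Num.max (padic_abs x) (padic_abs y);
  padic_abs_q : padic_abs q%:R = q%:R^-1;
  padic_dense : forall (x : padic_sort) (e : R), 0 < e ->
    exists r : rat, padic_abs (x - ratr r) < e;
  padic_complete : forall u : nat -> padic_sort,
    (forall e : R, 0 < e -> exists N : nat, forall m n : nat,
       (N <= m)%N -> (N <= n)%N -> padic_abs (u m - u n) < e) ->
    exists l : padic_sort, forall e : R, 0 < e ->
      exists N : nat, forall n : nat, (N <= n)%N -> padic_abs (u n - l) < e
}.

Section GL2.
Variable F : fieldType.

Record GL2 := MkGL2 { GL2val :> 'M[F]_2; GL2_unit : GL2val \in unitmx }.

HB.instance Definition _ := [isSub for GL2val].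
HB.instance Definition _ := [Choice of GL2 by <:].

Definition GL2_one : GL2 := MkGL2 (unitmx1 F 2).

Lemma GL2_mul_subproof (g h : GL2) : GL2val g *m GL2val h \in unitmx.
Proof. by rewrite unitmx_mul !GL2_unit. Qed.

Definition GL2_mul (g h : GL2) : GL2 := MkGL2 (GL2_mul_subproof g h).

Lemma GL2_inv_subproof (g : GL2) : invmx (GL2val g) \in unitmx.
Proof. by rewrite unitmx_inv GL2_unit. Qed.

Definition GL2_inv (g : GL2) : GL2 := MkGL2 (GL2_inv_subproof g).

Lemma GL2_mulA : associative GL2_mul.
Proof. by move=> x y z; apply: val_inj; rewrite /= mulmxA. Qed.

Lemma GL2_mul1 : left_id GL2_one GL2_mul.
Proof. by move=> x; apply: val_inj; rewrite /= mul1mx. Qed.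

Lemma GL2_mulr1 : right_id GL2_one GL2_mul.
Proof. by move=> x; apply: val_inj; rewrite /= mulmx1. Qed.

Lemma GL2_mulV : left_inverse GL2_one GL2_inv GL2_mul.
Proof. by move=> x; apply: val_inj; rewrite /= mulVmx ?GL2_unit. Qed.

Lemma GL2_mulrV : right_inverse GL2_one GL2_inv GL2_mul.
Proof. by move=> x; apply: val_inj; rewrite /= mulmxV ?GL2_unit. Qed.

HB.instance Definition _ := isGroup.Build GL2
  GL2_mulA GL2_mul1 GL2_mulr1 GL2_mulV GL2_mulrV.

HB.instance Definition _ := isPointed.Build GL2 GL2_one.

Definition center : set GL2 := [set z | exists a : F, GL2val z = a%:M].

End GL2.

Section Groups.
Variables (R : realType) (q : nat) (F : padicField R q).
Local Notation G := (GL2 F).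
Local Notation i0 := (ord0 : 'I_2).
Local Notation i1 := (ord_max : 'I_2).
Local Open Scope group_scope.

(* The topology of G induced from M_2(F); inversion is continuous for it, so
   it is the usual group topology. *)
Definition GL2_open (U : set G) : Prop :=
  forall g, U g -> exists2 e : R, (0 < e)%R &
    forall h : G,
      (forall i j, (padic_abs (GL2val h i j - GL2val g i j)%R < e)%R) -> U h.

Definition GL2_int : set G :=
  [set g | (forall i j, (padic_abs (GL2val g i j) <= 1)%R) /\
           padic_abs (\det (GL2val g)) = 1%R].

Definition K2 (c : nat) : set G :=
  [set g | GL2_int g /\
    (padic_abs (GL2val g i1 i0) <= q%:R ^- c)%R /\
    (padic_abs (GL2val g i1 i1 - 1)%R <= q%:R ^- c)%R].

(* Z\G is presented through its pull-back to G: the sigma-algebra generated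
   by the Z-invariant open subsets of G is the preimage of the Borel
   sigma-algebra of Z\G, measures on it are the Borel measures on Z\G, and
   functions on Z\G are the Z-invariant functions on G. *)
Definition center_invariant_open : set (set G) :=
  [set U | GL2_open U /\ forall z g, center z -> U g -> U (z * g)].

Definition ZmodG := g_sigma_algebraType center_invariant_open.

(* Haar measure on Z\G; the preimage in G of PGL_2(Z_q) is Z GL_2(Z_q). *)
Definition haar_measure (mu : {measure set ZmodG -> \bar R}) : Prop :=
  (forall (g : G) (A : set ZmodG), measurable A ->
     mu [set (g * (x : G) : ZmodG) | x in A] = mu A) /\
  mu [set x : ZmodG | exists z k : G,
        [/\ center z, GL2_int k & (x : G) = z * k]] = 1%E.

End Groups.

Section Characters.
Variables (R : realType) (q : nat) (F : padicField R q).
Local Notation C := (R[i]).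

(* The unit filtration of F^*: Z_q^* for n = 0, and 1 + q^n Z_q for n > 0. *)
Definition unit_filtration (n : nat) : set F :=
  [set x | padic_abs x = 1 /\ padic_abs (x - 1) <= q%:R ^- n].

(* Continuous homomorphisms F^* -> C^*; such a map is trivial on a subgroup
   1 + q^n Z_q.  The value at 0 is irrelevant. *)
Definition quasicharacter (chi : F -> C) : Prop :=
  [/\ forall x, x != 0 -> chi x != 0,
      forall x y, x != 0 -> y != 0 -> chi (x * y) = chi x * chi y &
      exists n, forall x, unit_filtration n x -> chi x = 1].

Definition unramified (chi : F -> C) : Prop :=
  forall x, padic_abs x = 1 -> chi x = 1.

Definition least (P : set nat) : nat :=
  xget 0%N [set n | P n /\ forall m, P m -> (n <= m)%N].

Definition char_conductor (chi : F -> C) : nat :=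
  least [set n | forall x, unit_filtration n x -> chi x = 1].

End Characters.

Section Representations.
Variables (R : realType) (q : nat) (F : padicField R q).
Local Notation C := (R[i]).
Local Notation G := (GL2 F).
Local Notation i0 := (ord0 : 'I_2).
Local Notation i1 := (ord_max : 'I_2).

Record smoothRep := SmoothRep {
  rep_space :> lmodType C;
  rep_act : G -> {linear rep_space -> rep_space};
  rep_act1 : forall v, rep_act 1%g v = v;
  rep_actM : forall g h v, rep_act (g * h)%g v = rep_act g (rep_act h v);
  rep_smooth : forall v, GL2_open [set g | rep_act g v = v]
}.

Definition irreducible (pi : smoothRep) : Prop :=
  (exists v : pi, v != 0) /\
  forall W : set pi,
    W 0 -> (forall (a : C) u v, W u -> W v -> W (a *: u + v)) ->
    (forall g v, W v -> W (rep_act pi g v)) ->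
    (forall v, W v -> v = 0) \/ (forall v, W v).

Definition invariant_inner_product (pi : smoothRep) (ip : pi -> pi -> C) :=
  [/\ forall (a : C) u v w, ip (a *: u + v) w = a * ip u w + ip v w,
      forall u v, ip v u = conjc (ip u v),
      forall u, u != 0 -> 0 < ip u u &
      forall g u v, ip (rep_act pi g u) (rep_act pi g v) = ip u v].

Definition central_character (pi : smoothRep) (omega : F -> C) : Prop :=
  forall (z : G) (a : F), GL2val z = a%:M ->
    forall v : pi, rep_act pi z v = omega a *: v.

(* Matrix coefficients are in L^(2+e) modulo the center for all e > 0. *)
Definition tempered (mu : {measure set (ZmodG F) -> \bar R})
    (pi : smoothRep) (ip : pi -> pi -> C) : Prop :=
  forall (u v : pi) (e : R), 0 < e ->
    (\int[mu]_g
       ((complex.Re `|ip (rep_act pi (g : G) u) v|) `^ (2 + e))%:E < +oo)%E.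

(* The space of the representation induced from the Borel subgroup of upper
   triangular matrices (normalized induction), on which G acts by right
   translation. *)
Definition induced_space (chi : (F -> C) * (F -> C)) : set (G -> C) :=
  [set f | (forall b g : G, GL2val b i1 i0 = 0 ->
              f (b * g)%g =
                chi.1 (GL2val b i0 i0) * chi.2 (GL2val b i1 i1) *
                (Num.sqrt (padic_abs (GL2val b i0 i0 / GL2val b i1 i1)))%:C%C
                * f g) /\
           exists U : set G, [/\ GL2_open U, U 1%g &
              forall g k, U k -> f (g * k)%g = f g]].

(* pi is isomorphic to pi(chi.1, chi.2); for irreducible pi, this says that
   pi is a principal series representation with these inducing data. *)
Definition principal_series (pi : smoothRep) (chi : (F -> C) * (F -> C)) :=
  [/\ quasicharacter chi.1, quasicharacter chi.2 &
   exists T : pi -> (G -> C),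
    [/\ forall (a : C) u v g, T (a *: u + v) g = a * T u g + T v g,
        injective T,
        range T = induced_space chi &
        forall g v h, T (rep_act pi g v) h = T v (h * g)%g]].

Definition K2_fixed (pi : smoothRep) (c : nat) : set pi :=
  [set v | forall k, K2 c k -> rep_act pi k v = v].

Definition rep_conductor (pi : smoothRep) : nat :=
  least [set c | exists2 v : pi, v != 0 & K2_fixed c v].

Definition newvector (pi : smoothRep) (x : pi) : Prop :=
  x != 0 /\ K2_fixed (rep_conductor pi) x.

Definition normalized_coeff (pi : smoothRep) (ip : pi -> pi -> C) (x : pi)
    (g : G) : C := ip (rep_act pi g x) x / ip x x.

End Representations.

Section Factors.
Variables (R : realType) (q : nat) (F : padicField R q).
Local Notation C := (R[i]).
Local Notation chars := ((F -> C) * (F -> C))%type.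

Definition qpow (s : R) : C := ((q%:R : R) `^ s)%:C%C.

Definition zeta (s : R) : C := (1 - qpow (- s))^-1.

Definition L_char (chi : F -> C) (s : R) : C :=
  if `[< unramified chi >] then (1 - chi q%:R * qpow (- s))^-1 else 1.

(* L-factors of principal series, in terms of their inducing data: the
   Langlands parameter of pi(chi.1, chi.2) is chi.1 + chi.2.  Its trace-zero
   adjoint is chi.1/chi.2 + 1 + chi.2/chi.1, and the tensor product
   of three such parameters is the sum of the eight products below. *)
Definition L_ad (chi : chars) (s : R) : C :=
  L_char (fun x => chi.1 x / chi.2 x) s * zeta s *
  L_char (fun x => chi.2 x / chi.1 x) s.

Definition L_triple (chi1 chi2 chi3 : chars) (s : R) : C :=
  \prod_(a <- [:: chi1.1; chi1.2]) \prod_(b <- [:: chi2.1; chi2.2])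
    \prod_(c <- [:: chi3.1; chi3.2]) L_char (fun x => a x * b x * c x) s.

Definition complex_integral (mu : {measure set (ZmodG F) -> \bar R})
    (f : GL2 F -> C) : C :=
  Complex (Rintegral mu setT (fun g => complex.Re (f g)))
          (Rintegral mu setT (fun g => complex.Im (f g))).

Definition I_local (mu : {measure set (ZmodG F) -> \bar R})
    (pi1 pi2 pi3 : smoothRep F)
    (ip1 : pi1 -> pi1 -> C) (ip2 : pi2 -> pi2 -> C) (ip3 : pi3 -> pi3 -> C)
    (x1 : pi1) (x2 : pi2) (x3 : pi3) : C :=
  complex_integral mu (fun g =>
    normalized_coeff ip1 x1 g * normalized_coeff ip2 x2 g *
    normalized_coeff ip3 x3 g).

Definition I_star (mu : {measure set (ZmodG F) -> \bar R})
    (pi1 pi2 pi3 : smoothRep F) (chi1 chi2 chi3 : chars)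
    (ip1 : pi1 -> pi1 -> C) (ip2 : pi2 -> pi2 -> C) (ip3 : pi3 -> pi3 -> C)
    (x1 : pi1) (x2 : pi2) (x3 : pi3) : C :=
  L_ad chi1 1 * L_ad chi2 1 * L_ad chi3 1 /
  (L_triple chi1 chi2 chi3 2^-1 * zeta 2 ^+ 2) *
  I_local mu ip1 ip2 ip3 x1 x2 x3.

(* L^H(ad pi, 1), for pi = pi(chi.1, chi.2) with central character omega. *)
Definition LH_ad (pi : smoothRep F) (omega : F -> C) (chi : chars) : C :=
  let c := rep_conductor pi in
  let c_omega := char_conductor omega in
  if c == 0%N then L_ad chi 1
  else if (c == 1%N) && (c_omega == 0%N)
    then (1 - q%:R ^- 2)^-1 * (1 + q%:R^-1)^-1
  else if c_omega == c then (1 - q%:R ^- 2)^-1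
  else (1 + q%:R^-1)^-1.

Definition E_factor (pi1 pi2 pi3 : smoothRep F) (omega1 omega2 omega3 : F -> C)
    (chi1 chi2 chi3 : chars) : C :=
  LH_ad pi1 omega1 chi1 / L_ad chi1 1 *
  (LH_ad pi2 omega2 chi2 / L_ad chi2 1) *
  (LH_ad pi3 omega3 chi3 / L_ad chi3 1).

End Factors.

(* Main.v *)
(* Write I for the Iwahori subgroup and t = diag(q, 1).  The product of the three
   normalized matrix coefficients is invariant under Z and under I on both sides,
   so the integral is a sum over Z\G modulo I.  The coefficients of x2 and x3
   vanish on the cells containing a Weyl element, since the characters by which I
   acts on x2 and x3 are ramified, and they equal (q^(-1/2) alpha)^n and
   (q^(-1/2) beta)^n at t^n, where alpha and beta are the values at q of the
   unramified inducing characters.  The cell Z I t^n I has volume q^|n| / (q + 1).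
   Hence the integral is 1 / (q + 1) times the sum over all integers n of
   (alpha beta)^n phi(t^n) (conjugates for n < 0), where phi is the spherical
   function of pi1; the Hecke recursion for phi evaluates this series as a
   rational function, which is q^-1 times the quotient of L-factors.
   Temperedness of pi1 gives absolute convergence and excludes the poles of
   L(ad pi1, 1). *)

Require Import Defs.
From HB Require Import structures.
From mathcomp Require Import all_boot all_order all_algebra.
From mathcomp Require Import all_classical all_reals all_analysis.
From mathcomp Require Import complex measurable_realfun.
From mathcomp Require Import ring lra zify.

Set Implicit Arguments.
Unset Strict Implicit.
Unset Printing Implicit Defensive.

Import Order.TTheory GRing.Theory Num.Theory.
Import numFieldNormedType.Exports.

Local Open Scope classical_set_scope.
Local Open Scope ring_scope.

(** * The absolute value of Q_q *)

(** The newvectors x2 and x3 are not fixed by the Iwahori subgroup I: it acts on them through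
    omega2(d) and omega3(d), because I is the product of K2(q) and the unit scalars. These values
    cancel in the product of coefficients, since omega1 is unramified. At t^n the coefficients of x2
    and x3 together have modulus q^(-n), exactly the inverse of the growth of the cells, so
    convergence rests on the decay of phi alone; cube-integrability already gives |phi(t^n)| =
    O(q^(-n/3)). The closed formula for phi is avoided, as it degenerates when the two inducing
    values a and b at q coincide. Instead the sum over n >= 0 satisfies a linear equation, and
    complex conjugation of that equation handles n < 0. The coefficients of the unknown sums in
    these equations are inverse L-factors of the triple product; they get multiplied and never
    divided by, so the poles of that L-factor do not matter. In u = q^(-1/2) what remains is an
    identity of rational functions. *)

Section PadicAbs.
Variables (R : realType) (q : nat) (F : padicField R q).
Hypothesis q_prime : prime q.
Implicit Types x y z : F.
Local Notation "`| x |_q" := (padic_abs x) (format "`| x |_q").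
Local Notation Q := (q%:R : R).

Lemma q_gt0 : 0 < Q. Proof. by rewrite ltr0n prime_gt0. Qed.
Lemma q_gt1 : 1 < Q. Proof. by rewrite ltr1n prime_gt1. Qed.
Lemma qV_gt0 : 0 < Q^-1. Proof. by rewrite invr_gt0 q_gt0. Qed.
Lemma qV_lt1 : Q^-1 < 1. Proof. by rewrite invf_lt1 ?q_gt0 ?q_gt1. Qed.

Lemma abs0 : `|0 : F|_q = 0.
Proof. exact/padic_abs_eq0. Qed.

Lemma abs_eq0 x : (`|x|_q == 0) = (x == 0).
Proof. by apply/eqP/eqP => /padic_abs_eq0. Qed.

Lemma abs_gt0 x : (0 < `|x|_q) = (x != 0).
Proof. by rewrite lt_def padic_abs_ge0 andbT abs_eq0. Qed.

Lemma abs1 : `|1 : F|_q = 1.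
Proof.
have h : `|1 : F|_q != 0 by rewrite abs_eq0 oner_eq0.
by apply: (mulfI h); rewrite -padic_absM !mulr1.
Qed.

Lemma absX x n : `|x ^+ n|_q = `|x|_q ^+ n.
Proof. by elim: n => [|n IH]; rewrite ?expr0 ?abs1 // !exprS padic_absM IH. Qed.

Lemma absN x : `|- x|_q = `|x|_q.
Proof.
rewrite -mulN1r padic_absM; suff -> : `|-1 : F|_q = 1 by rewrite mul1r.
have : `|-1 : F|_q ^+ 2 == 1 by rewrite -absX sqrrN expr1n abs1.
by rewrite sqrf_eq1 => /orP[/eqP//|/eqP h]; have := padic_abs_ge0 (-1 : F); rewrite h ler0N1.
Qed.

Lemma absV x : `|x^-1|_q = `|x|_q^-1.
Proof.
have [->|x0] := eqVneq x 0; first by rewrite invr0 abs0 invr0.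
have h : `|x|_q != 0 by rewrite abs_eq0.
by apply: (mulfI h); rewrite -padic_absM !mulfV // abs1.
Qed.

Lemma abs_div x y : `|x / y|_q = `|x|_q / `|y|_q.
Proof. by rewrite padic_absM absV. Qed.

Lemma absD_le x y (r : R) : `|x|_q <= r -> `|y|_q <= r -> `|x + y|_q <= r.
Proof. by move=> hx hy; apply: le_trans (padic_absD x y) _; rewrite ge_max hx. Qed.

Lemma absB_le x y (r : R) : `|x|_q <= r -> `|y|_q <= r -> `|x - y|_q <= r.
Proof. by move=> hx hy; apply: absD_le; rewrite ?absN. Qed.

Lemma absD_lt x y (r : R) : `|x|_q < r -> `|y|_q < r -> `|x + y|_q < r.
Proof. by move=> hx hy; apply: le_lt_trans (padic_absD x y) _; rewrite gt_max hx. Qed.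

Lemma absB_lt x y (r : R) : `|x|_q < r -> `|y|_q < r -> `|x - y|_q < r.
Proof. by move=> hx hy; apply: absD_lt; rewrite ?absN. Qed.

Lemma absC x y : `|x - y|_q = `|y - x|_q.
Proof. by rewrite -absN opprB. Qed.

Lemma abs_addl x y : `|y|_q < `|x|_q -> `|x + y|_q = `|x|_q.
Proof.
move=> yx; apply/eqP; rewrite eq_le absD_le ?(ltW yx) //= leNgt; apply/negP => h.
have := absB_lt h yx; by rewrite addrK ltxx.
Qed.

Lemma abs_addr x y : `|x|_q < `|y|_q -> `|x + y|_q = `|y|_q.
Proof. by move=> h; rewrite addrC abs_addl. Qed.

Lemma abs_subl x y : `|y|_q < `|x|_q -> `|x - y|_q = `|x|_q.
Proof. by move=> h; rewrite abs_addl ?absN. Qed.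

Lemma abs_nat n : `|n%:R : F|_q <= 1.
Proof. by elim: n => [|n IH]; rewrite ?abs0 // -natr1 absD_le ?abs1. Qed.

Lemma abs_natM n : (q %| n)%N -> `|n%:R : F|_q <= Q^-1.
Proof.
case/dvdnP => m ->; rewrite natrM padic_absM padic_abs_q ler_piMl ?abs_nat //.
Qed.

Lemma natF_neq0 : (q%:R : F) != 0.
Proof. by rewrite -abs_gt0 padic_abs_q qV_gt0. Qed.

(** By Bezout u n - v q = 1; if |n| < 1, both terms would be smaller than 1, contradicting |1| =
    1. *)
Lemma abs_coprime n : ~~ (q %| n)%N -> `|n%:R : F|_q = 1.
Proof.
move=> h; apply/eqP; rewrite eq_le abs_nat /= leNgt; apply/negP => lt1.
have n0 : (0 < n)%N by case: n h {lt1} => //; rewrite dvdn0.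
have [u v e _] := egcdnP q n0.
have cop : gcdn n q = 1%N by apply/eqP; rewrite -/(coprime n q) coprime_sym prime_coprime.
have : `|(u * n)%:R - (v * q)%:R : F|_q = 1 by rewrite e cop natrD addrAC subrr add0r abs1.
have h1 : `|(u * n)%:R : F|_q < 1.
  by rewrite natrM padic_absM; apply: le_lt_trans lt1; rewrite ler_piMl ?padic_abs_ge0 ?abs_nat.
have h2 : `|(v * q)%:R : F|_q < 1.
  by apply: le_lt_trans qV_lt1; rewrite abs_natM ?dvdn_mull.
by move=> h3; have := absB_lt h1 h2; rewrite h3 ltxx.
Qed.

Lemma abs_nat_val n : (0 < n)%N -> `|n%:R : F|_q = Q^-1 ^+ logn q n.
Proof.
move=> n0; have [m h {1}->] := pfactor_coprime q_prime n0.
by rewrite natrM natrX padic_absM absX padic_abs_q abs_coprime ?mul1r // -prime_coprime.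
Qed.

Lemma abs_int (m : int) : `|m%:~R : F|_q = `| `|m|%N%:R : F|_q.
Proof. by case: m => n //=; rewrite NegzE mulrNz absN. Qed.

Lemma ratr_F (r : rat) : (ratr r : F) = (numq r)%:~R / (denq r)%:~R.
Proof. by []. Qed.

(** A rational number closer to x than |x| has the same absolute value by the ultrametric
    inequality, and for rationals the exponent comes from the factorization of numerator and
    denominator. *)
Lemma abs_val x : x != 0 -> exists k : int, `|x|_q = Q ^ k.
Proof.
move=> x0; have := x0; rewrite -abs_gt0 => hx.
have [r hr] := padic_dense x hx.
have e : `|ratr r : F|_q = `|x|_q.
  by rewrite -[ratr r](subKr x) abs_subl.
have : (ratr r : F) != 0 by rewrite -abs_gt0 e.
rewrite ratr_F mulf_eq0 negb_or invr_eq0 => /andP[n0 d0].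
have posn (m : int) : (m%:~R : F) != 0 -> (0 < `|m|)%N.
  by rewrite absz_gt0; apply: contraNneq => ->.
exists (- (logn q `|numq r|)%:Z + (logn q `|denq r|)%:Z).
rewrite -e ratr_F abs_div !abs_int !abs_nat_val ?posn //.
by rewrite expfzDr ?gt_eqF ?q_gt0 // -exprnN !exprVn invrK.
Qed.

Lemma abs_lt1 x : `|x|_q < 1 -> `|x|_q <= Q^-1.
Proof.
have [->|x0] := eqVneq x 0; first by rewrite abs0 ltW // qV_gt0.
have [k ->] := abs_val x0.
rewrite -(expr0z Q) ltr_eXz2l ?q_gt1 // => k0.
have -> : Q^-1 = Q ^ (-1) by rewrite exprN1.
by rewrite ler_eXz2l ?q_gt1 //; lia.
Qed.

Lemma abs_ltM x y : `|x|_q < `|y|_q -> `|x|_q <= Q^-1 * `|y|_q.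
Proof.
move=> h; have y0 : y != 0 by rewrite -abs_gt0 (le_lt_trans _ h) ?padic_abs_ge0.
rewrite -ler_pdivrMr ?abs_gt0 // -abs_div; apply: abs_lt1.
by rewrite abs_div ltr_pdivrMr ?abs_gt0 // mul1r.
Qed.

(** By density x may be replaced by a rational r with |r| <= 1. Its denominator is then prime to q,
    since otherwise the coprime numerator would be a unit and |r| > 1. *)
Lemma residue x : `|x|_q <= 1 -> exists j : 'I_q, `|x - j%:R|_q < 1.
Proof.
move=> x1; have [r hr] := padic_dense x (ltr01 : 0 < 1 :> R).
have r1 : `|ratr r : F|_q <= 1 by rewrite -[ratr r](subKr x) absB_le // ltW.
suff [j hj] : exists j : 'I_q, `|ratr r - j%:R : F|_q < 1.
  by exists j; rewrite -[x](subrK (ratr r)) -addrA absD_lt.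
set n := numq r; set d := `|denq r|%N.
have d0 : (0 < d)%N by rewrite absz_gt0 denq_eq0.
have re : (ratr r : F) = n%:~R / d%:R by rewrite ratr_F -/n -[d%:R]/(d%:Z%:~R) absz_denq.
have qd : ~~ (q %| d)%N.
  apply/negP => qd; have qn : ~~ (q %| `|n|)%N.
    apply/negP => qn; have := coprime_num_den r.
    rewrite -/n -/d => /eqP e1; have : (q %| gcdn `|n| d)%N by rewrite dvdn_gcd qn qd.
    by rewrite e1 dvdn1 => /eqP q1; have := prime_gt1 q_prime; rewrite q1.
  move: r1; rewrite re abs_div abs_int (abs_coprime qn) div1r.
  rewrite leNgt invf_gt1 ?abs_gt0; last first.
    by rewrite -abs_eq0 abs_nat_val // gt_eqF // exprn_gt0 // qV_gt0.
  by rewrite (le_lt_trans (abs_natM qd) qV_lt1).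
have [u v e _] := egcdnP q d0.
have cop : gcdn d q = 1%N by apply/eqP; rewrite -/(coprime d q) coprime_sym prime_coprime.
rewrite cop in e.
(* Bezout makes [u] an inverse of the denominator [d] modulo q, so n u represents n / d. *)
pose jz := ((n * u%:Z) %% q%:Z)%Z.
have q0 : q%:Z != 0 by rewrite -lt0n prime_gt0.
have jz0 : 0 <= jz by apply: modz_ge0.
have jzq' : jz < q%:Z by rewrite ltz_pmod // ltz_nat prime_gt0.
have jzq : (`|jz| < q)%N by move: jz jz0 jzq' => z; lia.
exists (Ordinal jzq) => /=.
have dd : `|d%:R : F|_q = 1 by apply: abs_coprime.
have dF : (d%:R : F) != 0 by rewrite -abs_gt0 dd.
have -> : (ratr r - `|jz|%N%:R : F) = (n - d%:Z * jz)%:~R / d%:R.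
  rewrite re intrB intrM /= mulrBl [d%:~R * _]mulrC mulfK //.
  by congr (_ - _); rewrite -[_%:R]/(`|jz|%N%:Z%:~R) gez0_abs.
rewrite abs_div dd divr1 abs_int.
apply: le_lt_trans qV_lt1; apply: abs_natM.
have -> : n - d%:Z * jz = (d%:Z * (n * u%:Z %/ q%:Z)%Z - n * v%:Z) * q%:Z.
  have := divz_eq (n * u%:Z) q%:Z; rewrite -/jz => eq1.
  have eq2 : u%:Z * d%:Z = v%:Z * q%:Z + 1 by lia.
  have -> : jz = n * u%:Z - (n * u%:Z %/ q%:Z)%Z * q%:Z by lia.
  have -> : n - d%:Z * (n * u%:Z - (n * u%:Z %/ q%:Z)%Z * q%:Z) =
    n - n * (u%:Z * d%:Z) + d%:Z * (n * u%:Z %/ q%:Z)%Z * q%:Z by ring.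
  by rewrite eq2; ring.
by rewrite abszM dvdn_mull.
Qed.

Lemma residue_uniq (i j : 'I_q) : `|i%:R - j%:R : F|_q < 1 -> i = j.
Proof.
wlog ij : i j / (j <= i)%N.
  by move=> weyl h; case: (leqP j i) => [|/ltnW] /weyl; [|rewrite absC => W'; apply/esym/W'];
    exact.
rewrite -natrB // => h; apply/val_inj/eqP; rewrite eqn_leq ij andbT -subn_eq0.
have : (q %| i - j)%N by apply/negPn/negP => /abs_coprime h1; move: h; rewrite h1 ltxx.
move=> dv; apply/negPn/negP; rewrite -lt0n => /dvdn_leq /(_ dv).
by apply/negP; rewrite -ltnNge (leq_ltn_trans (leq_subr _ _) (ltn_ord i)).
Qed.

End PadicAbs.

(** * Matrix entries in GL_2 *)

Section GL2Entries.
Variable F : fieldType.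
Local Notation G := (GL2 F).
Local Notation i0 := (ord0 : 'I_2).
Local Notation i1 := (ord_max : 'I_2).
Implicit Types (g h : G) (a b c d : F).

Definition ma g := GL2val g i0 i0.
Definition mb g := GL2val g i0 i1.
Definition mc g := GL2val g i1 i0.
Definition md g := GL2val g i1 i1.
Definition dt g := ma g * md g - mb g * mc g.

Lemma dtE g : \det (GL2val g) = dt g.
Proof.
rewrite /dt /ma /mb /mc /md (expand_det_row _ i0) !big_ord_recl big_ord0 addr0 /cofactor.
rewrite !det_mx11 !mxE /= !add0n expr0 mul1r expr1 mulN1r mulrN.
have l1 (i : 'I_1) : lift ord0 i = i1 :> 'I_2 by apply/val_inj; rewrite /= ord1.
have l0 (i : 'I_1) : lift i1 i = i0 :> 'I_2 by apply/val_inj; rewrite /= ord1.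
by rewrite !l1 !l0.
Qed.

Lemma dt_neq0 g : dt g != 0.
Proof. by rewrite -dtE -unitfE -unitmxE GL2_unit. Qed.

Lemma ord2_cases (P : 'I_2 -> Prop) : P i0 -> P i1 -> forall i, P i.
Proof. by move=> p0 p1 [[|[|//]] h]; [have -> : Ordinal h = i0|have -> : Ordinal h = i1];
  try apply/val_inj. Qed.

Lemma GL2_ext g h : ma g = ma h -> mb g = mb h -> mc g = mc h -> md g = md h -> g = h.
Proof.
move=> ea eb ec ed; apply/val_inj/matrixP.
by apply: ord2_cases; apply: ord2_cases.
Qed.

Let mulE g h i j : GL2val (g * h)%g i j =
  GL2val g i i0 * GL2val h i0 j + GL2val g i i1 * GL2val h i1 j.
Proof.
rewrite [LHS]mxE !big_ord_recl big_ord0 addr0.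
by congr (_ * _ + GL2val g _ _ * GL2val h _ _); apply/val_inj.
Qed.

Lemma maM g h : ma (g * h)%g = ma g * ma h + mb g * mc h. Proof. exact: mulE. Qed.
Lemma mbM g h : mb (g * h)%g = ma g * mb h + mb g * md h. Proof. exact: mulE. Qed.
Lemma mcM g h : mc (g * h)%g = mc g * ma h + md g * mc h. Proof. exact: mulE. Qed.
Lemma mdM g h : md (g * h)%g = mc g * mb h + md g * md h. Proof. exact: mulE. Qed.
Lemma dtM g h : dt (g * h)%g = dt g * dt h.
Proof. by rewrite -!dtE -det_mulmx. Qed.

Lemma ma1 : ma 1%g = 1. Proof. by rewrite /ma mxE. Qed.
Lemma mb1 : mb 1%g = 0. Proof. by rewrite /mb mxE. Qed.
Lemma mc1 : mc 1%g = 0. Proof. by rewrite /mc mxE. Qed.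
Lemma md1 : md 1%g = 1. Proof. by rewrite /md mxE. Qed.

(* The junk value is 1 when a d = b c. *)
Definition mx2 a b c d : G :=
  insubd (1%g : G) (\matrix_(i < 2, j < 2)
    if i == i0 then if j == i0 then a else b else if j == i0 then c else d).

Let mx2_val a b c d : a * d - b * c != 0 -> GL2val (mx2 a b c d) =
  \matrix_(i < 2, j < 2)
    if i == i0 then if j == i0 then a else b else if j == i0 then c else d.
Proof.
move=> h; rewrite /mx2; set M := \matrix_(_, _) _.
suff hM : M \in unitmx by rewrite -[GL2val _]/(val _) insubdK.
rewrite unitmxE unitfE (expand_det_row _ i0) !big_ord_recl big_ord0 addr0 /cofactor.
by rewrite !det_mx11 !mxE /= !add0n expr0 mul1r expr1 mulN1r mulrN.
Qed.

Lemma ma_mx2 a b c d : a * d - b * c != 0 -> ma (mx2 a b c d) = a.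
Proof. by move=> h; rewrite /ma mx2_val // mxE. Qed.
Lemma mb_mx2 a b c d : a * d - b * c != 0 -> mb (mx2 a b c d) = b.
Proof. by move=> h; rewrite /mb mx2_val // mxE. Qed.
Lemma mc_mx2 a b c d : a * d - b * c != 0 -> mc (mx2 a b c d) = c.
Proof. by move=> h; rewrite /mc mx2_val // mxE. Qed.
Lemma md_mx2 a b c d : a * d - b * c != 0 -> md (mx2 a b c d) = d.
Proof. by move=> h; rewrite /md mx2_val // mxE. Qed.
Definition entry_mx2 := (ma_mx2, mb_mx2, mc_mx2, md_mx2).
Definition entryM := (maM, mbM, mcM, mdM).

Lemma glE g : g = mx2 (ma g) (mb g) (mc g) (md g).
Proof. by apply: GL2_ext; rewrite !entry_mx2 ?dt_neq0. Qed.

Lemma mx2_invE g : (g^-1)%g =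
  mx2 (md g / dt g) (- mb g / dt g) (- mc g / dt g) (ma g / dt g).
Proof.
have h := dt_neq0 g; have h' := h; rewrite /dt in h'.
have e : (md g / dt g) * (ma g / dt g) - (- mb g / dt g) * (- mc g / dt g) = (dt g)^-1.
  by rewrite /dt; field.
apply: (mulIg g); rewrite mulVg; apply: GL2_ext; rewrite !entryM !entry_mx2 ?e ?invr_neq0 //;
  rewrite ?ma1 ?mb1 ?mc1 ?md1 /dt; field.
all: by [].
Qed.

Lemma maV g : ma (g^-1)%g = md g / dt g.
Proof. by rewrite mx2_invE ma_mx2 // /dt; have := dt_neq0 g; rewrite /dt => h;
  rewrite (_ : _ - _ = (dt g)^-1) ?invr_neq0 // /dt; field. Qed.
Lemma mbV g : mb (g^-1)%g = - mb g / dt g.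
Proof. by rewrite mx2_invE mb_mx2 // /dt; have := dt_neq0 g; rewrite /dt => h;
  rewrite (_ : _ - _ = (dt g)^-1) ?invr_neq0 // /dt; field. Qed.
Lemma mcV g : mc (g^-1)%g = - mc g / dt g.
Proof. by rewrite mx2_invE mc_mx2 // /dt; have := dt_neq0 g; rewrite /dt => h;
  rewrite (_ : _ - _ = (dt g)^-1) ?invr_neq0 // /dt; field. Qed.
Lemma mdV g : md (g^-1)%g = ma g / dt g.
Proof. by rewrite mx2_invE md_mx2 // /dt; have := dt_neq0 g; rewrite /dt => h;
  rewrite (_ : _ - _ = (dt g)^-1) ?invr_neq0 // /dt; field. Qed.
Definition entryV := (maV, mbV, mcV, mdV).

Definition upper x := mx2 1 x 0 1.
Definition lower x := mx2 1 0 x 1.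
Definition diagm a d := mx2 a 0 0 d.
Definition antidiag b c := mx2 0 b c 0.
Definition scalm a := mx2 a 0 0 a.

Lemma upper_det_neq0 x : 1 * 1 - x *
  0 != 0 :> F. Proof. by rewrite mulr0 subr0 mulr1 oner_neq0. Qed.
Lemma lower_det_neq0 x : 1 * 1 - 0 *
  x != 0 :> F. Proof. by rewrite mul0r subr0 mulr1 oner_neq0. Qed.
Lemma diagm_det_neq0 a d : a != 0 -> d != 0 -> a * d - 0 * 0 != 0.
Proof. by move=> *; rewrite mulr0 subr0 mulf_neq0. Qed.
Lemma antidiag_det_neq0 b c : b != 0 -> c != 0 -> 0 * 0 - b * c != 0.
Proof. by move=> *; rewrite mulr0 sub0r oppr_eq0 mulf_neq0. Qed.

Lemma dt_mx2 a b c d : a * d - b * c != 0 -> dt (mx2 a b c d) = a * d - b * c.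
Proof. by move=> h; rewrite /dt !entry_mx2. Qed.

Lemma center_scalm g : Defs.center g <-> exists2 a, a != 0 & g = scalm a.
Proof.
split=> [[a e]|[a a0 ->]].
  have e1 : ma g = a by rewrite /ma e mxE.
  have e2 : mb g = 0 by rewrite /mb e mxE.
  have e3 : mc g = 0 by rewrite /mc e mxE.
  have e4 : md g = a by rewrite /md e mxE.
  have a0 : a != 0 by have := dt_neq0 g;
    rewrite /dt e1 e2 e3 e4 mul0r subr0 mulf_eq0 negb_or => /andP[].
  by exists a => //; rewrite [g]glE e1 e2 e3 e4.
exists a; apply/matrixP.
by apply: ord2_cases; apply: ord2_cases; rewrite mx2_val ?diagm_det_neq0 // !mxE.
Qed.

Lemma GL2val_scalm a : a != 0 -> GL2val (scalm a) = a%:M.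
Proof.
by move=> a0; apply/matrixP; apply: ord2_cases; apply: ord2_cases;
  rewrite mx2_val ?diagm_det_neq0 // !mxE.
Qed.

End GL2Entries.

(** * Cells of the Iwahori subgroup and their volumes *)

Section Iwahori.
Variables (R : realType) (q : nat) (F : padicField R q).
Hypothesis q_prime : prime q.
Local Notation G := (GL2 F).
Local Notation "`| x |_q" := (padic_abs x) (format "`| x |_q").
Local Notation Q := (q%:R : R).
Local Notation w := (q%:R : F).
Implicit Types (x y : F) (r : R) (g h k z : G).

Lemma absM_le x y r : `|x|_q <= r -> `|y|_q <= 1 -> `|x * y|_q <= r.
Proof.
by move=> hx hy; rewrite padic_absM; apply: le_trans hx; rewrite ler_piMr ?padic_abs_ge0.
Qed.

Lemma absM_lt x y r : `|x|_q < r -> `|y|_q <= 1 -> `|x * y|_q < r.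
Proof.
by move=> hx hy; rewrite padic_absM; apply: le_lt_trans hx; rewrite ler_piMr ?padic_abs_ge0.
Qed.

Lemma absM_ltr x y r : `|x|_q <= r -> 0 < r -> `|y|_q < 1 -> `|x * y|_q < r.
Proof.
move=> hx r0 hy; rewrite padic_absM; apply: (@le_lt_trans _ _ (r * `|y|_q)).
  by rewrite ler_wpM2r ?padic_abs_ge0.
by rewrite gtr_pMr.
Qed.

Lemma GL2_intE g : GL2_int g <->
  [/\ `|ma g|_q <= 1, `|mb g|_q <= 1, `|mc g|_q <= 1, `|md g|_q <= 1 & `|dt g|_q = 1].
Proof.
rewrite /GL2_int /= dtE; split=> [[h e]|[ha hb hc hd e]].
  by split=> //; apply: h.
by split=> //; apply: ord2_cases; apply: ord2_cases.
Qed.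

Definition Iw : set G := [set k | GL2_int k /\ `|mc k|_q < 1].

Lemma Iw_diag k : Iw k -> `|ma k|_q = 1 /\ `|md k|_q = 1.
Proof.
case=> /GL2_intE[ha hb hc hd e] hc1.
have e1 : `|ma k|_q * `|md k|_q = 1.
  rewrite -padic_absM -e /dt abs_subl // -[ma k * _](subrK (mb k * mc k)).
  by rewrite -/(dt k) abs_addl e //; rewrite mulrC absM_lt.
have a1 : `|ma k|_q = 1.
  apply/eqP; rewrite eq_le ha /= -e1 ler_piMr ?padic_abs_ge0 //.
by split=> //; move: e1; rewrite a1 mul1r.
Qed.

Lemma K2_1E k : K2 1 k <-> Iw k /\ `|md k - 1|_q < 1.
Proof.
rewrite /K2 /Iw /= expr1; split=> [[h [hc hd]]|[[h hc] hd]].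
  by split; [split=> //|]; apply: le_lt_trans (qV_lt1 R q_prime).
by split=> //; split; apply: abs_lt1.
Qed.

Lemma K2_0E k : K2 0 k <-> GL2_int k.
Proof.
rewrite /K2 /= expr0 invr1; split=> [[]//|h]; split=> //.
by have /GL2_intE[_ _ hc hd _] := h; split=> //; rewrite absB_le // abs1.
Qed.

Lemma dt_scalm (a : F) : a != 0 -> dt (scalm a) = a * a.
Proof. by move=> a0; rewrite dt_mx2 ?diagm_det_neq0 // mulr0 subr0. Qed.

Lemma entry_scalm (a : F) g : a != 0 ->
  [/\ ma (scalm a * g)%g = a * ma g, mb (scalm a * g)%g = a * mb g,
      mc (scalm a * g)%g = a * mc g & md (scalm a * g)%g = a * md g].
Proof.
by move=> a0; rewrite !entryM !entry_mx2 ?diagm_det_neq0 // !mul0r !addr0 !add0r.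
Qed.

Lemma scC (a : F) g : a != 0 -> (scalm a * g = g * scalm a)%g.
Proof.
move=> a0; apply: GL2_ext; rewrite !entryM !entry_mx2 ?diagm_det_neq0 //; ring.
Qed.

(** This is how I acts on vectors fixed by K2(q): only the central character of the lower right
    entry remains. *)
Lemma Iw_K2 k : Iw k -> exists k', K2 1 k' /\ k = (scalm (md k) * k')%g.
Proof.
move=> hk; have [a1 d1] := Iw_diag hk; have [/GL2_intE[ha hb hc hd e] hc1] := hk.
have d0 : md k != 0 by rewrite -abs_gt0 d1.
have d0' : (md k)^-1 != 0 by rewrite invr_eq0.
exists (scalm (md k)^-1 * k)%g; split; last first.
  apply: GL2_ext; rewrite !(entryM, entry_mx2) ?diagm_det_neq0 // !mul0r ?add0r ?addr0 ?mulVKf //.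
have [ea eb ec ed] := entry_scalm k d0'.
apply/K2_1E; split; last by rewrite ed mulVf // subrr abs0.
split; last by rewrite ec padic_absM absV d1 invr1 mul1r.
apply/GL2_intE; rewrite ea eb ec ed dtM dt_scalm // !padic_absM !absV d1 invr1 !mul1r.
by split.
Qed.

Definition ZI_invariant (S : set G) : Prop :=
  (forall z g, Defs.center z -> S g -> S (z * g)%g) /\
  (forall g k, Iw k -> S g -> S (g * k)%g).

(** I is an open subgroup: when h is close to g, the matrix g^-1 h is congruent to 1 and so lies in
    I. *)
Lemma right_invariant_open (S : set G) :
  (forall g k, Iw k -> S g -> S (g * k)%g) -> GL2_open S.
Proof.
move=> hS g Sg.
(* [M] bounds every entry of g^-1, and the summand 1 makes its positivity immediate. *)
pose M := 1 + `|ma (g^-1)%g|_q + `|mb (g^-1)%g|_q + `|mc (g^-1)%g|_q + `|md (g^-1)%g|_q.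
have := padic_abs_ge0 (ma (g^-1)%g); have := padic_abs_ge0 (mb (g^-1)%g).
have := padic_abs_ge0 (mc (g^-1)%g); have := padic_abs_ge0 (md (g^-1)%g) => hd hc hb ha.
have M0 : 0 < M by rewrite /M; lra.
exists M^-1; first by rewrite invr_gt0.
move=> h hh; rewrite -[h](mulVKg g); apply: hS => //.
have key x y : `|x|_q <= M -> `|y|_q < M^-1 -> `|x * y|_q < 1.
  move=> hx hy; rewrite padic_absM; apply: (@le_lt_trans _ _ (M * `|y|_q)).
    by rewrite ler_wpM2r ?padic_abs_ge0.
  by rewrite mulrC -ltr_pdivlMr // div1r.
pose i0 : 'I_2 := ord0; pose i1 : 'I_2 := ord_max.
have da : `|ma h - ma g|_q < M^-1 by exact: (hh i0 i0).
have db : `|mb h - mb g|_q < M^-1 by exact: (hh i0 i1).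
have dc : `|mc h - mc g|_q < M^-1 by exact: (hh i1 i0).
have dd : `|md h - md g|_q < M^-1 by exact: (hh i1 i1).
have ea : `|ma (g^-1 * h)%g - 1|_q < 1.
  rewrite -(ma1 F) -(mulVg g) !maM.
  rewrite (_ : _ - _ = ma (g^-1)%g * (ma h - ma g) + mb (g^-1)%g * (mc h - mc g)); last by ring.
  by apply: absD_lt; apply: key => //; rewrite /M; lra.
have eb : `|mb (g^-1 * h)%g|_q < 1.
  rewrite -[mb _]subr0 -[X in _ - X](mb1 F) -(mulVg g) !mbM.
  rewrite (_ : _ - _ = ma (g^-1)%g * (mb h - mb g) + mb (g^-1)%g * (md h - md g)); last by ring.
  by apply: absD_lt; apply: key => //; rewrite /M; lra.
have ec : `|mc (g^-1 * h)%g|_q < 1.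
  rewrite -[mc _]subr0 -[X in _ - X](mc1 F) -(mulVg g) !mcM.
  rewrite (_ : _ - _ = mc (g^-1)%g * (ma h - ma g) + md (g^-1)%g * (mc h - mc g)); last by ring.
  by apply: absD_lt; apply: key => //; rewrite /M; lra.
have ed : `|md (g^-1 * h)%g - 1|_q < 1.
  rewrite -(md1 F) -(mulVg g) !mdM.
  rewrite (_ : _ - _ = mc (g^-1)%g * (mb h - mb g) + md (g^-1)%g * (md h - md g)); last by ring.
  by apply: absD_lt; apply: key => //; rewrite /M; lra.
set k := (g^-1 * h)%g in ea eb ec ed *.
have a1 : `|ma k|_q = 1 by rewrite -[ma k](subrK 1) abs_addr abs1.
have d1 : `|md k|_q = 1 by rewrite -[md k](subrK 1) abs_addr abs1.
split=> //; apply/GL2_intE; split; rewrite ?a1 ?d1 //; [exact: ltW|exact: ltW|].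
have e1 : `|ma k * md k|_q = 1 by rewrite padic_absM a1 d1 mulr1.
by rewrite /dt abs_subl e1 // absM_lt // ltW.
Qed.

Lemma ZI_measurable (S : set G) : ZI_invariant S ->
  measurable (S : set (ZmodG F)).
Proof.
case=> hz hi; apply: sub_sigma_algebra; split; last by move=> z g; apply: hz.
exact: right_invariant_open.
Qed.

(* With t = diag(q, 1) and I the Iwahori subgroup, cell_d n = Z I t^n I and
   cell_a n = Z I t^(-n) I; these cells are cut out by which diagonal entry
   dominates the matrix. *)
Definition cell_d n : set G := [set g | [/\ `|mc g|_q < `|md g|_q, `|mb g|_q <= `|md g|_q,
  `|ma g|_q <= `|md g|_q & `|dt g|_q = Q^-1 ^+ n * `|md g|_q ^+ 2]].
Definition cell_a n : set G := [set g | [/\ `|mc g|_q < `|ma g|_q, `|mb g|_q <= `|ma g|_q,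
  `|md g|_q <= `|ma g|_q & `|dt g|_q = Q^-1 ^+ n * `|ma g|_q ^+ 2]].

Lemma cell_d_ZI n : ZI_invariant (cell_d n).
Proof.
split.
  move=> z g /center_scalm[a a0 ->] [hc hb ha e].
  have [ea eb ec ed] := entry_scalm g a0.
  have a1 : 0 < `|a|_q by rewrite abs_gt0.
  split; rewrite ?ea ?eb ?ec ?ed ?dtM ?dt_scalm // !padic_absM ?ler_pM2l ?ltr_pM2l //.
  by rewrite e; ring.
move=> g k hk [hc hb ha e].
have [a1 d1] := Iw_diag hk; have [/GL2_intE[ka kb kc kd ke] kc1] := hk.
have d0 : 0 < `|md g|_q by apply: le_lt_trans hc; exact: padic_abs_ge0.
have ed : `|md (g * k)%g|_q = `|md g|_q.
  have e1 : `|md g * md k|_q = `|md g|_q by rewrite padic_absM d1 mulr1.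
  by rewrite mdM abs_addr e1 // absM_lt.
split; rewrite ?ed.
- by rewrite mcM; apply: absD_lt; [apply: absM_lt|apply: absM_ltr].
- by rewrite mbM; apply: absD_le; apply: absM_le.
- by rewrite maM; apply: absD_le; apply: absM_le.
- by rewrite dtM padic_absM ke mulr1.
Qed.

Lemma cell_a_ZI n : ZI_invariant (cell_a n).
Proof.
split.
  move=> z g /center_scalm[a a0 ->] [hc hb ha e].
  have [ea eb ec ed] := entry_scalm g a0.
  have a1 : 0 < `|a|_q by rewrite abs_gt0.
  split; rewrite ?ea ?eb ?ec ?ed ?dtM ?dt_scalm // !padic_absM ?ler_pM2l ?ltr_pM2l //.
  by rewrite e; ring.
move=> g k hk [hc hb hd e].
have [a1 d1] := Iw_diag hk; have [/GL2_intE[ka kb kc kd ke] kc1] := hk.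
have d0 : 0 < `|ma g|_q by apply: le_lt_trans hc; exact: padic_abs_ge0.
have ea : `|ma (g * k)%g|_q = `|ma g|_q.
  have e1 : `|ma g * ma k|_q = `|ma g|_q by rewrite padic_absM a1 mulr1.
  by rewrite maM abs_addl e1 // absM_ltr.
split; rewrite ?ea.
- by rewrite mcM; apply: absD_lt; [apply: absM_lt|apply: absM_ltr].
- by rewrite mbM; apply: absD_le; apply: absM_le => //; exact: ltW.
- by rewrite mdM; apply: absD_le; apply: absM_le => //; exact: ltW.
- by rewrite dtM padic_absM ke mulr1.
Qed.

Lemma Q_expVI m n : Q^-1 ^+ m = Q^-1 ^+ n -> m = n.
Proof. by apply: ieexprIn; [exact: qV_gt0|rewrite lt_eqF ?qV_lt1]. Qed.

Lemma cell_d_disjoint m n g : cell_d m g -> cell_d n g -> m = n.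
Proof.
case=> hc _ _ e [_ _ _ e'].
have d0 : 0 < `|md g|_q ^+ 2 by rewrite exprn_gt0 // (le_lt_trans _ hc) ?padic_abs_ge0.
by apply: Q_expVI; apply: (mulIf (lt0r_neq0 d0)); rewrite -e -e'.
Qed.

Lemma cell_a_disjoint m n g : cell_a m g -> cell_a n g -> m = n.
Proof.
case=> hc _ _ e [_ _ _ e'].
have d0 : 0 < `|ma g|_q ^+ 2 by rewrite exprn_gt0 // (le_lt_trans _ hc) ?padic_abs_ge0.
by apply: Q_expVI; apply: (mulIf (lt0r_neq0 d0)); rewrite -e -e'.
Qed.

(** If both diagonal entries dominate, then |a| = |d| and |b c| < |d|^2, so the determinant has size
    |d|^2, which is exponent 0. *)
Lemma cell_d_cell_a_disjoint m n g : cell_d m g -> cell_a n g -> m = 0%N /\ n = 0%N.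
Proof.
case=> hc hb ha e [hc' hb' hd' e'].
have ead : `|ma g|_q = `|md g|_q by apply/eqP; rewrite eq_le ha.
have d0 : 0 < `|md g|_q by rewrite (le_lt_trans _ hc) ?padic_abs_ge0.
have ed : `|dt g|_q = `|md g|_q ^+ 2.
  have e1 : `|ma g * md g|_q = `|md g|_q ^+ 2 by rewrite padic_absM ead expr2.
  rewrite /dt abs_subl e1 // padic_absM expr2.
  apply: (@le_lt_trans _ _ (`|md g|_q * `|mc g|_q)); first by rewrite ler_wpM2r ?padic_abs_ge0.
  by rewrite ltr_pM2l.
have d2 : 0 < `|md g|_q ^+ 2 by rewrite exprn_gt0.
by split; apply: Q_expVI; apply: (mulIf (lt0r_neq0 d2));
  rewrite expr0 mul1r -?e ?ed // -ead -e' ed ead.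
Qed.

(** The two families share the cell Z I. In the decomposition of the integral the second family
    therefore starts at exponent 1. *)
Lemma cell_d0_cell_a0 : cell_d 0 = cell_a 0.
Proof.
apply/seteqP; split=> g [hc hb ha]; rewrite expr0 mul1r => e.
  have d0 : 0 < `|md g|_q by rewrite (le_lt_trans _ hc) ?padic_abs_ge0.
  have h : `|mb g * mc g|_q < `|md g|_q ^+ 2.
    rewrite padic_absM expr2; apply: (@le_lt_trans _ _ (`|md g|_q * `|mc g|_q));
      first by rewrite ler_wpM2r ?padic_abs_ge0.
    by rewrite ltr_pM2l.
  have : `|ma g * md g|_q = `|md g|_q ^+ 2.
    by rewrite -[ma g * _](subrK (mb g * mc g)) -/(dt g) abs_addl e.
  rewrite padic_absM expr2 => /(mulIf (lt0r_neq0 d0)) ead.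
  by split; rewrite ?ead // expr0 mul1r.
have d0 : 0 < `|ma g|_q by rewrite (le_lt_trans _ hc) ?padic_abs_ge0.
have h : `|mb g * mc g|_q < `|ma g|_q ^+ 2.
  rewrite padic_absM expr2; apply: (@le_lt_trans _ _ (`|ma g|_q * `|mc g|_q));
    first by rewrite ler_wpM2r ?padic_abs_ge0.
  by rewrite ltr_pM2l.
have : `|ma g * md g|_q = `|ma g|_q ^+ 2.
  by rewrite -[ma g * _](subrK (mb g * mc g)) -/(dt g) abs_addl e.
rewrite padic_absM expr2 => /(mulfI (lt0r_neq0 d0)) ead.
by split; rewrite ?ead // expr0 mul1r.
Qed.

End Iwahori.

(** * Coset decompositions of the cells and their Haar volumes *)

Section Volumes.
Variables (R : realType) (q : nat) (F : padicField R q).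
Hypothesis q_prime : prime q.
Local Notation G := (GL2 F).
Local Notation "`| x |_q" := (padic_abs x) (format "`| x |_q").
Local Notation Q := (q%:R : R).
Local Notation w := (q%:R : F).
Implicit Types (x y : F) (r : R) (g h k z : G).

(* For x = 0, ..., q - 1 these represent the left cosets of the Iwahori subgroup
   I in I diag(q, 1) I and in I diag(q^-1, 1) I. *)
Definition ucoset (x : F) : G := mx2 w x 0 1.
Definition lcoset (x : F) : G := mx2 w^-1 0 x 1.

Lemma ucoset_det_neq0 (x : F) : w * 1 - x * 0 != 0.
Proof. by rewrite mulr0 subr0 mulr1 natF_neq0. Qed.

Lemma lcoset_det_neq0 (x : F) : w^-1 * 1 - 0 * x != 0.
Proof. by rewrite mul0r subr0 mulr1 invr_eq0 natF_neq0. Qed.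

Lemma ucoset_inv (x : F) g : let h := ((ucoset x)^-1 * g)%g in
  [/\ ma h = (ma g - x * mc g) / w, mb h = (mb g - x * md g) / w,
      mc h = mc g & md h = md g].
Proof.
have w0 := natF_neq0 F q_prime.
rewrite /= !(entryM, entryV) dt_mx2 ?ucoset_det_neq0 // !entry_mx2 ?ucoset_det_neq0 //.
by split; field.
Qed.

Lemma lcoset_inv (x : F) g : let h := ((lcoset x)^-1 * g)%g in
  [/\ ma h = w * ma g, mb h = w * mb g,
      mc h = mc g - w * x * ma g & md h = md g - w * x * mb g].
Proof.
have w0 := natF_neq0 F q_prime.
rewrite /= !(entryM, entryV) dt_mx2 ?lcoset_det_neq0 // !entry_mx2 ?lcoset_det_neq0 //.
by rewrite mulr1 mul0r subr0 !invrK; split; field.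
Qed.

Lemma abs_w : `|w|_q = Q^-1. Proof. exact: padic_abs_q. Qed.

Let Q0 : 0 < Q := q_gt0 R q_prime.
Let QV0 : 0 < Q^-1 := qV_gt0 R q_prime.
Let QVle r : 0 <= r -> Q^-1 * r <= r.
Proof. by move=> r0; rewrite ler_piMl // ltW // qV_lt1. Qed.

Lemma dt1 : dt (1%g : G) = 1.
Proof. by rewrite /dt ma1 mb1 mc1 md1 mulr1 mulr0 subr0. Qed.

Lemma dtV g : dt (g^-1)%g = (dt g)^-1.
Proof.
by apply: (mulfI (dt_neq0 g)); rewrite -dtM mulgV mulfV ?dt_neq0 // dt1.
Qed.

Lemma dt_ucoset (x : F) : dt (ucoset x) = w.
Proof. by rewrite dt_mx2 ?ucoset_det_neq0 // mulr1 mulr0 subr0. Qed.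

Lemma dt_lcoset (x : F) : dt (lcoset x) = w^-1.
Proof. by rewrite dt_mx2 ?lcoset_det_neq0 // mulr1 mul0r subr0. Qed.

Lemma absM_lel x y r : `|x|_q <= 1 -> `|y|_q <= r -> `|x * y|_q <= r.
Proof. by move=> hx hy; rewrite mulrC absM_le. Qed.

Lemma cell_d_step_sub n g (x : F) : `|x|_q <= 1 -> cell_d n ((ucoset x)^-1 * g)%g ->
  cell_d n.+1 g /\ `|mb g - x * md g|_q <= Q^-1 * `|md g|_q.
Proof.
move=> x1; have [ea eb ec ed] := ucoset_inv x g.
case; rewrite ea eb ec ed dtM dtV dt_ucoset => hc hb ha e.
rewrite padic_absM absV abs_w invrK in e.
rewrite abs_div abs_w invrK in hb; rewrite abs_div abs_w invrK in ha.
have hb' : `|mb g - x * md g|_q <= Q^-1 * `|md g|_q by rewrite ler_pdivlMl // mulrC.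
have ha' : `|ma g - x * mc g|_q <= Q^-1 * `|md g|_q by rewrite ler_pdivlMl // mulrC.
have le1 := QVle (padic_abs_ge0 (md g)).
split=> //; split=> //.
- by rewrite -[mb g](subrK (x * md g)) absD_le ?(le_trans hb') // absM_lel.
- rewrite -[ma g](subrK (x * mc g)) absD_le ?(le_trans ha') // absM_lel //.
  exact: ltW.
- by rewrite exprS -mulrA -e mulKf // gt_eqF.
Qed.

Lemma cell_d_step_sup n g (x : F) : `|x|_q <= 1 -> cell_d n.+1 g ->
  `|mb g - x * md g|_q <= Q^-1 * `|md g|_q -> cell_d n ((ucoset x)^-1 * g)%g.
Proof.
move=> x1 [hc hb ha e] hx; have [ea eb ec ed] := ucoset_inv x g.
have d0 : 0 < `|md g|_q by apply: le_lt_trans hc; exact: padic_abs_ge0.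
have d0' : md g != 0 by rewrite -abs_gt0.
have hx' : `|ma g - x * mc g|_q <= Q^-1 * `|md g|_q.
  rewrite -(ler_pM2r d0) -padic_absM.
  have -> : (ma g - x * mc g) * md g = dt g + (mb g - x * md g) * mc g by rewrite /dt; ring.
  apply: absD_le.
    rewrite e exprS -!mulrA expr2 ler_pM2l // ler_piMl ?mulr_ge0 ?padic_abs_ge0 //.
    by apply: exprn_ile1; rewrite ?(ltW QV0) // ltW // qV_lt1.
  rewrite padic_absM; apply: ler_pM; rewrite ?padic_abs_ge0 //.
  exact: ltW.
split; rewrite ?ea ?eb ?ec ?ed //.
- by rewrite abs_div abs_w invrK mulrC -ler_pdivlMl.
- by rewrite abs_div abs_w invrK mulrC -ler_pdivlMl.
- by rewrite dtM dtV dt_ucoset padic_absM absV abs_w invrK e exprS -!mulrA mulVKf // gt_eqF.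
Qed.

(** The inverse of [ucoset] j subtracts j times the bottom row from the top row and divides the
    result by q. The entry d stays dominant exactly when j is the residue of b / d; the bound on the
    new a then follows from the determinant. *)
Lemma cell_d_step n g : cell_d n.+1 g <-> exists j : 'I_q, cell_d n ((ucoset j%:R)^-1 * g)%g.
Proof.
split=> [D|[j D]]; last by have [] := cell_d_step_sub (abs_nat F j) D.
have [hc hb _ _] := D.
have d0 : 0 < `|md g|_q by apply: le_lt_trans hc; exact: padic_abs_ge0.
have d0' : md g != 0 by rewrite -abs_gt0.
have [j hj] : exists j : 'I_q, `|mb g / md g - j%:R|_q < 1.
  by apply: residue => //; rewrite abs_div ler_pdivrMr // mul1r.
exists j; apply: cell_d_step_sup => //; first exact: abs_nat.
rewrite -ler_pdivrMr // -abs_div; apply: abs_lt1 => //.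
by rewrite mulrBl mulfK.
Qed.

Lemma cell_d_step_uniq n g (i j : 'I_q) :
  cell_d n ((ucoset i%:R)^-1 * g)%g -> cell_d n ((ucoset j%:R)^-1 * g)%g -> i = j.
Proof.
move=> Di Dj; have [_ hi] := cell_d_step_sub (abs_nat F i) Di.
have [[hc _ _ _] hj] := cell_d_step_sub (abs_nat F j) Dj.
have d0 : 0 < `|md g|_q by apply: le_lt_trans hc; exact: padic_abs_ge0.
apply: (residue_uniq (F := F)) => //; rewrite -(ltr_pM2r d0) -padic_absM mul1r.
have -> : (i%:R - j%:R) * md g = (mb g - j%:R * md g) - (mb g - i%:R * md g) by ring.
apply: (@le_lt_trans _ _ (Q^-1 * `|md g|_q)); first exact: absB_le.
by rewrite gtr_pMl // qV_lt1.
Qed.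

Lemma cell_a_step_sub n g (x : F) : `|x|_q <= 1 -> cell_a n ((lcoset x)^-1 * g)%g ->
  cell_a n.+1 g /\ `|mc g - w * x * ma g|_q < Q^-1 * `|ma g|_q.
Proof.
move=> x1; have [ea eb ec ed] := lcoset_inv x g.
case; rewrite ea eb ec ed dtM dtV dt_lcoset invrK !(padic_absM w) abs_w => hc hb hd e.
rewrite ler_pM2l // in hb.
have a0 : 0 < `|ma g|_q by rewrite -(pmulr_rgt0 _ QV0) (le_lt_trans _ hc) // padic_abs_ge0.
have wx : `|w * x * ma g|_q <= Q^-1 * `|ma g|_q.
  by rewrite !padic_absM abs_w ler_pM2r // ler_piMr // ltW.
have lt1 : Q^-1 * `|ma g|_q < `|ma g|_q by rewrite gtr_pMl // qV_lt1.
split=> //; split=> //.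
- rewrite -[mc g](subrK (w * x * ma g)) absD_lt //; first exact: lt_trans lt1.
  exact: le_lt_trans lt1.
- rewrite -[md g](subrK (w * x * mb g)) absD_le //; first exact: le_trans (ltW lt1).
  rewrite absM_lel // padic_absM abs_w.
  by apply: mulr_ile1; rewrite ?padic_abs_ge0 ?(ltW QV0) // ltW // qV_lt1.
- by apply: (mulfI (lt0r_neq0 QV0)); rewrite e (exprS _ n); ring.
Qed.

Lemma cell_a_step_sup n g (x : F) : `|x|_q <= 1 -> cell_a n.+1 g ->
  `|mc g - w * x * ma g|_q < Q^-1 * `|ma g|_q -> cell_a n ((lcoset x)^-1 * g)%g.
Proof.
move=> x1 [hc hb hd e] hx; have [ea eb ec ed] := lcoset_inv x g.
have a0 : 0 < `|ma g|_q by apply: le_lt_trans hc; exact: padic_abs_ge0.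
have hx' : `|md g - w * x * mb g|_q <= Q^-1 * `|ma g|_q.
  rewrite -(ler_pM2r a0) -padic_absM.
  have -> : (md g - w * x * mb g) * ma g = dt g + (mc g - w * x * ma g) * mb g by rewrite /dt;
    ring.
  apply: absD_le.
    rewrite e exprS -!mulrA expr2 ler_pM2l // ler_piMl ?mulr_ge0 ?padic_abs_ge0 //.
    by apply: exprn_ile1; rewrite ?(ltW QV0) // ltW // qV_lt1.
  by rewrite padic_absM; apply: ler_pM; rewrite ?padic_abs_ge0 // ltW.
split; rewrite ?ea ?eb ?ec ?ed //.
- by rewrite padic_absM abs_w.
- by rewrite !padic_absM abs_w ler_pM2l.
- by rewrite padic_absM abs_w.
- by rewrite dtM dtV dt_lcoset invrK !padic_absM abs_w e exprS; ring.
Qed.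

(** Now q j times the top row is subtracted from the bottom row, and j is the residue of c / (q a).
    This quotient is integral because the value group is discrete, so |c| < |a| gains a full factor
    1/q. *)
Lemma cell_a_step n g : cell_a n.+1 g <-> exists j : 'I_q, cell_a n ((lcoset j%:R)^-1 * g)%g.
Proof.
split=> [D|[j D]]; last by have [] := cell_a_step_sub (abs_nat F j) D.
have [hc _ _ _] := D.
have a0 : 0 < `|ma g|_q by apply: le_lt_trans hc; exact: padic_abs_ge0.
have a0' : ma g != 0 by rewrite -abs_gt0.
have w0 := natF_neq0 F q_prime.
have [j hj] : exists j : 'I_q, `|mc g / (w * ma g) - j%:R|_q < 1.
  apply: residue => //; rewrite abs_div padic_absM abs_w ler_pdivrMr ?mul1r ?mulr_gt0 //.
  exact: abs_ltM.
exists j; apply: cell_a_step_sup => //; first exact: abs_nat.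
rewrite -ltr_pdivrMr // -abs_div.
have -> : (mc g - w * j%:R * ma g) / ma g = w * (mc g / (w * ma g) - j%:R).
  by field; rewrite w0 a0'.
by rewrite padic_absM abs_w gtr_pMr.
Qed.

Lemma cell_a_step_uniq n g (i j : 'I_q) :
  cell_a n ((lcoset i%:R)^-1 * g)%g -> cell_a n ((lcoset j%:R)^-1 * g)%g -> i = j.
Proof.
move=> Di Dj; have [_ hi] := cell_a_step_sub (abs_nat F i) Di.
have [[hc _ _ _] hj] := cell_a_step_sub (abs_nat F j) Dj.
have a0 : 0 < `|ma g|_q by apply: le_lt_trans hc; exact: padic_abs_ge0.
apply: (residue_uniq (F := F)) => //; rewrite -(ltr_pM2r a0) -padic_absM mul1r.
rewrite -(ltr_pM2l QV0) -{1}abs_w -padic_absM.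
have -> : w * ((i%:R - j%:R) * ma g) =
  (mc g - w * j%:R * ma g) - (mc g - w * i%:R * ma g) by ring.
exact: absB_lt.
Qed.

(* Representatives of GL_2(Z_q) modulo the Iwahori subgroup. *)
Definition kcoset (j : option 'I_q) : G := if j is Some i then mx2 i%:R 1 1 0 else 1%g.

Lemma kcoset_det_neq0 (x : F) : x * 0 - 1 * 1 != 0.
Proof. by rewrite mulr0 mulr1 sub0r oppr_eq0 oner_neq0. Qed.

Lemma kcoset_inv (i : 'I_q) g : let h := ((kcoset (Some i))^-1 * g)%g in
  [/\ ma h = mc g, mb h = md g, mc h = ma g - i%:R * mc g & md h = mb g - i%:R * md g].
Proof.
rewrite /= !(entryM, entryV) dt_mx2 ?kcoset_det_neq0 // !entry_mx2 ?kcoset_det_neq0 //.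
by rewrite mulr0 mulr1 sub0r invrN1; split; ring.
Qed.

Definition ZK : set G := [set x | exists z k : G, [/\ Defs.center z, GL2_int k & x = (z * k)%g]].

Lemma ZK_E g : ZK g <-> exists a : F, [/\ a != 0,
  [/\ `|ma g|_q <= `|a|_q, `|mb g|_q <= `|a|_q, `|mc g|_q <= `|a|_q & `|md g|_q <= `|a|_q] &
  `|dt g|_q = `|a|_q ^+ 2].
Proof.
split=> [[z [k [/center_scalm[a a0 ->] /GL2_intE[ha hb hc hd e] ->]]]|[a [a0 [ha hb hc hd] e]]].
  exists a; have [-> -> -> ->] := entry_scalm k a0.
  split=> //; last by rewrite dtM dt_scalm // !padic_absM e mulr1.
  by rewrite !padic_absM !ler_piMr ?padic_abs_ge0.
have a1 : 0 < `|a|_q by rewrite abs_gt0.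
have a0' : a^-1 != 0 by rewrite invr_eq0.
exists (scalm a), (scalm a^-1 * g)%g; split.
- by apply/center_scalm; exists a.
- have [ea eb ec ed] := entry_scalm g a0'.
  apply/GL2_intE; rewrite ea eb ec ed dtM dt_scalm // !padic_absM absV e.
  by split; rewrite ?ler_pdivrMl ?mulr1 //; field; rewrite gt_eqF.
- apply: GL2_ext; have [ea eb ec ed] := entry_scalm g a0'.
  + by have [-> _ _ _] := entry_scalm (scalm a^-1 * g)%g a0; rewrite ea mulVKf.
  + by have [_ -> _ _] := entry_scalm (scalm a^-1 * g)%g a0; rewrite eb mulVKf.
  + by have [_ _ -> _] := entry_scalm (scalm a^-1 * g)%g a0; rewrite ec mulVKf.
  + by have [_ _ _ ->] := entry_scalm (scalm a^-1 * g)%g a0; rewrite ed mulVKf.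
Qed.

Lemma abs_dt_kcoset j : `|dt (kcoset j)|_q = 1.
Proof.
case: j => [i|] /=; last by rewrite dt1 abs1.
by rewrite dt_mx2 ?kcoset_det_neq0 // mulr0 mulr1 sub0r absN abs1.
Qed.

(** GL_2(Z_q) / I is the projective line over F_q, through the first column modulo q: the coset of 1
    if c vanishes there, and otherwise the coset of j = a / c. *)
Lemma ZK_step g : ZK g <-> exists j, cell_d 0 ((kcoset j)^-1 * g)%g.
Proof.
split=> [/ZK_E[a [a0 [ha hb hc hd] e]]|[j D]]; last first.
  apply/ZK_E; have [hc hb ha e] := D.
  have d0 : 0 < `|md ((kcoset j)^-1 * g)%g|_q by apply: le_lt_trans hc; exact: padic_abs_ge0.
  exists (md ((kcoset j)^-1 * g)%g); split; first by rewrite -abs_gt0.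
    case: j D hc hb ha e d0 => [i|] D.
      have [-> -> -> ->] := kcoset_inv i g => hc hb ha e d0.
      have i1 := abs_nat F i; split=> //.
      + rewrite -[ma g](subrK (i%:R * mc g)) absD_le // ?(ltW hc) //.
        by rewrite absM_lel.
      + rewrite -[X in `|X|_q <= _](subrK (i%:R * md g)) absD_le //.
        by rewrite absM_lel.
    by rewrite invg1 mul1g => hc hb ha e d0; split=> //; exact: ltW.
  by move: e; rewrite dtM dtV padic_absM absV abs_dt_kcoset invr1 !mul1r.
have a1 : 0 < `|a|_q by rewrite abs_gt0.
have [cd|dc] := ltP `|mc g|_q `|md g|_q.
  suff da : `|md g|_q = `|a|_q.
    by exists None; rewrite invg1 mul1g; split; rewrite ?da // -?da // expr0 mul1r e da.
  apply/eqP; rewrite eq_le hd /= leNgt; apply/negP => lt_da.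
  have : `|dt g|_q < `|a|_q ^+ 2.
    rewrite /dt expr2 absB_lt // padic_absM.
      by rewrite (le_lt_trans (ler_wpM2r _ ha)) ?padic_abs_ge0 // ltr_pM2l.
    by rewrite (le_lt_trans (ler_wpM2r _ hb)) ?padic_abs_ge0 // ltr_pM2l // (lt_trans cd).
  by rewrite e ltxx.
have ca : `|mc g|_q = `|a|_q.
  apply/eqP; rewrite eq_le hc /= leNgt; apply/negP => lt_ca.
  have : `|dt g|_q < `|a|_q ^+ 2.
    rewrite /dt expr2 absB_lt // padic_absM.
      by rewrite (le_lt_trans (ler_wpM2r _ ha)) ?padic_abs_ge0 // ltr_pM2l // (le_lt_trans dc).
    by rewrite (le_lt_trans (ler_wpM2r _ hb)) ?padic_abs_ge0 // ltr_pM2l.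
  by rewrite e ltxx.
have c0 : mc g != 0 by rewrite -abs_gt0 ca.
have [j hj] : exists j : 'I_q, `|ma g / mc g - j%:R|_q < 1.
  by apply: residue => //; rewrite abs_div ca ler_pdivrMr // mul1r.
have {}hj : `|ma g - j%:R * mc g|_q < `|a|_q.
  rewrite -ca -[X in _ < X]mul1r -ltr_pdivrMr ?ca // -ca -abs_div.
  by rewrite mulrBl mulfK.
have bj : `|mb g - j%:R * md g|_q <= `|a|_q.
  by rewrite absB_le // absM_lel // abs_nat.
have bj' : `|mb g - j%:R * md g|_q = `|a|_q.
  apply/eqP; rewrite eq_le bj /= -(ler_pM2l a1) -expr2 -e -{1}ca -padic_absM.
  have -> : dt g = (ma g - j%:R * mc g) * md g - mc g * (mb g - j%:R * md g) by rewrite /dt; ring.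
  rewrite -absN opprB abs_subl // ltNge; apply/negP => h.
  have : `|dt g|_q < `|a|_q ^+ 2.
    have -> : dt g = (ma g - j%:R * mc g) * md g - mc g * (mb g - j%:R * md g) by rewrite /dt;
      ring.
    have h1 : `|(ma g - j%:R * mc g) * md g|_q < `|a|_q ^+ 2.
      rewrite padic_absM expr2 (le_lt_trans (ler_wpM2l _ hd)) ?padic_abs_ge0 //.
      by rewrite ltr_pM2r.
    by apply: absB_lt => //; apply: le_lt_trans h1.
  by rewrite e ltxx.
exists (Some j); have [ea eb ec ed] := kcoset_inv j g.
split; rewrite ?ea ?eb ?ec ?ed bj' //.
by rewrite dtM dtV padic_absM absV abs_dt_kcoset invr1 mul1r e expr0 mul1r.
Qed.

Lemma ZK_step_uniq g i j : cell_d 0 ((kcoset i)^-1 * g)%g -> cell_d 0 ((kcoset j)^-1 * g)%g ->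
  i = j.
Proof.
have diff (i' : 'I_q) : cell_d 0 g -> cell_d 0 ((kcoset (Some i'))^-1 * g)%g -> False.
  case=> hc hb ha e; have [ea eb ec ed] := kcoset_inv i' g.
  case; rewrite ea eb ec ed => hc' hb' ha' e'; have bd : `|mb g - i'%:R * md g|_q <= `|md g|_q.
    by rewrite absB_le // absM_lel // abs_nat.
  have d0 : 0 < `|md g|_q by apply: le_lt_trans hc; exact: padic_abs_ge0.
  have : `|dt g|_q < `|md g|_q ^+ 2.
    have -> : dt g = (ma g - i'%:R * mc g) * md g - mc g * (mb g - i'%:R *
      md g) by rewrite /dt; ring.
    rewrite expr2 absB_lt // padic_absM.
      by rewrite ltr_pM2r // (lt_le_trans hc').
    by rewrite (le_lt_trans (ler_wpM2l _ bd)) ?padic_abs_ge0 // ltr_pM2r.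
  by rewrite e expr0 mul1r ltxx.
case: i j => [i|] [j|] //; rewrite ?invg1 ?mul1g.
- rewrite cell_d0_cell_a0 //; have [ea eb ec ed] := kcoset_inv i g;
  have [ea' eb' ec' ed'] := kcoset_inv j g.
  case; rewrite ea eb ec ed => hc _ _ _; case; rewrite ea' eb' ec' ed' => hc' _ _ _.
  congr Some; apply: (residue_uniq (F := F)) => //.
  have c0 : 0 < `|mc g|_q by apply: le_lt_trans hc; exact: padic_abs_ge0.
  rewrite -(ltr_pM2r c0) -padic_absM mul1r.
  have -> : (i%:R - j%:R) * mc g = (ma g - j%:R * mc g) - (ma g - i%:R * mc g) by ring.
  exact: absB_lt.
- by move=> h1 h2; case: (diff i).
- by move=> h1 h2; case: (diff j).
Qed.

Lemma ZI_translate (S : set G) h : ZI_invariant S -> ZI_invariant [set g | S (h^-1 * g)%g].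
Proof.
case=> hz hi; split=> [z g /center_scalm[a a0 ->] /= Sg|g k hk /= Sg]; last by rewrite mulgA;
  apply: hi.
by rewrite mulgA -scC // -mulgA; apply: hz => //; apply/center_scalm; exists a.
Qed.

Section Measure.
Variables (mu : {measure set (ZmodG F) -> \bar R}) (mu_haar : haar_measure mu).
Local Open Scope ereal_scope.

Lemma mu_translate (S : set G) h : ZI_invariant S ->
  mu ([set g | S (h^-1 * g)%g] : set (ZmodG F)) = mu (S : set (ZmodG F)).
Proof.
move=> hS; have [inv _] := mu_haar; rewrite -(inv h S); last exact: ZI_measurable.
congr (mu _); apply/seteqP; split=> [g /= Sg|_ [g Sg <-]] /=; last by rewrite mulKg.
by exists (h^-1 * g)%g => //; rewrite mulVKg.
Qed.

(** By left invariance of the Haar measure a volume is a number of cosets times the volume of one of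
    them. The same count serves the normalization and both recursions on the exponent. *)
Lemma mu_cosets (J : finType) (s : J -> G) (A D : set G) : ZI_invariant A ->
  (forall g, D g <-> exists j, A ((s j)^-1 * g)%g) ->
  (forall g i j, A ((s i)^-1 * g)%g -> A ((s j)^-1 * g)%g -> i = j) ->
  mu (D : set (ZmodG F)) = (#|J|%:R)%:E * mu (A : set (ZmodG F)).
Proof.
move=> hA hD uniq; pose X j : set (ZmodG F) := [set g | A ((s j)^-1 * g)%g].
have mX j : measurable (X j) by apply: ZI_measurable => //; apply: ZI_translate.
have -> : (D : set (ZmodG F)) = \big[setU/set0]_(i in 'I_#|J|) X (enum_val i).
  rewrite -bigcup_pred; apply/seteqP; split=> [g /hD[j Aj]|g [i _ Aj]].
    by exists (enum_rank j) => //; rewrite /X /= enum_rankK.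
  by apply/hD; exists (enum_val i).
rewrite measure_bigsetU_ord //; last first.
  by move=> i j _ _ [g [Ai Aj]]; apply: enum_val_inj; exact: uniq Ai Aj.
rewrite (eq_bigr (fun=> mu (A : set (ZmodG F)))); last by move=> i _; exact: mu_translate.
by rewrite big_const card_ord iter_addr addr0 mule_natl.
Qed.

Lemma mu_cell_d0 : mu (cell_d 0 : set (ZmodG F)) = ((Q + 1)^-1)%:E.
Proof.
have [_ ] := mu_haar; have := mu_cosets (cell_d_ZI F 0) ZK_step ZK_step_uniq.
rewrite card_option card_ord => -> /eqP h.
have q1 : (q.+1%:R != 0 :> R)%R by rewrite pnatr_eq0.
(* An infinite volume has to be excluded before dividing by q + 1; it contradicts the total volume
   1. *)
have : mu (cell_d 0 : set (ZmodG F)) \is a fin_num.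
  rewrite ge0_fin_numE //; apply: contraTT h; rewrite -leNgt leye_eq => /eqP ->.
  by rewrite gt0_muley // lte_fin ltr0n.
case: (mu _) h => [r|//|//] /= h _; congr EFin.
move: h; rewrite -EFinM eqe => /eqP h.
by apply: (mulfI q1); rewrite h -natr1 mulfV // natr1.
Qed.

Lemma mu_cell_d n : mu (cell_d n : set (ZmodG F)) = (Q ^+ n / (Q + 1))%:E.
Proof.
elim: n => [|n IH]; first by rewrite mu_cell_d0 expr0 mul1r.
rewrite (mu_cosets (cell_d_ZI F n) (cell_d_step n) (@cell_d_step_uniq n)) card_ord IH.
by rewrite -EFinM exprS mulrA.
Qed.

Lemma mu_cell_a n : mu (cell_a n : set (ZmodG F)) = (Q ^+ n / (Q + 1))%:E.
Proof.
elim: n => [|n IH]; first by rewrite -cell_d0_cell_a0 // mu_cell_d0 expr0 mul1r.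
rewrite (mu_cosets (cell_a_ZI F n) (cell_a_step n) (@cell_a_step_uniq n)) card_ord IH.
by rewrite -EFinM exprS mulrA.
Qed.

End Measure.

End Volumes.

(** * Hecke operators *)

Section Hecke.
Variables (R : realType) (q : nat) (F : padicField R q).
Hypothesis q_prime : prime q.
Local Notation C := (R[i]).
Local Notation G := (GL2 F).
Local Notation "`| x |_q" := (padic_abs x) (format "`| x |_q").
Local Notation Q := (q%:R : R).
Local Notation w := (q%:R : F).

Lemma abs_mulu (x y : F) : `|y|_q = 1 -> `|x * y|_q = `|x|_q.
Proof. by move=> y1; rewrite padic_absM y1 mulr1. Qed.

Lemma abs_divu (x y : F) : `|y|_q = 1 -> `|x / y|_q = `|x|_q.
Proof. by move=> y1; rewrite abs_div y1 divr1. Qed.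

Lemma GL2_int_mul (k l : G) : GL2_int k -> GL2_int l -> GL2_int (k * l)%g.
Proof.
move=> /GL2_intE[ha hb hc hd e] /GL2_intE[ha' hb' hc' hd' e'].
by apply/GL2_intE; rewrite dtM padic_absM e e' mulr1 !entryM; split=> //; apply: absD_le;
  apply: absM_le.
Qed.

Lemma GL2_int_inv (k : G) : GL2_int k -> GL2_int (k^-1)%g.
Proof.
move=> /GL2_intE[ha hb hc hd e].
by apply/GL2_intE; rewrite dtV absV e invr1 !entryV !abs_div !absN e invr1 !mulr1.
Qed.

Lemma K2_0_mul (k l : G) : K2 0 k -> K2 0 l -> K2 0 (k * l)%g.
Proof. by rewrite !K2_0E; exact: GL2_int_mul. Qed.

Lemma K2_0_inv (k : G) : K2 0 k -> K2 0 (k^-1)%g.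
Proof. by rewrite !K2_0E; exact: GL2_int_inv. Qed.

Lemma K2_1_sub_0 (k : G) : K2 1 k -> K2 0 k.
Proof. by move=> /(K2_1E q_prime)[[h _] _]; apply/K2_0E. Qed.

Lemma K2_1_mul (k l : G) : K2 1 k -> K2 1 l -> K2 1 (k * l)%g.
Proof.
move=> /(K2_1E q_prime)[[hk ck] dk] /(K2_1E q_prime)[[hl cl] dl]; apply/(K2_1E q_prime).
have /GL2_intE[ha hb hc hd e] := hk; have /GL2_intE[ha' hb' hc' hd' e'] := hl.
split; first split; first exact: GL2_int_mul.
  by rewrite mcM; apply: absD_lt; [exact: absM_lt|rewrite mulrC; exact: absM_lt].
rewrite mdM (_ : _ - 1 = mc k * mb l + (md k * (md l - 1) + (md k - 1))); last by ring.
by apply: absD_lt; [exact: absM_lt|apply: absD_lt => //; rewrite mulrC; exact: absM_lt].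
Qed.

Lemma K2_1_inv (k : G) : K2 1 k -> K2 1 (k^-1)%g.
Proof.
move=> /(K2_1E q_prime)[[hk ck] dk]; apply/(K2_1E q_prime).
have /GL2_intE[ha hb hc hd e] := hk.
split; first split; first exact: GL2_int_inv.
  by rewrite mcV abs_div absN e invr1 mulr1.
have d0 := dt_neq0 k.
rewrite mdV (_ : _ - 1 = ((1 - md k) * ma k + mc k * mb k) / dt k); last first.
  by apply: (mulIf d0); rewrite mulrBl !mulfVK // /dt; ring.
by rewrite abs_div e invr1 mulr1; apply: absD_lt; apply: absM_lt => //; rewrite absC.
Qed.

(* The elements of H permute the cosets (s j) H. *)
Lemma hecke_fixed (pi : smoothRep F) (H : set G) (J : finType) (s : J -> G) (x : pi) :
  (forall k, H k -> H (k^-1)%g) -> (forall k l, H k -> H l -> H (k * l)%g) ->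
  (forall k, H k -> rep_act pi k x = x) ->
  (forall k i, H k -> exists j, H ((s j)^-1 * (k * s i))%g) ->
  (forall i j, H ((s i)^-1 * s j)%g -> i = j) ->
  forall k, H k -> rep_act pi k (\sum_j rep_act pi (s j) x) = \sum_j rep_act pi (s j) x.
Proof.
move=> HV HM fixH ex uniq k Hk; rewrite linear_sum /=.
have /choice[sg hsg] i : exists j, H ((s j)^-1 * (k * s i))%g by exact: ex.
have sg_inj : injective sg.
  move=> i i' e; have h := hsg i; have h' := hsg i'; rewrite e in h.
  apply: uniq; have := HM _ _ (HV _ h) h'.
  have -> // : (((s (sg i'))^-1 * (k * s i))^-1 * ((s (sg i'))^-1 * (k * s i')) =
    (s i)^-1 * s i')%g.
  by apply: (mulgI ((s (sg i'))^-1 * (k * s i))%g); rewrite mulVKg -!mulgA mulVKg.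
rewrite [RHS](reindex_inj sg_inj) /=; apply: eq_bigr => i _.
by rewrite -rep_actM -[(k * s i)%g](mulVKg (s (sg i))) rep_actM fixH.
Qed.

Let w0 := natF_neq0 F q_prime.
Let QV0 := qV_gt0 R q_prime.

(** Representatives of the q + 1 left cosets of K = GL_2(Z_q) in K diag(q, 1) K; summing over them
    is the classical operator T_q. *)
Definition s_hecke (j : option 'I_q) : G := if j is Some i then ucoset i%:R else diagm 1 w.

Let diagw_det_neq0 : 1 * w - 0 * 0 != 0 :> F.
Proof. exact: diagm_det_neq0 (oner_neq0 _) w0. Qed.

Lemma diagw_inv g : let h := ((diagm 1 w)^-1 * g)%g in
  [/\ ma h = ma g, mb h = mb g, mc h = mc g / w & md h = md g / w].
Proof.
rewrite /= !(entryM, entryV) dt_mx2 ?diagw_det_neq0 // !entry_mx2 ?diagw_det_neq0 //.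
by rewrite mul1r mulr0 subr0; split; field.
Qed.

Lemma abs_dt_hecke j : `|dt (s_hecke j)|_q = Q^-1.
Proof.
case: j => [j|] /=; first by rewrite dt_ucoset // abs_w.
by rewrite dt_mx2 ?diagw_det_neq0 // mul1r mulr0 subr0 abs_w.
Qed.

Lemma abs_divw (x : F) : `|x|_q < 1 -> `|x / w|_q <= 1.
Proof.
by move=> h; rewrite abs_div abs_w ler_pdivrMr // mul1r; apply: abs_lt1.
Qed.

(** The matrix k s_i is integral with determinant of valuation 1, hence singular modulo q. Either
    its bottom row vanishes modulo q, giving diag(1, q), or its top row is j times its bottom row
    modulo q, giving [ucoset] j. *)
Lemma hecke_perm (k : G) i : K2 0 k -> exists j, K2 0 ((s_hecke j)^-1 * (k * s_hecke i))%g.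
Proof.
move/K2_0E => hk; have /GL2_intE[ha hb hc hd e] := hk.
set g := (k * s_hecke i)%g.
have dg1 : `|dt g|_q = Q^-1 by rewrite /g dtM padic_absM e abs_dt_hecke mul1r.
have hint : [/\ `|ma g|_q <= 1, `|mb g|_q <= 1, `|mc g|_q <= 1 & `|md g|_q <= 1].
  have : [/\ `|ma (s_hecke i)|_q <= 1, `|mb (s_hecke i)|_q <= 1,
    `|mc (s_hecke i)|_q <= 1 & `|md (s_hecke i)|_q <= 1].
    by case: (i) => [j|] /=; rewrite !entry_mx2 ?ucoset_det_neq0 ?diagw_det_neq0 //
      ?abs0 ?abs1 ?abs_nat.
  by case=> *; rewrite !entryM; split; apply: absD_le; apply: absM_le.
have [ga gb gc gd] := hint.
have dti j : `|dt ((s_hecke j)^-1 * g)%g|_q = 1.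
  by rewrite dtM dtV padic_absM absV abs_dt_hecke dg1 invrK mulfV // gt_eqF // q_gt0.
have [hcd|] := boolP ((`|mc g|_q < 1) && (`|md g|_q < 1)).
  have /andP[c1 d1] := hcd; exists None; apply/K2_0E/GL2_intE; rewrite dti.
  by have [-> -> -> ->] := diagw_inv g; split=> //; exact: abs_divw.
rewrite negb_and -!leNgt => hcd.
suff [j [h1 h2]] : exists j : 'I_q, `|ma g - j%:R * mc g|_q < 1 /\ `|mb g - j%:R * md g|_q < 1.
  exists (Some j); apply/K2_0E/GL2_intE; rewrite dti.
  by have [-> -> -> ->] := ucoset_inv q_prime j%:R g; split=> //; exact: abs_divw.
have dlt : `|dt g|_q < 1 by rewrite dg1 qV_lt1.
case/orP: hcd => [c1|d1].
  have {}c1 : `|mc g|_q = 1 by apply/eqP; rewrite eq_le gc.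
  have c0 : mc g != 0 by rewrite -abs_gt0 c1.
  have [j hj] : exists j : 'I_q, `|ma g / mc g - j%:R|_q < 1.
    by apply: residue => //; rewrite abs_div c1 invr1 mulr1.
  have h1 : `|ma g - j%:R * mc g|_q < 1.
    by rewrite -(abs_divu _ c1) mulrBl mulfK.
  exists j; split=> //.
  rewrite -(abs_mulu _ c1).
  rewrite (_ : _ * _ = (ma g - j%:R * mc g) * md g - dt g); last by rewrite /dt; ring.
  by apply: absB_lt => //; apply: absM_lt.
have {}d1 : `|md g|_q = 1 by apply/eqP; rewrite eq_le gd.
have d0 : md g != 0 by rewrite -abs_gt0 d1.
have [j hj] : exists j : 'I_q, `|mb g / md g - j%:R|_q < 1.
  by apply: residue => //; rewrite abs_div d1 invr1 mulr1.
have h1 : `|mb g - j%:R * md g|_q < 1.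
  by rewrite -(abs_divu _ d1) mulrBl mulfK.
exists j; split=> //.
rewrite -(abs_mulu _ d1).
rewrite (_ : _ * _ = (mb g - j%:R * md g) * mc g + dt g); last by rewrite /dt; ring.
by apply: absD_lt => //; apply: absM_lt.
Qed.

Lemma abs_wV_gt1 (x : F) : `|x / w|_q <= 1 -> `|x|_q < 1.
Proof.
rewrite abs_div abs_w ler_pdivrMr // mul1r => h; apply: le_lt_trans h _.
exact: qV_lt1.
Qed.

Lemma ucoset_uniq (i j : 'I_q) : `|mb ((ucoset i%:R)^-1 * ucoset j%:R : G)%g|_q <= 1 -> i = j.
Proof.
have [_ -> _ _] := ucoset_inv q_prime i%:R (ucoset j%:R : G).
rewrite !entry_mx2 ?ucoset_det_neq0 // mulr1 => /abs_wV_gt1 h.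
by apply/esym; apply: (residue_uniq q_prime h).
Qed.

Lemma hecke_uniq i j : K2 0 ((s_hecke i)^-1 * s_hecke j)%g -> i = j.
Proof.
move/K2_0E/GL2_intE; case: i j => [i|] [j|] //=.
- by case=> _ h _ _ _; congr Some; exact: ucoset_uniq.
- case=> + _ _ _ _; have [-> _ _ _] := ucoset_inv q_prime i%:R (diagm 1 w).
  by rewrite !entry_mx2 // mulr0 subr0 => /abs_wV_gt1; rewrite abs1 ltxx.
- case=> _ _ _ + _; have [_ _ _ ->] := diagw_inv (ucoset j%:R : G).
  by rewrite !entry_mx2 ?ucoset_det_neq0 // => /abs_wV_gt1; rewrite abs1 ltxx.
Qed.

(** For k in K2(q) the coset of diag(1, q) does not occur in [hecke_perm]: it would require c i + d
    to vanish modulo q, whereas c is congruent to 0 and d to 1. *)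
Lemma upper_perm (k : G) (i : 'I_q) : K2 1 k ->
  exists j : 'I_q, K2 1 ((ucoset j%:R)^-1 * (k * ucoset i%:R))%g.
Proof.
move=> hk; have /(K2_1E q_prime)[[ki kc] kd] := hk.
have [[j|] hj] := hecke_perm (Some i) (K2_1_sub_0 hk).
  exists j; apply/(K2_1E q_prime); move/K2_0E: hj => /= hj.
  have [_ _ ec ed] := ucoset_inv q_prime j%:R (k * ucoset i%:R)%g.
  split; first split=> //.
    rewrite ec mcM !entry_mx2 ?ucoset_det_neq0 // mulr0 addr0 absM_lt // abs_w ltW //.
    exact: qV_lt1.
  rewrite ed mdM !entry_mx2 ?ucoset_det_neq0 // mulr1 -addrA absD_lt // absM_lt //.
  exact: abs_nat.
move/K2_0E/GL2_intE: hj => [_ _ _ + _].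
have [_ _ _ ->] := diagw_inv (k * s_hecke (Some i))%g; move/abs_wV_gt1.
rewrite mdM /= !entry_mx2 ?ucoset_det_neq0 // mulr1 => h; exfalso.
have : `|mc k * i%:R + (md k - 1)|_q < 1 by apply: absD_lt => //; rewrite absM_lt // abs_nat.
rewrite addrA => h'; have := absB_lt h h'.
by rewrite subKr abs1 ltxx.
Qed.

Lemma upper_uniq (i j : 'I_q) : K2 1 ((ucoset i%:R)^-1 * ucoset j%:R : G)%g -> i = j.
Proof.
by move/K2_1_sub_0/K2_0E/GL2_intE => [_ h _ _ _]; exact: ucoset_uniq.
Qed.

(** The upper left entry a of k [lcoset] i is a unit divided by q, so q a is a unit and the residue
    of c / (q a) selects j. *)
Lemma lower_perm (k : G) (i : 'I_q) : K2 1 k ->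
  exists j : 'I_q, K2 1 ((lcoset j%:R)^-1 * (k * lcoset i%:R))%g.
Proof.
move=> hk; have /(K2_1E q_prime)[hI kd] := hk; have [a1 d1] := Iw_diag hI.
have [/GL2_intE[ha hb hc hd e] hc1] := hI.
set g := (k * lcoset i%:R)%g.
have ea : ma g = w^-1 * (ma k + w * mb k * i%:R).
  by rewrite maM !entry_mx2 ?lcoset_det_neq0 //; field.
have eb : mb g = mb k by rewrite mbM !entry_mx2 ?lcoset_det_neq0 // mulr0 add0r mulr1.
have ec : mc g = mc k / w + md k * i%:R by rewrite mcM !entry_mx2 ?lcoset_det_neq0.
have ed : md g = md k by rewrite mdM !entry_mx2 ?lcoset_det_neq0 // mulr0 add0r mulr1.
have wm : `|w * mb k * i%:R|_q < 1.
  by rewrite absM_lt ?abs_nat // absM_lt // abs_w qV_lt1.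
have wa : `|w * ma g|_q = 1 by rewrite ea mulVKf // abs_addl a1.
have wa0 : w * ma g != 0 by rewrite -abs_gt0 wa.
have gc : `|mc g|_q <= 1.
  by rewrite ec absD_le // ?abs_divw // absM_le // abs_nat.
have [j hj] : exists j : 'I_q, `|mc g / (w * ma g) - j%:R|_q < 1.
  by apply: residue => //; rewrite abs_div wa invr1 mulr1.
have h1 : `|mc g - w * j%:R * ma g|_q < 1.
  rewrite -(abs_divu _ wa).
  by rewrite (_ : _ / _ = mc g / (w * ma g) - j%:R) //; move: wa0;
    rewrite mulf_eq0 negb_or => /andP[_ a0]; field; rewrite w0 a0.
have wj : `|w * j%:R * mb k|_q < 1.
  by rewrite absM_lt // absM_lt ?abs_nat // abs_w qV_lt1.
exists j; apply/(K2_1E q_prime); rewrite /Iw /= GL2_intE.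
have [-> -> -> ->] := lcoset_inv q_prime j%:R g.
rewrite wa eb ed; split; first split=> //.
- split=> //.
  + by rewrite absM_le // abs_w ltW // qV_lt1.
  + exact: ltW.
  + by rewrite absB_le // ltW.
  + by rewrite dtM dtV dt_lcoset // invrK dtM dt_lcoset //
    !padic_absM absV abs_w e mul1r mulfV // gt_eqF.
- by rewrite addrAC absB_lt.
Qed.

Lemma lower_uniq (i j : 'I_q) : K2 1 ((lcoset i%:R)^-1 * lcoset j%:R : G)%g -> i = j.
Proof.
move/(K2_1E q_prime)=> [[_ +] _]; have [_ _ -> _] := lcoset_inv q_prime i%:R (lcoset j%:R : G).
rewrite !entry_mx2 ?lcoset_det_neq0 // mulrAC mulfV // mul1r => h.
by apply/esym; apply: (residue_uniq q_prime h).
Qed.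

End Hecke.

(** * Principal series *)

Section Characters.
Variables (R : realType) (q : nat) (F : padicField R q).
Hypothesis q_prime : prime q.
Local Notation C := (R[i]).
Local Notation "`| x |_q" := (padic_abs x) (format "`| x |_q").
Implicit Types (chi : F -> C) (x y : F).

Lemma qchar1 chi : quasicharacter chi -> chi 1 = 1.
Proof.
case=> nz M _; have := M 1 1 (oner_neq0 _) (oner_neq0 _); rewrite mulr1.
by move=> e; apply: (mulfI (nz _ (oner_neq0 _))); rewrite -e mulr1.
Qed.

Lemma qcharV chi x : quasicharacter chi -> x != 0 -> chi x^-1 = (chi x)^-1.
Proof.
move=> qc x0; have [nz M _] := qc; apply: (mulfI (nz _ x0)).
by rewrite -M ?invr_eq0 // !mulfV ?nz // qchar1.
Qed.

Lemma qchar_div chi x y : quasicharacter chi -> x != 0 -> y != 0 -> chi (x / y) = chi x / chi y.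
Proof. by move=> qc x0 y0; have [_ M _] := qc; rewrite M ?invr_eq0 // qcharV. Qed.

Lemma unramifiedE chi x y : quasicharacter chi -> unramified chi ->
  y != 0 -> `|x|_q = `|y|_q -> chi x = chi y.
Proof.
move=> qc un y0 e; have y1 : `|y|_q != 0 by rewrite abs_eq0.
have x0 : x != 0 by rewrite -abs_eq0 e.
have : chi (x / y) = 1 by apply: un; rewrite abs_div e mulfV.
by rewrite qchar_div // => /(canRL (mulfVK _)) ->; [rewrite mul1r|have [nz _ _] := qc; exact: nz].
Qed.

Lemma leastP (P : set nat) n : P n -> P (least P) /\ forall m, P m -> (least P <= m)%N.
Proof.
move=> Pn; have exP : exists n, `[< P n >] by exists n; apply/asboolP.
have [m Pm hm] := ex_minnP exP.
rewrite /least; case: xgetP => [k _ [Pk hk]|/(_ m)[]]; first by split.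
by split; [exact/asboolP|move=> k /asboolP; exact: hm].
Qed.

Lemma least_eq (P : set nat) n : P n -> (forall m, P m -> (n <= m)%N) -> least P = n.
Proof.
move=> Pn hn; have [Pl hl] := leastP Pn.
by apply/eqP; rewrite eqn_leq hl // hn.
Qed.

(** [least] returns 0 on the empty set, so only a nonzero value certifies a true minimum. This makes
    conductor exponent 1 informative. *)
Lemma least_neq0 (P : set nat) n : least P = n -> (n != 0)%N -> P n /\ forall m, P m ->
  (n <= m)%N.
Proof.
rewrite /least; case: xgetP => [k -> [Pk hk] <- _|_ <-]; [by split|by rewrite eqxx].
Qed.

End Characters.

Section Model.
Variables (R : realType) (q : nat) (F : padicField R q).
Hypothesis q_prime : prime q.
Local Notation C := (R[i]).
Local Notation G := (GL2 F).
Local Notation "`| x |_q" := (padic_abs x) (format "`| x |_q").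
Local Notation Q := (q%:R : R).
Local Notation w := (q%:R : F).

Let w0 := natF_neq0 F q_prime.

Definition sqrt_qV : C := (Num.sqrt (Q^-1))%:C%C.
Definition delta (x : F) : C := (Num.sqrt `|x|_q)%:C%C.

Lemma sqrt_qV_neq0 : sqrt_qV != 0.
Proof.
by rewrite /sqrt_qV fmorph_eq0 gt_eqF // sqrtr_gt0 qV_gt0.
Qed.

Lemma sqrt_qV_sqr : sqrt_qV ^+ 2 = (q%:R)^-1.
Proof.
rewrite /sqrt_qV -rmorphXn /= sqr_sqrtr ?ltW ?qV_gt0 //.
by rewrite fmorphV /= rmorph_nat.
Qed.

Lemma deltaM x y : delta (x * y) = delta x * delta y.
Proof. by rewrite /delta padic_absM sqrtrM ?padic_abs_ge0 // rmorphM. Qed.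

Lemma delta1 : delta 1 = 1.
Proof. by rewrite /delta abs1 sqrtr1. Qed.

Lemma delta_neq0 x : x != 0 -> delta x != 0.
Proof.
move=> x0; apply/eqP => e; have := delta1; rewrite -(mulfV x0) deltaM e mul0r => /eqP.
by rewrite eq_sym oner_eq0.
Qed.

Lemma deltaV x : delta x^-1 = (delta x)^-1.
Proof.
have [->|x0] := eqVneq x 0; first by rewrite invr0 /delta abs0 sqrtr0 rmorph0 invr0.
by apply: (mulfI (delta_neq0 x0)); rewrite -deltaM !mulfV ?delta1 ?delta_neq0.
Qed.

Lemma delta_w : delta w = sqrt_qV.
Proof. by rewrite /delta padic_abs_q. Qed.

Lemma delta_abs x y : `|x|_q = `|y|_q -> delta x = delta y.
Proof. by rewrite /delta => ->. Qed.

Definition weyl : G := antidiag 1 1.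

Lemma weyl_det_neq0 : 0 * 0 - 1 * 1 != 0 :> F.
Proof. exact: antidiag_det_neq0 (oner_neq0 _) (oner_neq0 _). Qed.

Lemma K2_0_weyl : K2 0 weyl.
Proof.
apply/K2_0E/GL2_intE; rewrite dt_mx2 ?weyl_det_neq0 // !entry_mx2 ?weyl_det_neq0 // abs0 abs1.
by rewrite mul0r mulr1 sub0r absN abs1; split.
Qed.

Lemma K2_1_lower (x : F) : `|x|_q < 1 -> K2 1 (lower x : G).
Proof.
move=> hx; apply/(K2_1E q_prime);
  rewrite /Iw /= GL2_intE dt_mx2 ?lower_det_neq0 // !entry_mx2 ?lower_det_neq0 //.
rewrite abs0 abs1 subrr abs0 mulr1 mul0r subr0 abs1; split=> //; split=> //; split=> //.
exact: ltW.
Qed.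

Lemma K2_1_upper (x : F) : `|x|_q <= 1 -> K2 1 (upper x : G).
Proof.
by move=> hx; apply/(K2_1E q_prime);
  rewrite /Iw /= GL2_intE dt_mx2 ?upper_det_neq0 // !entry_mx2 ?upper_det_neq0 //
  abs0 abs1 subrr abs0 mulr1 mulr0 subr0 abs1; do !split.
Qed.

Lemma K2_1_diagm (a d : F) : `|a|_q = 1 -> `|d|_q = 1 -> `|d - 1|_q < 1 -> K2 1 (diagm a d : G).
Proof.
move=> ha hd hd1; have a0 : a != 0 by rewrite -abs_gt0 ha.
have d0 : d != 0 by rewrite -abs_gt0 hd.
by apply/(K2_1E q_prime); rewrite /Iw /= GL2_intE dt_mx2 ?diagm_det_neq0 //
  !entry_mx2 ?diagm_det_neq0 //
  abs0 mulr0 subr0 padic_absM ha hd mulr1; do !split.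
Qed.

(** With the next lemma, G is the union of B K2(q) and B [weyl] K2(q), told apart by the test |c| <
    |d|. The unipotent factors on the right are those that K2(q) absorbs. *)
Lemma bruhat_small (g : G) : `|mc g|_q < `|md g|_q ->
  g = (mx2 (dt g / md g) (mb g) 0 (md g) * lower (mc g / md g))%g.
Proof.
move=> h; have d0 : md g != 0 by rewrite -abs_gt0 (le_lt_trans _ h) ?padic_abs_ge0.
have det_neq0 : dt g / md g * md g - mb g * 0 != 0 by rewrite mulr0 subr0 mulfVK // dt_neq0.
by apply: GL2_ext; rewrite !entryM !entry_mx2 ?lower_det_neq0 // /dt; field.
Qed.

Lemma bruhat_big (g : G) : mc g != 0 ->
  g = (mx2 (- dt g / mc g) (ma g) 0 (mc g) * (weyl * upper (md g / mc g)))%g.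
Proof.
move=> c0.
have det_neq0 : - dt g / mc g * mc g - ma g * 0 != 0 by rewrite mulr0 subr0 mulfVK //
  oppr_eq0 dt_neq0.
by apply: GL2_ext; rewrite !(entryM, entry_mx2) ?upper_det_neq0 ?weyl_det_neq0 // /dt; field.
Qed.

Section Fixed.
Variables (pi : smoothRep F) (chi : (F -> C) * (F -> C)) (T : pi -> G -> C).
Hypotheses (qc1 : quasicharacter chi.1) (qc2 : quasicharacter chi.2).
Hypothesis T_lin : forall (a : C) u v g, T (a *: u + v) g = a * T u g + T v g.
Hypothesis T_inj : injective T.
Hypothesis T_range : range T = induced_space chi.
Hypothesis T_act : forall g v h, T (rep_act pi g v) h = T v (h * g)%g.

Lemma model0 g : T 0 g = 0.
Proof.
have := T_lin 1 0 0 g; rewrite scaler0 addr0 mul1r => e.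
by apply: (addrI (T 0 g)); rewrite addr0 -e.
Qed.

Lemma modelD u v g : T (u + v) g = T u g + T v g.
Proof. by rewrite -[u]scale1r T_lin mul1r scale1r. Qed.

Lemma modelZ a v g : T (a *: v) g = a * T v g.
Proof. by rewrite -[a *: v]addr0 T_lin model0 addr0. Qed.

Lemma model_sum (J : finType) (f : J -> pi) g : T (\sum_j f j) g = \sum_j T (f j) g.
Proof. by apply: (big_morph (fun v => T v g)) => [u v|]; rewrite ?modelD ?model0. Qed.

Lemma model_eq u v : (forall g, T u g = T v g) -> u = v.
Proof. by move=> h; apply: T_inj; apply/funext. Qed.

Lemma model_ind v (b g : G) : mc b = 0 ->
  T v (b * g)%g = chi.1 (ma b) * chi.2 (md b) * delta (ma b / md b) * T v g.
Proof.
move=> b0; have : induced_space chi (T v) by rewrite -T_range; exists v.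
by case=> /(_ b g b0).
Qed.

Lemma model_fixed v k g : rep_act pi k v = v -> T v (g * k)%g = T v g.
Proof. by move=> e; rewrite -T_act e. Qed.

Section K2_1_fixed.
Variable v : pi.
Hypothesis fv : forall k, K2 1 k -> rep_act pi k v = v.

Lemma model_small g : `|mc g|_q < `|md g|_q ->
  T v g = chi.1 (dt g / md g) * chi.2 (md g) * delta (dt g / md g / md g) * T v 1%g.
Proof.
move=> h; have d0 : md g != 0 by rewrite -abs_gt0 (le_lt_trans _ h) ?padic_abs_ge0.
have det_neq0 : dt g / md g * md g - mb g * 0 != 0 by rewrite mulr0 subr0 mulfVK // dt_neq0.
have hl : `|mc g / md g|_q < 1 by rewrite abs_div ltr_pdivrMr ?mul1r // abs_gt0.
rewrite {1}(bruhat_small h) model_fixed; last by apply: fv; exact: K2_1_lower.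
by rewrite -[X in T v X]mulg1 model_ind ?entry_mx2.
Qed.

Lemma model_big g : `|md g|_q <= `|mc g|_q ->
  T v g = chi.1 (- dt g / mc g) * chi.2 (mc g) * delta (dt g / mc g / mc g) * T v weyl.
Proof.
move=> h; have c0 : mc g != 0.
  apply/negP => /eqP c0; move: h; rewrite c0 abs0 => h.
  have /eqP : `|md g|_q = 0 by apply/eqP; rewrite eq_le h padic_abs_ge0.
  by rewrite abs_eq0 => /eqP d0; have := dt_neq0 g; rewrite /dt c0 d0 !mulr0 subrr eqxx.
have det_neq0 : - dt g / mc g * mc g - ma g * 0 != 0 by rewrite mulr0 subr0 mulfVK //
  oppr_eq0 dt_neq0.
have hl : `|md g / mc g|_q <= 1 by rewrite abs_div ler_pdivrMr ?mul1r // abs_gt0.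
rewrite {1}(bruhat_big c0) mulgA model_fixed; last by apply: fv; exact: K2_1_upper.
rewrite model_ind ?entry_mx2 //; congr (_ * _ * _); apply: delta_abs.
by rewrite !abs_div absN.
Qed.

(** A function in the induced model fixed by K2(q) is determined by one value on each of the two
    double cosets. *)
Lemma model_fixed_eq0 : T v 1%g = 0 -> T v weyl = 0 -> v = 0.
Proof.
move=> h1 hW; apply: model_eq => g; rewrite model0.
have [h|h] := ltP `|mc g|_q `|md g|_q; first by rewrite model_small // h1 mulr0.
by rewrite model_big // hW mulr0.
Qed.

(** diag(a, d) lies both in B and in K2(q). It acts at once through the inducing characters and
    trivially, which is consistent with a nonzero value only if the characters give 1. *)
Lemma model_one_diagm (a d : F) : `|a|_q = 1 -> `|d|_q = 1 -> `|d - 1|_q < 1 ->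
  T v 1%g != 0 -> chi.1 a * chi.2 d = 1.
Proof.
move=> ha hd hd1 nz; apply: (mulIf nz); rewrite mul1r.
have a0 : a != 0 by rewrite -abs_gt0 ha.
have d0 : d != 0 by rewrite -abs_gt0 hd.
rewrite -[RHS](model_fixed _ (fv (K2_1_diagm ha hd hd1))) mul1g -[diagm a d]mulg1.
rewrite model_ind ?entry_mx2 ?diagm_det_neq0 //.
by rewrite (delta_abs (y := 1)) ?delta1 ?mulr1 // abs_div ha hd abs1 divr1.
Qed.

(** Moving diag(a, d) across [weyl] swaps its entries, hence the roles of the two inducing
    characters. *)
Lemma model_weyl_diagm (a d : F) : `|a|_q = 1 -> `|d|_q = 1 -> `|d - 1|_q < 1 ->
  T v weyl != 0 -> chi.1 d * chi.2 a = 1.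
Proof.
move=> ha hd hd1 nz; apply: (mulIf nz); rewrite mul1r.
have a0 : a != 0 by rewrite -abs_gt0 ha.
have d0 : d != 0 by rewrite -abs_gt0 hd.
rewrite -[RHS](model_fixed _ (fv (K2_1_diagm ha hd hd1))).
have -> : (weyl * diagm a d = diagm d a * weyl)%g.
  by apply: GL2_ext; rewrite !entryM !entry_mx2 ?diagm_det_neq0 ?weyl_det_neq0 //; ring.
rewrite model_ind ?entry_mx2 ?diagm_det_neq0 //.
by rewrite (delta_abs (y := 1)) ?delta1 ?mulr1 // abs_div ha hd abs1 divr1.
Qed.

Let one_sub : `|1 - 1 : F|_q < 1. Proof. by rewrite subrr abs0. Qed.

Lemma model_one_unramified : T v 1%g != 0 -> unramified chi.1.
Proof.
by move=> nz a ha; have := model_one_diagm ha (abs1 F) one_sub nz; rewrite (qchar1 qc2) mulr1.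
Qed.

Lemma model_one_unit d : T v 1%g != 0 -> `|d|_q = 1 -> `|d - 1|_q < 1 -> chi.2 d = 1.
Proof.
by move=> nz hd hd1; have := model_one_diagm (abs1 F) hd hd1 nz; rewrite (qchar1 qc1) mul1r.
Qed.

Lemma model_weyl_unramified : T v weyl != 0 -> unramified chi.2.
Proof.
by move=> nz a ha; have := model_weyl_diagm ha (abs1 F) one_sub nz; rewrite (qchar1 qc1) mul1r.
Qed.

Lemma model_weyl_unit d : T v weyl != 0 -> `|d|_q = 1 -> `|d - 1|_q < 1 -> chi.1 d = 1.
Proof.
by move=> nz hd hd1; have := model_weyl_diagm (abs1 F) hd hd1 nz; rewrite (qchar1 qc2) mulr1.
Qed.

End K2_1_fixed.

Lemma model_spherical_eq0 v : (forall k, K2 0 k -> rep_act pi k v = v) -> T v 1%g = 0 -> v = 0.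
Proof.
move=> fv h1; have fv1 k : K2 1 k -> rep_act pi k v = v.
  by move/(K2_1_sub_0 q_prime); exact: fv.
apply: (model_fixed_eq0 fv1) => //.
by rewrite -h1 -[weyl]mul1g model_fixed //; apply: fv; exact: K2_0_weyl.
Qed.

Let diagw_det_neq0 : 1 * w - 0 * 0 != 0 :> F.
Proof. exact: diagm_det_neq0 (oner_neq0 _) w0. Qed.

(** Spherical vectors are determined by their value at 1, so the eigenvalue is read off there: the q
    upper representatives give q q^(-1/2) chi.1(q), and diag(1, q) gives q^(1/2) chi.2(q). *)
Lemma spherical_eigen v : (forall k, K2 0 k -> rep_act pi k v = v) ->
  \sum_j rep_act pi (s_hecke F j) v = (sqrt_qV^-1 * (chi.1 w + chi.2 w)) *: v.
Proof.
move=> fv; set y := \sum_j _.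
have fy k : K2 0 k -> rep_act pi k y = y.
  apply: hecke_fixed => //.
  - exact: K2_0_inv.
  - exact: K2_0_mul.
  - by move=> {}k i; exact: hecke_perm.
  - by move=> i j; exact: hecke_uniq.
apply/eqP; rewrite -subr_eq0; apply/eqP; apply: model_spherical_eq0.
  by move=> k hk; rewrite linearB linearZ /= fv // fy.
have -> (a b : pi) : T (a - b) 1%g = T a 1%g - T b 1%g.
  by rewrite modelD -scaleN1r modelZ mulN1r.
apply/eqP; rewrite subr_eq0; apply/eqP; rewrite modelZ model_sum.
have q1 := qchar1 qc1; have q2 := qchar1 qc2.
have e1 : T (rep_act pi (diagm 1 w) v) 1%g = chi.2 w * sqrt_qV^-1 * T v 1%g.
  rewrite T_act mul1g -[diagm 1 w]mulg1 model_ind !entry_mx2 //.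
  by rewrite q1 !mul1r deltaV delta_w.
have e2 (i : 'I_q) : T (rep_act pi (ucoset i%:R) v) 1%g = chi.1 w * sqrt_qV * T v 1%g.
  rewrite T_act mul1g -[ucoset _]mulg1 model_ind !entry_mx2 ?ucoset_det_neq0 //.
  by rewrite q2 mulr1 divr1 delta_w.
rewrite (bigD1 None) //= e1 (reindex_onto Some (fun j => odflt (Ordinal (prime_gt0 q_prime))
  j)) /=; last by case.
under eq_bigr => i _ do rewrite e2.
rewrite sumr_const; have -> : #|[pred i : 'I_q | true && (i == i)]| = q.
  by rewrite -[RHS]card_ord; apply: eq_card => i; rewrite !inE eqxx.
rewrite -[X in _ + X]mulr_natl; have u0 := sqrt_qV_neq0.
have -> : (q%:R : C) = sqrt_qV ^- 2 by rewrite sqrt_qV_sqr invrK.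
by field.
Qed.

Definition K2_1_fixed v := forall k, K2 1 k -> rep_act pi k v = v.

Lemma upper_sum_fixed v : K2_1_fixed v -> K2_1_fixed (\sum_(j < q) rep_act pi (ucoset j%:R) v).
Proof.
move=> fv; apply: hecke_fixed => //.
- exact: K2_1_inv.
- exact: K2_1_mul.
- by move=> k i; exact: upper_perm.
- by move=> i j; exact: upper_uniq.
Qed.

Lemma lower_sum_fixed v : K2_1_fixed v -> K2_1_fixed (\sum_(j < q) rep_act pi (lcoset j%:R) v).
Proof.
move=> fv; apply: hecke_fixed => //.
- exact: K2_1_inv.
- exact: K2_1_mul.
- by move=> k i; exact: lower_perm.
- by move=> i j; exact: lower_uniq.
Qed.

Lemma model_eigen v y c h : K2_1_fixed v -> K2_1_fixed y ->
  (forall x, K2_1_fixed x -> T x h = 0 -> x = 0) -> T y h = c * T v h -> y = c *: v.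
Proof.
move=> fv fy inj e; apply/eqP; rewrite -subr_eq0; apply/eqP; apply: inj.
  by move=> k hk; rewrite linearB linearZ /= fv // fy.
by rewrite modelD -scaleN1r !modelZ e; ring.
Qed.

Lemma ramified2_model_weyl v : ~ unramified chi.2 -> K2_1_fixed v -> T v weyl = 0.
Proof.
by move=> ram fv; apply/eqP/negPn/negP => nz; apply: ram; exact: (@model_weyl_unramified v).
Qed.

Lemma ramified1_model_one v : ~ unramified chi.1 -> K2_1_fixed v -> T v 1%g = 0.
Proof.
by move=> ram fv; apply/eqP/negPn/negP => nz; apply: ram; exact: (@model_one_unramified v).
Qed.

Lemma ramified2_model_inj : ~ unramified chi.2 ->
  forall v, K2_1_fixed v -> T v 1%g = 0 -> v = 0.
Proof. by move=> ram v fv h; apply: model_fixed_eq0 => //; exact: ramified2_model_weyl. Qed.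

Lemma ramified1_model_inj : ~ unramified chi.1 ->
  forall v, K2_1_fixed v -> T v weyl = 0 -> v = 0.
Proof. by move=> ram v fv h; apply: model_fixed_eq0 => //; exact: ramified1_model_one. Qed.

Lemma abs_ord (j : 'I_q) : (j : nat) != 0%N -> `|j%:R : F|_q = 1.
Proof.
move=> j0; apply: abs_coprime => //; apply/negP => /dvdn_leq; rewrite lt0n => /(_ j0).
by rewrite leqNgt ltn_ord.
Qed.

Let qE : (q%:R : C) = sqrt_qV ^- 2. Proof. by rewrite sqrt_qV_sqr invrK. Qed.
Let z0 : 'I_q := Ordinal (prime_gt0 q_prime).
Let qc2_neq0 (x : F) : x != 0 -> chi.2 x != 0. Proof. by have [h _ _] := qc2; exact: h. Qed.

(** With chi.2 ramified v vanishes at [weyl] and is determined at 1, where each of the q upper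
    triangular representatives contributes q^(-1/2) chi.1(q). *)
Lemma upper_eigen1 v : ~ unramified chi.2 -> K2_1_fixed v ->
  \sum_(j < q) rep_act pi (ucoset j%:R) v = (sqrt_qV^-1 * chi.1 w) *: v.
Proof.
move=> ram fv; apply: (model_eigen fv (upper_sum_fixed fv) (ramified2_model_inj ram)).
rewrite model_sum (eq_bigr (fun=> chi.1 w * sqrt_qV * T v 1%g)).
  rewrite sumr_const card_ord -[LHS]mulr_natl qE; have u0 := sqrt_qV_neq0.
  by field.
move=> j _; rewrite T_act mul1g -[ucoset _]mulg1 model_ind !entry_mx2 ?ucoset_det_neq0 //.
by rewrite (qchar1 qc2) mulr1 divr1 delta_w.
Qed.

(** Only j = 0 contributes: for 0 < j < q the entry j is a unit, so the representative lies in the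
    double coset of [weyl], where v vanishes. *)
Lemma lower_eigen1 v : ~ unramified chi.2 -> K2_1_fixed v ->
  \sum_(j < q) rep_act pi (lcoset j%:R) v = (sqrt_qV^-1 * (chi.1 w)^-1) *: v.
Proof.
move=> ram fv; apply: (model_eigen fv (lower_sum_fixed fv) (ramified2_model_inj ram)).
rewrite model_sum (bigD1 z0) //= [X in _ + X]big1 ?addr0 => [|j jz0].
  rewrite T_act mul1g -[lcoset _]mulg1 model_ind !entry_mx2 ?lcoset_det_neq0 //.
  by rewrite (qchar1 qc2) (qcharV qc1) // mulr1 divr1 deltaV delta_w; congr (_ * _);
    rewrite mulrC.
rewrite T_act mul1g model_big //; last by rewrite !entry_mx2 ?lcoset_det_neq0 // abs1 abs_ord.
by rewrite ramified2_model_weyl // mulr0.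
Qed.

(** With chi.1 ramified v lives on the double coset of [weyl], and the pattern is reversed: one
    surviving term for the upper sum, q equal terms for the lower one. Both cases yield the same
    formula in the unramified character. *)
Lemma upper_eigen2 v : ~ unramified chi.1 -> K2_1_fixed v ->
  \sum_(j < q) rep_act pi (ucoset j%:R) v = (sqrt_qV^-1 * chi.2 w) *: v.
Proof.
move=> ram fv; apply: (model_eigen fv (upper_sum_fixed fv) (ramified1_model_inj ram)).
have ent (x : F) : [/\ mc (weyl * ucoset x)%g = w,
  md (weyl * ucoset x)%g = x & dt (weyl * ucoset x)%g = - w].
  by rewrite dtM dt_ucoset // dt_mx2 ?weyl_det_neq0 //
    !entryM !entry_mx2 ?ucoset_det_neq0 ?weyl_det_neq0 //; split; ring.
rewrite model_sum (bigD1 z0) //= [X in _ + X]big1 ?addr0 => [|j jz0].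
  rewrite T_act model_big //; have [ec ed e] := ent 0; rewrite /= ec ?ed ?abs0 ?padic_abs_ge0 //.
  rewrite e opprK mulfV // (qchar1 qc1) mul1r mulNr mulfV // mulNr div1r.
  rewrite (delta_abs (y := w^-1)) ?absN // deltaV delta_w; by congr (_ * _); rewrite mulrC.
rewrite T_act model_small //; have [ec ed e] := ent j%:R;
  rewrite ?ec ?ed ?abs_ord ?abs_w ?qV_lt1 //.
by rewrite ramified1_model_one // mulr0.
Qed.

Lemma lower_eigen2 v : ~ unramified chi.1 -> K2_1_fixed v ->
  \sum_(j < q) rep_act pi (lcoset j%:R) v = (sqrt_qV^-1 * (chi.2 w)^-1) *: v.
Proof.
move=> ram fv; apply: (model_eigen fv (lower_sum_fixed fv) (ramified1_model_inj ram)).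
have ent (x : F) : [/\ mc (weyl * lcoset x)%g = w^-1,
  md (weyl * lcoset x)%g = 0 & dt (weyl * lcoset x)%g = - w^-1].
  by rewrite dtM dt_lcoset // dt_mx2 ?weyl_det_neq0 //
    !entryM !entry_mx2 ?lcoset_det_neq0 ?weyl_det_neq0 //; split; ring.
have wV0 : w^-1 != 0 by rewrite invr_eq0.
rewrite model_sum (eq_bigr (fun=> (chi.2 w)^-1 * sqrt_qV * T v weyl)).
  rewrite sumr_const card_ord -[LHS]mulr_natl qE; have u0 := sqrt_qV_neq0.
  by have c0 := qc2_neq0 w0; field; rewrite u0 c0.
move=> j _; rewrite T_act; have [ec ed e] := ent j%:R.
rewrite model_big //; last by rewrite ed abs0 padic_abs_ge0.
rewrite ec e opprK mulfV // (qchar1 qc1) mul1r (qcharV qc2) // mulNr mulfV // mulNr div1r invrK.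
by rewrite (delta_abs (y := w)) ?absN // delta_w.
Qed.

(** If g = b k is an Iwasawa decomposition, this is the lower right entry of b up to a unit. *)
Definition row_max (g : G) : F := if `|mc g|_q < `|md g|_q then md g else mc g.

Lemma abs_row_max g : `|row_max g|_q = Num.max `|mc g|_q `|md g|_q.
Proof. by rewrite /row_max; case: ltP. Qed.

Lemma row_max_neq0 g : row_max g != 0.
Proof.
rewrite -abs_gt0 abs_row_max lt_max !abs_gt0 -negb_and; apply/negP => /andP[/eqP c0 /eqP d0].
by have := dt_neq0 g; rewrite /dt c0 d0 !mulr0 subrr eqxx.
Qed.

Lemma abs_row_maxK g k : GL2_int k -> `|row_max (g * k)%g|_q = `|row_max g|_q.
Proof.
suff le g' k' : GL2_int k' -> `|row_max (g' * k')%g|_q <= `|row_max g'|_q.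
  move=> hk; apply/eqP; rewrite eq_le le //=.
  by have := le (g * k)%g _ (GL2_int_inv hk); rewrite mulgK.
move=> /GL2_intE[ha hb hc hd e].
have hc' : `|mc g'|_q <= `|row_max g'|_q by rewrite abs_row_max le_max lexx.
have hd' : `|md g'|_q <= `|row_max g'|_q by rewrite abs_row_max le_max lexx orbT.
rewrite [leLHS]abs_row_max ge_max mcM mdM.
by apply/andP; split; apply: absD_le; apply: absM_le.
Qed.

(* By the Iwasawa decomposition the spherical function depends on g only through
   det g and the absolute value of its bottom row. *)
Lemma spherical_exists : unramified chi.1 -> unramified chi.2 ->
  exists2 v, v != 0 & forall k, K2 0 k -> rep_act pi k v = v.
Proof.
move=> un1 un2.
pose f (g : G) : C := chi.1 (dt g / row_max g) * chi.2 (row_max g) *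
  delta (dt g / row_max g / row_max g).
have fK g k : GL2_int k -> f (g * k)%g = f g.
  move=> hk; have [] := GL2_intE k; case/(_ hk) => _ _ _ _ e _.
  have m0 := row_max_neq0 g; have d0 := dt_neq0 g.
  have em : `|row_max (g * k)%g|_q = `|row_max g|_q by exact: abs_row_maxK.
  have ed : `|dt (g * k)%g|_q = `|dt g|_q by rewrite dtM padic_absM e mulr1.
  rewrite /f; congr (_ * _ * _).
  - by apply: unramifiedE => //; [rewrite mulf_neq0 ?invr_eq0|rewrite !abs_div em ed].
  - by apply: unramifiedE.
  - by apply: delta_abs; rewrite !abs_div em ed.
have f_ind : induced_space chi f.
  split=> [b g b0|].
    have eb : dt b = ma b * md b by rewrite /dt [mc b]b0 mulr0 subr0.
    have := dt_neq0 b; rewrite eb mulf_eq0 negb_or => /andP[a0 d0].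
    have em : row_max (b * g)%g = md b * row_max g.
      rewrite /row_max mcM mdM [mc b]b0 !mul0r !add0r !padic_absM ltr_pM2l ?abs_gt0 //.
      by case: ifP.
    have m0 := row_max_neq0 g; have dg0 := dt_neq0 g.
    have [_ M1 _] := qc1; have [_ M2 _] := qc2.
    rewrite -/(ma b) -/(md b) -/(delta (ma b / md b)) /f em dtM eb.
    have -> : ma b * md b * dt g / (md b * row_max g) = ma b * (dt g / row_max g).
      by field; rewrite m0 d0.
    have -> : ma b * (dt g / row_max g) / (md b * row_max g) =
      (ma b / md b) * (dt g / row_max g / row_max g).
      by field; rewrite m0 d0.
    by rewrite M1 ?M2 ?deltaM ?mulf_neq0 ?invr_eq0 //; ring.
  exists (@GL2_int R q F); split.
  - apply: right_invariant_open => g k [hk _] hg; exact: GL2_int_mul.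
  - by apply/GL2_intE; rewrite dt1 ma1 mb1 mc1 md1 abs0 abs1; split.
  - by move=> g k hk; exact: fK.
have : range T f by rewrite T_range.
case=> v _ Tv; exists v.
  apply/negP => /eqP v0; have : f 1%g = 0 by rewrite -Tv v0 model0.
  have [n1 _ _] := qc1; have [n2 _ _] := qc2.
  have m0 := row_max_neq0 1%g; have d0 := dt_neq0 (1%g : G).
  apply/eqP; rewrite /f !mulf_neq0 ?n1 ?n2 ?delta_neq0 ?mulf_neq0 ?invr_eq0 //.
by move=> k /K2_0E hk; apply: model_eq => g; rewrite T_act Tv fK.
Qed.

End Fixed.

End Model.

(** * Matrix coefficients *)

Section Coefficients.
Variables (R : realType) (q : nat) (F : padicField R q).
Hypothesis q_prime : prime q.
Local Notation C := (R[i]).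
Local Notation G := (GL2 F).
Local Notation "`| x |_q" := (padic_abs x) (format "`| x |_q").
Local Notation Q := (q%:R : R).
Local Notation w := (q%:R : F).

Let w0 := natF_neq0 F q_prime.
Let wn0 n : w ^+ n != 0. Proof. by rewrite expf_neq0. Qed.

Definition tpow n : G := diagm (w ^+ n) 1.

Let tpow_det_neq0 n : w ^+ n * 1 - 0 * 0 != 0 :> F.
Proof. exact: diagm_det_neq0 (wn0 n) (oner_neq0 _). Qed.

Variables (pi : smoothRep F) (ip : pi -> pi -> C) (x : pi).
Hypotheses (ip_inv : invariant_inner_product ip) (x0 : x != 0).

Notation Phi := (normalized_coeff ip x).

Let ip_lin a u v z : ip (a *: u + v) z = a * ip u z + ip v z.
Proof. by have [h _ _ _] := ip_inv; exact: h. Qed.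
Let ip_herm u v : ip v u = conjc (ip u v).
Proof. by have [_ h _ _] := ip_inv; exact: h. Qed.
Let ip_act g u v : ip (rep_act pi g u) (rep_act pi g v) = ip u v.
Proof. by have [_ _ _ h] := ip_inv; exact: h. Qed.
Let ip_neq0 : ip x x != 0.
Proof. by have [_ _ h _] := ip_inv; rewrite gt_eqF // h. Qed.

Let ip0 z : ip 0 z = 0.
Proof.
have := ip_lin 1 0 0 z; rewrite scaler0 addr0 mul1r => e.
by apply: (addrI (ip 0 z)); rewrite addr0 -e.
Qed.

Let ipZ a u z : ip (a *: u) z = a * ip u z.
Proof. by rewrite -[a *: u]addr0 ip_lin ip0 addr0. Qed.

Let ipD u v z : ip (u + v) z = ip u z + ip v z.
Proof. by rewrite -[u]scale1r ip_lin mul1r scale1r. Qed.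

Let ipZr a u z : ip u (a *: z) = conjc a * ip u z.
Proof. by rewrite ip_herm ipZ rmorphM /= -ip_herm. Qed.

Lemma coeff1 : Phi 1%g = 1.
Proof. by rewrite /normalized_coeff rep_act1 mulfV. Qed.

Lemma coeffV g : Phi (g^-1)%g = conjc (Phi g).
Proof.
rewrite /normalized_coeff rmorphM fmorphV /= -!ip_herm; congr (_ / _).
by rewrite -(ip_act g) -rep_actM mulgV rep_act1.
Qed.

Lemma unitary_scalar g c : rep_act pi g x = c *: x -> c * conjc c = 1.
Proof.
move=> e; apply: (mulIf ip_neq0); rewrite mul1r -[RHS](ip_act g) e ipZ ipZr.
by rewrite mulrA.
Qed.

Lemma coeffMr g k c : rep_act pi k x = c *: x -> Phi (g * k)%g = c * Phi g.
Proof. by move=> e; rewrite /normalized_coeff rep_actM e linearZ /= ipZ mulrA. Qed.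

(** Invariance moves k to the second argument as k^-1, which acts on x by the conjugate of c because
    |c| = 1; conjugate linearity there turns it back into c. *)
Lemma coeffMl g k c : rep_act pi k x = c *: x -> Phi (k * g)%g = c * Phi g.
Proof.
move=> e; have cc := unitary_scalar e; rewrite /normalized_coeff rep_actM.
have -> : ip (rep_act pi k (rep_act pi g x)) x = c * ip (rep_act pi g x) x; last by rewrite mulrA.
have eV : x = c *: rep_act pi (k^-1)%g x by rewrite -linearZ /= -e -rep_actM mulVg rep_act1.
have eV' : rep_act pi (k^-1)%g x = conjc c *: x.
  by rewrite [in RHS]eV scalerA mulrC cc scale1r.
by rewrite -(ip_act (k^-1)%g) -rep_actM mulVg rep_act1 eV' ipZr conjcK.
Qed.

Lemma coeff_fixr g k : rep_act pi k x = x -> Phi (g * k)%g = Phi g.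
Proof. by move=> e; rewrite (coeffMr _ (c := 1)) ?mul1r // scale1r. Qed.

Lemma coeff_fixl g k : rep_act pi k x = x -> Phi (k * g)%g = Phi g.
Proof. by move=> e; rewrite (coeffMl _ (c := 1)) ?mul1r // scale1r. Qed.

(** This converts an eigenvector equation for a Hecke operator into a recursion for the matrix
    coefficient. *)
Lemma coeff_sum (J : finType) (s : J -> G) c g :
  \sum_j rep_act pi (s j) x = c *: x -> \sum_j Phi (g * s j)%g = c * Phi g.
Proof.
move=> e; rewrite /normalized_coeff mulrA -ipZ -linearZ /= -e linear_sum /=.
rewrite (big_morph (fun v => ip v x) (fun u v => ipD u v x) (ip0 x)) mulr_suml.
by apply: eq_bigr => j _; rewrite rep_actM.
Qed.

Section Central.
Variable omega : F -> C.
Hypothesis omega_pi : central_character pi omega.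

Lemma act_scalm a : a != 0 -> forall v : pi, rep_act pi (scalm a) v = omega a *: v.
Proof. by move=> a0; apply: omega_pi; exact: GL2val_scalm. Qed.

Lemma omega_unitary a : a != 0 -> omega a * conjc (omega a) = 1.
Proof. by move=> a0; apply: (@unitary_scalar (scalm a)); exact: act_scalm. Qed.

Lemma coeff_scalm a g : a != 0 -> Phi (scalm a * g)%g = omega a * Phi g.
Proof. by move=> a0; apply: coeffMl; exact: act_scalm. Qed.

Lemma omega1 : omega 1 = 1.
Proof.
have := act_scalm (oner_neq0 _) x; have -> : scalm 1 = 1%g :> G.
  by apply: GL2_ext; rewrite !entry_mx2 ?diagm_det_neq0 ?oner_neq0 ?ma1 ?mb1 ?mc1 ?md1.
rewrite rep_act1 => /esym e; apply/eqP; rewrite -subr_eq0.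
have : (omega 1 - 1) *: x == 0 by rewrite scalerBl e scale1r subrr.
by rewrite scaler_eq0 (negbTE x0) orbF.
Qed.

(** For integral y the unipotent factor on the left is integral and leaves the coefficient
    unchanged, so every upper representative raises the exponent by one. *)
Lemma tpow_upper n (y : F) : (tpow n * ucoset y = upper (w ^+ n * y) * tpow n.+1)%g.
Proof.
by apply: GL2_ext; rewrite !entryM !entry_mx2 ?ucoset_det_neq0 ?upper_det_neq0 // ?exprS; ring.
Qed.

Let diagw_det_neq0 : 1 * w - 0 * 0 != 0 :> F.
Proof. exact: diagm_det_neq0 (oner_neq0 _) w0. Qed.

Section Spherical.
Hypothesis fx : forall k, K2 0 k -> rep_act pi k x = x.
Variable lam : C.
Hypothesis eig : \sum_j rep_act pi (s_hecke F j) x = lam *: x.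

Let sum_hecke (f : option 'I_q -> C) : \sum_j f j = f None + \sum_(j < q) f (Some j).
Proof.
rewrite (bigD1 None) //=; congr (_ + _).
rewrite (reindex_onto Some (fun j => odflt (Ordinal (prime_gt0 q_prime)) j)) /=; last by case.
by apply: eq_bigl => i; rewrite eqxx.
Qed.

Let Phi_upper n (j : 'I_q) : Phi (tpow n * s_hecke F (Some j))%g = Phi (tpow n.+1).
Proof.
rewrite /= tpow_upper coeff_fixl //; apply: fx; apply: K2_1_sub_0 => //; apply: K2_1_upper => //.
by apply: absM_le; rewrite ?abs_nat // absX exprn_ile1 ?padic_abs_ge0 ?abs_nat.
Qed.

Let PhiW g : Phi (weyl F * g)%g = Phi g /\ Phi (g * weyl F)%g = Phi g.
Proof. by split; [apply: coeff_fixl|apply: coeff_fixr]; apply: fx; exact: K2_0_weyl. Qed.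

Lemma spherical_dg1w : Phi (diagm 1 w) = Phi (tpow 1).
Proof.
have -> : diagm 1 w = (weyl F * (tpow 1 * weyl F))%g.
  by apply: GL2_ext; rewrite !(entryM, entry_mx2) ?weyl_det_neq0 // ?expr1; ring.
by rewrite (PhiW _).1 (PhiW _).2.
Qed.

(** At g = 1 all q + 1 representatives lie in K diag(q, 1) K, on which [Phi] is constant. *)
Lemma spherical_rec0 : (q%:R + 1) * Phi (tpow 1) = lam.
Proof.
have := coeff_sum 1%g eig; rewrite coeff1 mulr1 => <-.
rewrite sum_hecke mul1g spherical_dg1w (eq_bigr (fun=> Phi (tpow 1))).
  by rewrite sumr_const card_ord mulrDl mul1r addrC; congr (_ + _); rewrite mulr_natl.
move=> j _; rewrite -(Phi_upper 0 j); congr (Phi (_ * _)%g).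
by apply: GL2_ext; rewrite !entry_mx2 // ?expr0 ?ma1 ?mb1 ?mc1 ?md1.
Qed.

(** The exceptional representative diag(1, q) turns diag(q^(n+1), 1) into the scalar q times
    diag(q^n, 1), whence the central character. *)
Lemma spherical_rec n : lam * Phi (tpow n.+1) = q%:R * Phi (tpow n.+2) + omega w * Phi (tpow n).
Proof.
rewrite -(coeff_sum _ eig) sum_hecke addrC; congr (_ + _).
  rewrite (eq_bigr (fun=> Phi (tpow n.+2))); last by move=> j _; rewrite Phi_upper.
  by rewrite sumr_const card_ord mulr_natl.
rewrite -coeff_scalm //; congr Phi.
by apply: GL2_ext; rewrite !entryM !entry_mx2 ?diagm_det_neq0 ?oner_neq0 // ?exprS; ring.
Qed.

(** The inverse of diag(q, 1) is q^-1 diag(1, q), and inversion conjugates the coefficient. *)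
Lemma spherical_conj1 : conjc (Phi (tpow 1)) = (omega w)^-1 * Phi (tpow 1).
Proof.
have ow : omega w != 0.
  by apply/negP => /eqP e; have := omega_unitary w0; rewrite e mul0r => /eqP;
    rewrite eq_sym oner_eq0.
apply: (mulfI ow); rewrite mulVKf // -coeffV -coeff_scalm // -spherical_dg1w; congr Phi.
apply: (mulIg (tpow 1)); rewrite -mulgA mulVg mulg1.
by apply: GL2_ext; rewrite !entryM !entry_mx2 ?diagm_det_neq0 ?oner_neq0 // ?expr1; ring.
Qed.

End Spherical.

Section Newvector.
Hypothesis fx : forall k, K2 1 k -> rep_act pi k x = x.
Variable alpha : C.
Hypothesis alpha0 : alpha != 0.
Hypothesis eig_upper : \sum_(j < q) rep_act pi (ucoset j%:R) x = ((sqrt_qV R q)^-1 * alpha) *: x.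
Hypothesis eig_lower : \sum_(j < q) rep_act pi (lcoset j%:R) x =
  ((sqrt_qV R q)^-1 * alpha^-1) *: x.

(** The q translates have equal coefficients, so each step multiplies by q^(1/2) alpha / q. *)
Lemma newvector_tpow n : Phi (tpow n) = (sqrt_qV R q * alpha) ^+ n.
Proof.
elim: n => [|n IH].
  rewrite expr0 -coeff1; congr Phi.
  by apply: GL2_ext; rewrite !entry_mx2 // ?expr0 ?ma1 ?mb1 ?mc1 ?md1.
have := coeff_sum (tpow n) eig_upper; rewrite IH (eq_bigr (fun=> Phi (tpow n.+1))) => [|j _];
  last first.
  rewrite tpow_upper coeff_fixl //; apply: fx; apply: K2_1_upper => //.
  by apply: absM_le; rewrite ?abs_nat // absX exprn_ile1 ?padic_abs_ge0 ?abs_nat.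
have u0 := sqrt_qV_neq0 R q_prime.
rewrite sumr_const card_ord -mulr_natl exprS => h.
have q0 : (q%:R : C) != 0 by rewrite pnatr_eq0 -lt0n prime_gt0.
apply: (mulfI q0); rewrite h -[q%:R]invrK -sqrt_qV_sqr //.
by field.
Qed.

(** The lower representatives are lower unipotents of K2(q) times diag(q, 1)^-1. Their sum therefore
    evaluates the conjugate of Phi(diag(q, 1)) as q^(-1/2) alpha^-1, while the upper sum gives
    Phi(diag(q, 1)) = q^(-1/2) alpha. *)
Lemma newvector_unitary : alpha * conjc alpha = 1.
Proof.
have u0 := sqrt_qV_neq0 R q_prime.
have h1 : Phi (tpow 1)^-1%g = sqrt_qV R q * conjc alpha.
  by rewrite coeffV newvector_tpow expr1 rmorphM /=; congr (_ * _); exact: conjc_real.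
have := coeff_sum 1%g eig_lower; rewrite coeff1 mulr1 (eq_bigr (fun=> Phi (tpow 1)^-1%g)).
  rewrite sumr_const card_ord -mulr_natl h1 -[q%:R]invrK -sqrt_qV_sqr // => h.
  have -> : conjc alpha = alpha^-1.
    by apply: (mulfI (_ : (sqrt_qV R q)^-1 != 0)); [rewrite invr_eq0|rewrite -h; field].
  by rewrite mulfV.
move=> j _; rewrite mul1g.
have -> : lcoset j%:R = (lower (w * j%:R) * (tpow 1)^-1)%g.
  apply: (mulIg (tpow 1)); rewrite -mulgA mulVg mulg1.
  by apply: GL2_ext; rewrite !entryM !entry_mx2 ?lcoset_det_neq0 ?lower_det_neq0 // ?expr1; field.
by rewrite coeff_fixl //; apply: fx; apply: K2_1_lower => //;
  rewrite absM_lt ?abs_nat // abs_w qV_lt1.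
Qed.

Lemma newvector_Iw k : Iw k -> rep_act pi k x = omega (md k) *: x.
Proof.
move=> hk; have [a1 d1] := Iw_diag hk.
have [k' [hk' {1}->]] := Iw_K2 q_prime hk.
by rewrite rep_actM fx // act_scalm // -abs_gt0 d1.
Qed.

(** diag(1, e) on the left of an antidiagonal matrix equals diag(e, 1) on its right. The former
    multiplies the coefficient by omega(e), the latter fixes it. *)
Lemma newvector_antidiag e b c : `|e|_q = 1 -> omega e != 1 -> b != 0 -> c != 0 ->
  Phi (antidiag b c) = 0.
Proof.
move=> he ome b0 c0; have e0 : e != 0 by rewrite -abs_gt0 he.
have hI : Iw (diagm 1 e : G).
  by rewrite /Iw /= GL2_intE dt_mx2 ?diagm_det_neq0 ?oner_neq0 //
    !entry_mx2 ?diagm_det_neq0 ?oner_neq0 //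
    abs0 mulr0 subr0 mul1r he abs1; do !split.
have h1 : Phi (diagm 1 e * antidiag b c)%g = omega e * Phi (antidiag b c).
  by apply: coeffMl; rewrite newvector_Iw // md_mx2 ?diagm_det_neq0 ?oner_neq0.
have h2 : Phi (antidiag b c * diagm e 1)%g = Phi (antidiag b c).
  by apply: coeff_fixr; apply: fx; apply: K2_1_diagm; rewrite ?abs1 // subrr abs0.
have e12 : (diagm 1 e * antidiag b c = antidiag b c * diagm e 1)%g.
  by apply: GL2_ext; rewrite !entryM !entry_mx2 ?diagm_det_neq0 ?antidiag_det_neq0 ?oner_neq0
    //; ring.
have : (omega e - 1) * Phi (antidiag b c) = 0 by rewrite mulrBl -h1 e12 h2 mul1r subrr.
by move/eqP; rewrite mulf_eq0 subr_eq0 (negbTE ome) /= => /eqP.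
Qed.

End Newvector.

End Central.

End Coefficients.

(** * Integration over the cells *)

Lemma eseries_EFin (R : realType) (u : nat -> R) : cvgn (series u) ->
  (\sum_(i <oo) (u i)%:E = (limn (series u))%:E)%E.
Proof.
move=> cu; rewrite -EFin_lim //.
have -> // : EFin \o series u = (fun n => \sum_(0 <= i < n) (u i)%:E)%E.
by apply/funext => n; rewrite /series /= sumEFin.
Qed.

Section SeriesIntegral.
Context d (T : measurableType d) (R : realType) (mu : {measure set T -> \bar R}).
Variables (D : nat -> set T) (m : nat -> R) (f : T -> R) (c : nat -> R) (K r : R).
Hypotheses (mD : forall n, measurable (D n)) (tD : trivIset setT D).
Hypothesis muD : forall n, mu (D n) = (m n)%:E.
Hypothesis fD : forall n x, D n x -> f x = c n.
Hypothesis f0 : forall x, (forall n, ~ D n x) -> f x = 0.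
Hypotheses (r0 : 0 <= r) (r1 : r < 1) (bnd : forall n, `|c n| * m n <= K * r ^+ n).

Let m_ge0 n : 0 <= m n.
Proof. by rewrite -lee_fin -muD measure_ge0. Qed.

Let E := \bigcup_n D n.
Let mE : measurable E. Proof. exact: bigcup_measurable. Qed.

Let cvg_norm : cvgn (series (fun n => `|c n| * m n)).
Proof.
apply: (@series_le_cvg _ _ (geometric K r)) => //.
- by move=> n; rewrite mulr_ge0.
- by move=> n; apply: le_trans (bnd n); rewrite mulr_ge0.
- by apply: is_cvg_geometric_series; rewrite ger0_norm.
Qed.

Let cvg_c : cvgn (series (fun n => c n * m n)).
Proof.
apply: normed_cvg; rewrite /normed_series_of /=.
rewrite (_ : (fun n => `|c n * m n|) = (fun n => `|c n| * m n)) //.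
by apply/funext => n; rewrite normrM (ger0_norm (m_ge0 n)).
Qed.

Let f_mE : measurable_fun E f.
Proof.
apply/measurable_fun_bigcup => // n; apply: (eq_measurable_fun (cst (c n))) => //.
by move=> x; rewrite inE => /fD ->.
Qed.

Let f_intE : mu.-integrable E (EFin \o f).
Proof.
apply/integrableP; split; first exact/measurable_EFinP.
rewrite ge0_integral_bigcup //; last first.
  by apply: measurableT_comp => //; exact/measurable_EFinP.
rewrite (eq_eseriesr (g := fun n => (`|c n| * m n)%:E)) => [|n _].
  by rewrite eseries_EFin ?ltry.
rewrite (eq_integral (cst (`|c n|)%:E)); last by move=> x; rewrite inE => /fD /= ->.
by rewrite integral_cst // muD EFinM.
Qed.

(** Integrability holds on the union of the sets D n by the geometric majorant, and extends by zero
    to the whole space. *)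
Lemma integrable_step : mu.-integrable setT (EFin \o f).
Proof.
have fE : (EFin \o f) \_ E = EFin \o f.
  apply/funext => x; rewrite patchE; case: ifPn => // /negP; rewrite inE => nE.
  by rewrite /= f0 // => n Dn; apply: nE; exists n.
by rewrite -fE; exact: (iffLR (integrable_mkcond _ mE) f_intE).
Qed.

Lemma Rintegral_step : series (fun n => c n * m n) @ \oo --> Rintegral mu setT f.
Proof.
have -> : Rintegral mu setT f = limn (series (fun n => c n * m n)); last exact: cvg_c.
have fE : f \_ E = f.
  apply/funext => x; rewrite patchE; case: ifPn => // /negP; rewrite inE => nE.
  by rewrite /= f0 // => n Dn; apply: nE; exists n.
rewrite -fE -Rintegral_mkcond /Rintegral integral_bigcup //.
rewrite (eq_eseriesr (g := fun n => (c n * m n)%:E)) => [|n _]; last first.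
  rewrite (eq_integral (cst (c n)%:E)); last by move=> x; rewrite inE => /fD /= ->.
  by rewrite integral_cst // muD EFinM.
by rewrite eseries_EFin.
Qed.

End SeriesIntegral.

(** * Complex series and their linear recursions *)

Section ComplexSeries.
Variable R : realType.
Local Notation C := (R[i]).
Implicit Types (c : nat -> C) (l z : C).

(** Convergence is split into real and imaginary parts to match [complex_integral], which is built
    from two real integrals. *)
Definition csum c l := series (fun n => complex.Re (c n)) @ \oo --> complex.Re l /\
  series (fun n => complex.Im (c n)) @ \oo --> complex.Im l.

Lemma csum_uniq c l l' : csum c l -> csum c l' -> l = l'.
Proof.
case=> r1 i1 [r2 i2]; apply/eqP; rewrite eq_complex.
by rewrite (cvg_unique _ r1 r2) // (cvg_unique _ i1 i2) // !eqxx.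
Qed.

Lemma csumD c c' l l' : csum c l -> csum c' l' -> csum (fun n => c n + c' n) (l + l').
Proof.
case=> r1 i1 [r2 i2]; split.
  have -> : series (fun n => complex.Re (c n + c' n)) =
    series (fun n => complex.Re (c n)) \+ series (fun n => complex.Re (c' n)).
    by apply/funext => n; rewrite /series /= -big_split; apply: eq_bigr => i _;
      case: (c i) (c' i) => [? ?] [].
  by case: l l' r1 r2 {i1 i2} => [a b] [a' b'] /= r1 r2; exact: cvgD.
have -> : series (fun n => complex.Im (c n + c' n)) =
  series (fun n => complex.Im (c n)) \+ series (fun n => complex.Im (c' n)).
  by apply/funext => n; rewrite /series /= -big_split; apply: eq_bigr => i _;
    case: (c i) (c' i) => [? ?] [].
by case: l l' i1 i2 {r1 r2} => [a b] [a' b'] /= i1 i2; exact: cvgD.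
Qed.

Lemma csumZ z c l : csum c l -> csum (fun n => z * c n) (z * l).
Proof.
case: z => x y [r1 i1]; split.
  have -> : series (fun n => complex.Re (Complex x y * c n)) =
    (fun n => x * series (fun n => complex.Re (c n)) n - y *
      series (fun n => complex.Im (c n)) n).
    apply/funext => n; rewrite /series /= !mulr_sumr -sumrB.
    by apply: eq_bigr => i _; case: (c i).
  by case: l r1 i1 => [a b] /= r1 i1; apply: cvgB; apply: cvgMr.
have -> : series (fun n => complex.Im (Complex x y * c n)) =
  (fun n => x * series (fun n => complex.Im (c n)) n + y * series (fun n => complex.Re (c n)) n).
  apply/funext => n; rewrite /series /= !mulr_sumr -big_split.
  by apply: eq_bigr => i _; case: (c i).
by case: l r1 i1 => [a b] /= r1 i1; apply: cvgD; apply: cvgMr.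
Qed.

Lemma csum_conj c l : csum c l -> csum (fun n => conjc (c n)) (conjc l).
Proof.
case=> r1 i1; split.
  have -> : series (fun n => complex.Re (conjc (c n))) = series (fun n => complex.Re (c n)).
    by apply/funext => n; apply: eq_bigr => i _; case: (c i).
  by case: l r1 {i1}.
have -> : series (fun n => complex.Im (conjc (c n))) = \- series (fun n => complex.Im (c n)).
  by apply/funext => n; rewrite /series /= -sumrN; apply: eq_bigr => i _; case: (c i).
by case: l i1 {r1} => a b /= i1; exact: cvgN.
Qed.

Let cvg_shift (u : nat -> R) (x : R) : series u @ \oo --> x ->
  series (fun n => u n.+1) @ \oo --> x - u 0%N.
Proof.
move=> h; have -> : series (fun n => u n.+1) = (fun n => series u n.+1 - u 0%N).
  apply/funext => n; rewrite /series /= [in RHS]big_nat_recl //= addrAC subrr add0r.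
  by [].
by apply: cvgB; [rewrite (cvg_shiftS (series u))|exact: cvg_cst].
Qed.

Lemma csum_shift c l : csum c l -> csum (fun n => c n.+1) (l - c 0%N).
Proof.
case=> /cvg_shift r1 /cvg_shift i1.
by split; move: r1 i1; case: l (c 0%N) => [a b] [a' b'].
Qed.

(** Summing the recursion expresses the sum shifted twice through the sum and its first shift. The
    equation is left undivided, so a vanishing 1 - s + p is harmless. *)
Lemma csum_linear_rec c l s p : csum c l ->
  (forall n, c n.+2 = s * c n.+1 - p * c n) ->
  l * (1 - s + p) = c 0%N + c 1%N - s * c 0%N.
Proof.
move=> h rec; have h1 := csum_shift h; have h2 := csum_shift h1.
have := csumD (csumZ s h1) (csumZ (- p) h).
have -> : (fun n => s * c n.+1 + - p * c n) = (fun n => c n.+2).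
  by apply/funext => n; rewrite rec mulNr.
move/(csum_uniq h2) => e.
have -> : l * (1 - s + p) = (l - c 0%N - c 1%N) - (s * (l - c 0%N) + - p *
  l) + c 0%N + c 1%N - s * c 0%N by ring.
by rewrite -e subrr add0r.
Qed.

(** The norm of R[i] takes values in R[i]; its real part is the modulus as an element of R, in which
    all bounds are stated. *)
Lemma Re_normr z : `|z| = ((complex.Re `|z|)%:C)%C.
Proof. by []. Qed.

Lemma normr_Re_le z : `|complex.Re z| <= complex.Re `|z| /\ `|complex.Im z| <= complex.Re `|z|.
Proof.
case: z => a b /=; split; rewrite -sqrtr_sqr ler_wsqrtr //.
  by rewrite lerDl sqr_ge0.
by rewrite lerDr sqr_ge0.
Qed.

Lemma Re_normrM z z' : complex.Re `|z * z'| = complex.Re `|z| * complex.Re `|z'|.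
Proof. by rewrite normrM [X in X * _]Re_normr [X in _ * X]Re_normr -rmorphM. Qed.

Lemma Re_normrX z n : complex.Re `|z ^+ n| = complex.Re `|z| ^+ n.
Proof.
by elim: n => [|n IH]; [rewrite !expr0 normr1|rewrite !exprS Re_normrM IH].
Qed.

Lemma Re_normr_ge0 z : 0 <= complex.Re `|z|.
Proof. by case: z => a b; exact: sqrtr_ge0. Qed.

Lemma Re_normr_conj1 z : z * conjc z = 1 -> complex.Re `|z| = 1.
Proof.
move=> h; have : `|z| ^+ 2 = 1 by rewrite sqr_normc.
move/eqP; rewrite sqrf_eq1 => /orP[/eqP -> //|/eqP e].
by have := Re_normr_ge0 z; rewrite e /= ler0N1.
Qed.

End ComplexSeries.

Section StepIntegral.
Variables (R : realType) (q : nat) (F : padicField R q).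
Local Notation C := (R[i]).
Local Notation G := (GL2 F).
Variable mu : {measure set (ZmodG F) -> \bar R}.

(** Integrability of both parts is recorded with the sum, since adding the integrals over the two
    families of cells requires it. *)
Lemma complex_integral_step (D : nat -> set G) (m : nat -> R) (f : G -> C) (c : nat ->
  C) (K r : R) :
  (forall n, measurable (D n : set (ZmodG F))) -> trivIset setT D ->
  (forall n, mu (D n : set (ZmodG F)) = (m n)%:E) ->
  (forall n x, D n x -> f x = c n) -> (forall x, (forall n, ~ D n x) -> f x = 0) ->
  0 <= r -> r < 1 -> (forall n, complex.Re `|c n| * m n <= K * r ^+ n) ->
  [/\ mu.-integrable setT (EFin \o (fun g : ZmodG F => complex.Re (f g))),
      mu.-integrable setT (EFin \o (fun g : ZmodG F => complex.Im (f g))) &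
      csum (fun n => c n * ((m n)%:C)%C) (complex_integral mu f)].
Proof.
move=> mD tD muD fD f0 r0 r1 bnd.
have m_ge0 n : 0 <= m n by rewrite -lee_fin -muD measure_ge0.
have fR n x : D n x -> complex.Re (f x) = complex.Re (c n) by move/fD ->.
have fI n x : D n x -> complex.Im (f x) = complex.Im (c n) by move/fD ->.
have f0R x : (forall n, ~ D n x) -> complex.Re (f x) = 0 by move/f0 ->.
have f0I x : (forall n, ~ D n x) -> complex.Im (f x) = 0 by move/f0 ->.
have bR n : `|complex.Re (c n)| * m n <= K * r ^+ n.
  by apply: le_trans (bnd n); rewrite ler_wpM2r //; exact: (normr_Re_le _).1.
have bI n : `|complex.Im (c n)| * m n <= K * r ^+ n.
  by apply: le_trans (bnd n); rewrite ler_wpM2r //; exact: (normr_Re_le _).2.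
split.
- exact: (@integrable_step _ (ZmodG F) R mu D m (fun g => complex.Re (f g)) (fun n =>
  complex.Re (c n)) K r).
- exact: (@integrable_step _ (ZmodG F) R mu D m (fun g => complex.Im (f g)) (fun n =>
  complex.Im (c n)) K r).
- split.
    have -> : series (fun n => complex.Re (c n * ((m n)%:C)%C)) =
      series (fun n => complex.Re (c n) * m n).
      by apply/funext => n; apply: eq_bigr => i _; case: (c i) => a b /=; rewrite mulr0 subr0.
    exact: (@Rintegral_step _ (ZmodG F) R mu D m (fun g => complex.Re (f g)) (fun n =>
      complex.Re (c n)) K r).
  have -> : series (fun n => complex.Im (c n * ((m n)%:C)%C)) =
    series (fun n => complex.Im (c n) * m n).
    by apply/funext => n; apply: eq_bigr => i _; case: (c i) => a b /=; rewrite mulr0 add0r mulrC.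
  exact: (@Rintegral_step _ (ZmodG F) R mu D m (fun g => complex.Im (f g)) (fun n => complex.Im
    (c n)) K r).
Qed.

End StepIntegral.

(** * Reduction of a bi-invariant function to its values on powers of diag(q, 1) and on antidiagonal
    matrices *)

Section Decomposition.
Variables (R : realType) (q : nat) (F : padicField R q).
Hypothesis q_prime : prime q.
Local Notation C := (R[i]).
Local Notation G := (GL2 F).
Local Notation "`| x |_q" := (padic_abs x) (format "`| x |_q").
Local Notation Q := (q%:R : R).
Local Notation w := (q%:R : F).

Let w0 := natF_neq0 F q_prime.
Let wn0 n : w ^+ n != 0. Proof. by rewrite expf_neq0. Qed.
Let QV0 := qV_gt0 R q_prime.

Lemma K2_1_Iw (k : G) : K2 1 k -> Iw k.
Proof. by move/(K2_1E q_prime) => []. Qed.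

Lemma Iw_diagm (a d : F) : `|a|_q = 1 -> `|d|_q = 1 -> Iw (diagm a d : G).
Proof.
move=> ha hd; have a0 : a != 0 by rewrite -abs_gt0 ha.
have d0 : d != 0 by rewrite -abs_gt0 hd.
by rewrite /Iw /= GL2_intE dt_mx2 ?diagm_det_neq0 // !entry_mx2 ?diagm_det_neq0 //
  abs0 mulr0 subr0 padic_absM ha hd mulr1; do !split.
Qed.

Lemma int_exp_le1 (x : F) : x != 0 -> `|x|_q <= 1 -> exists n, `|x|_q = Q^-1 ^+ n.
Proof.
move=> x0; have [k ->] := abs_val q_prime x0.
rewrite -[X in _ <= X](expr0z Q) ler_eXz2l ?q_gt1 // => k0.
by exists `|k|%N; rewrite exprVn exprnN; congr (_ ^ _); lia.
Qed.

(** Dominance of d makes |det g| / |d|^2 at most 1, hence a power of 1/q whose exponent is the index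
    of the cell. *)
Lemma pivot_d (g : G) : `|mc g|_q < `|md g|_q -> `|mb g|_q <= `|md g|_q ->
  `|ma g|_q <= `|md g|_q -> exists n, cell_d n g.
Proof.
move=> hc hb ha; have d0 : 0 < `|md g|_q by rewrite (le_lt_trans _ hc) ?padic_abs_ge0.
have d0' : md g != 0 by rewrite -abs_gt0.
have hdt : `|dt g|_q <= `|md g|_q ^+ 2.
  by rewrite /dt expr2; apply: absB_le; rewrite padic_absM; apply: ler_pM;
    rewrite ?padic_abs_ge0 // ltW.
have [n hn] : exists n, `|dt g / md g ^+ 2|_q = Q^-1 ^+ n.
  apply: int_exp_le1; first by rewrite mulf_neq0 ?invr_eq0 ?expf_neq0 ?dt_neq0.
  by rewrite abs_div absX ler_pdivrMr ?mul1r // exprn_gt0.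
exists n; split=> //; rewrite -hn abs_div absX mulfVK // expf_neq0 //.
by rewrite abs_eq0.
Qed.

Lemma pivot_a (g : G) : `|mc g|_q < `|ma g|_q -> `|mb g|_q <= `|ma g|_q ->
  `|md g|_q <= `|ma g|_q -> exists n, cell_a n g.
Proof.
move=> hc hb hd; have a0 : 0 < `|ma g|_q by rewrite (le_lt_trans _ hc) ?padic_abs_ge0.
have a0' : ma g != 0 by rewrite -abs_gt0.
have hdt : `|dt g|_q <= `|ma g|_q ^+ 2.
  by rewrite /dt expr2; apply: absB_le; rewrite padic_absM; apply: ler_pM;
    rewrite ?padic_abs_ge0 // ltW.
have [n hn] : exists n, `|dt g / ma g ^+ 2|_q = Q^-1 ^+ n.
  apply: int_exp_le1; first by rewrite mulf_neq0 ?invr_eq0 ?expf_neq0 ?dt_neq0.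
  by rewrite abs_div absX ler_pdivrMr ?mul1r // exprn_gt0.
exists n; split=> //; rewrite -hn abs_div absX mulfVK // expf_neq0 //.
by rewrite abs_eq0.
Qed.

Section Values.
Variables (Y : Type) (f : G -> Y).
Hypothesis f_scalm : forall a g, a != 0 -> f (scalm a * g)%g = f g.
Hypothesis f_l : forall k g, Iw k -> f (k * g)%g = f g.
Hypothesis f_r : forall k g, Iw k -> f (g * k)%g = f g.

Let Iw_upper (x : F) : `|x|_q <= 1 -> Iw (upper x : G).
Proof. by move=> h; apply: K2_1_Iw; exact: K2_1_upper. Qed.
Let Iw_lower (x : F) : `|x|_q < 1 -> Iw (lower x : G).
Proof. by move=> h; apply: K2_1_Iw; exact: K2_1_lower. Qed.

Lemma value_cell_d n g : cell_d n g -> f g = f (tpow F n).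
Proof.
case=> hc hb ha e; have d0 : 0 < `|md g|_q by rewrite (le_lt_trans _ hc) ?padic_abs_ge0.
have d0' : md g != 0 by rewrite -abs_gt0.
have dt0 := dt_neq0 g.
(* The unit left over from the determinant once the scalar d and the matrix diag(q^n, 1) are
   removed. *)
pose t := dt g / (md g ^+ 2 * w ^+ n).
have t0 : t != 0 by rewrite mulf_neq0 ?invr_eq0 ?mulf_neq0 ?expf_neq0.
have -> : g = (upper (mb g / md g) * (scalm (md g) * (tpow F n * diagm t 1)) *
  lower (mc g / md g))%g.
  have n0 := wn0 n.
  have tE : md g ^+ 2 * w ^+ n * t = dt g by rewrite /t mulrC mulfVK // mulf_neq0 ?expf_neq0.
  apply: GL2_ext; rewrite !(entryM,
    entry_mx2) ?upper_det_neq0 ?lower_det_neq0 ?diagm_det_neq0 ?oner_neq0 //; try by field.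
  rewrite (_ : ma g = (dt g + mb g * mc g) / md g); last by rewrite /dt subrK mulfK.
  by rewrite -tE; field.
rewrite f_r; last by apply: Iw_lower; rewrite abs_div ltr_pdivrMr // mul1r.
rewrite f_l; last by apply: Iw_upper; rewrite abs_div ler_pdivrMr // mul1r.
rewrite f_scalm // f_r //; apply: Iw_diagm; rewrite ?abs1 //.
rewrite abs_div padic_absM !absX abs_w e [X in X / _]mulrC mulfV //.
by rewrite mulf_neq0 ?expf_neq0 // gt_eqF.
Qed.

Lemma value_cell_a n g : cell_a n g -> f g = f (tpow F n)^-1%g.
Proof.
case=> hc hb hd e; have a0 : 0 < `|ma g|_q by rewrite (le_lt_trans _ hc) ?padic_abs_ge0.
have a0' : ma g != 0 by rewrite -abs_gt0.
have dt0 := dt_neq0 g; have n0 := wn0 n.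
pose t := dt g / (ma g ^+ 2 * w ^+ n).
have t0 : t != 0 by rewrite mulf_neq0 ?invr_eq0 ?mulf_neq0 ?expf_neq0.
have -> : (tpow F n)^-1%g = (scalm (w ^- n) * diagm 1 (w ^+ n))%g.
  apply: (mulIg (tpow F n)); rewrite mulVg; apply: GL2_ext;
  by rewrite !(entryM, entry_mx2) ?diagm_det_neq0 ?oner_neq0 ?invr_eq0 // ?ma1 ?mb1 ?mc1 ?md1;
    field.
rewrite f_scalm ?invr_eq0 //.
have -> : g = (lower (mc g / ma g) * (scalm (ma g) * (diagm 1 (w ^+ n) * diagm 1 t)) *
  upper (mb g / ma g))%g.
  have tE : ma g ^+ 2 * w ^+ n * t = dt g by rewrite /t mulrC mulfVK // mulf_neq0 ?expf_neq0.
  apply: GL2_ext; rewrite !(entryM,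
    entry_mx2) ?upper_det_neq0 ?lower_det_neq0 ?diagm_det_neq0 ?oner_neq0 //; try by field.
  rewrite [LHS](_ : _ = (dt g + mb g * mc g) / ma g); last by rewrite /dt subrK mulrC mulKf.
  by rewrite -tE; field.
rewrite f_r; last by apply: Iw_upper; rewrite abs_div ler_pdivrMr // mul1r.
rewrite f_l; last by apply: Iw_lower; rewrite abs_div ltr_pdivrMr // mul1r.
rewrite f_scalm // f_r //; apply: Iw_diagm; rewrite ?abs1 //.
rewrite abs_div padic_absM !absX abs_w e [X in X / _]mulrC mulfV //.
by rewrite mulf_neq0 ?expf_neq0 // gt_eqF.
Qed.

(** If no diagonal entry dominates, then c dominates weakly or b dominates strictly, and elimination
    by unipotents of I on both sides leaves an antidiagonal matrix. The asymmetry is that of I: its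
    upper unipotents are integral, its lower ones have entry in q Z_q. *)
Lemma value_antidiag g : (forall n, ~ cell_d n g) -> (forall n, ~ cell_a n.+1 g) ->
  exists b c, [/\ b != 0, c != 0 & f g = f (antidiag b c)].
Proof.
move=> nD nA; have {}nA n : ~ cell_a n g.
  by case: n => [|n]; [rewrite -cell_d0_cell_a0; exact: nD|exact: nA].
have pc : `|ma g|_q <= `|mc g|_q -> `|md g|_q <= `|mc g|_q ->
  exists b c, [/\ b != 0, c != 0 & f g = f (antidiag b c)].
  move=> ha hd; have c0 : mc g != 0.
    apply/negP => /eqP c0; move: ha hd; rewrite c0 abs0 => ha hd.
    have /eqP : `|ma g|_q = 0 by apply/eqP; rewrite eq_le ha padic_abs_ge0.
    by rewrite abs_eq0 => /eqP a0; have := dt_neq0 g; rewrite /dt c0 a0 mul0r mulr0 subrr eqxx.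
  have c1 : 0 < `|mc g|_q by rewrite abs_gt0.
  have b0 : - dt g / mc g != 0 by rewrite mulf_neq0 ?invr_eq0 ?oppr_eq0 ?dt_neq0.
  exists (- dt g / mc g), (mc g); split=> //.
  have {1}-> : g = (upper (ma g / mc g) * antidiag (- dt g / mc g) (mc g) *
    upper (md g / mc g))%g.
    by apply: GL2_ext; rewrite !(entryM, entry_mx2) ?upper_det_neq0 ?antidiag_det_neq0 // /dt;
      field.
  rewrite f_r; last by apply: Iw_upper; rewrite abs_div ler_pdivrMr // mul1r.
  by rewrite f_l //; apply: Iw_upper; rewrite abs_div ler_pdivrMr // mul1r.
have pb : `|ma g|_q < `|mb g|_q -> `|md g|_q < `|mb g|_q ->
  exists b c, [/\ b != 0, c != 0 & f g = f (antidiag b c)].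
  move=> ha hd; have b1 : 0 < `|mb g|_q by rewrite (le_lt_trans _ ha) ?padic_abs_ge0.
  have b0 : mb g != 0 by rewrite -abs_gt0.
  have c0 : - dt g / mb g != 0 by rewrite mulf_neq0 ?invr_eq0 ?oppr_eq0 ?dt_neq0.
  exists (mb g), (- dt g / mb g); split=> //.
  have {1}-> : g = (lower (md g / mb g) * antidiag (mb g) (- dt g / mb g) *
    lower (ma g / mb g))%g.
    by apply: GL2_ext; rewrite !(entryM, entry_mx2) ?lower_det_neq0 ?antidiag_det_neq0 // /dt;
      field.
  rewrite f_r; last by apply: Iw_lower; rewrite abs_div ltr_pdivrMr // mul1r.
  by rewrite f_l //; apply: Iw_lower; rewrite abs_div ltr_pdivrMr // mul1r.
have [lead|lda] := leP `|ma g|_q `|md g|_q.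
  have [cd|dc] := ltP `|mc g|_q `|md g|_q; last by apply: pc => //; exact: le_trans lead dc.
  have [bd|db] := leP `|mb g|_q `|md g|_q; last by apply: pb => //; exact: le_lt_trans lead db.
  by have [n /nD] := pivot_d cd bd lead.
have [ca|ac] := ltP `|mc g|_q `|ma g|_q; last by apply: pc => //; exact: le_trans (ltW lda) ac.
have [ba|ab] := leP `|mb g|_q `|ma g|_q; last by apply: pb => //; exact: lt_trans lda ab.
by have [n /nA] := pivot_a ca ba (ltW lda).
Qed.

End Values.

(** Every preimage is Z-invariant and right invariant under I, hence open and a generator of the
    sigma-algebra. *)
Lemma invariant_measurable d (Y : measurableType d) (f : G -> Y) :
  (forall a g, a != 0 -> f (scalm a * g)%g = f g) -> (forall k g, Iw k -> f (g * k)%g = f g) ->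
  measurable_fun setT (f : ZmodG F -> Y).
Proof.
move=> f_scalm f_r _ B _; rewrite setTI; apply: ZI_measurable; split.
  by move=> z g /center_scalm[a a0 ->] /= ; rewrite f_scalm.
by move=> g k hk /=; rewrite f_r.
Qed.

End Decomposition.

(** * Decay of a tempered spherical function *)

Section Decay.
Variables (R : realType) (q : nat) (F : padicField R q).
Hypothesis q_prime : prime q.
Local Notation C := (R[i]).
Local Notation G := (GL2 F).
Local Notation "`| x |_q" := (padic_abs x) (format "`| x |_q").
Local Notation Q := (q%:R : R).
Local Notation w := (q%:R : F).
Variables (mu : {measure set (ZmodG F) -> \bar R}) (mu_haar : haar_measure mu).

(** Temperedness with e = 1 makes the cube of the coefficient integrable with an integer exponent.
    The cell of diag(q^n, 1) alone contributes the cube of its value there times q^n / (q + 1), so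
    the value is O(q^(-n/3)). *)
Lemma tempered_decay (pi : smoothRep F) (ip : pi -> pi -> C) (omega : F -> C) (x : pi) :
  invariant_inner_product ip -> tempered mu ip -> central_character pi omega -> x != 0 ->
  (forall k, K2 0 k -> rep_act pi k x = x) ->
  exists K r : R, [/\ 0 <= r, r < 1 &
    forall n, complex.Re `|normalized_coeff ip x (tpow F n)| <= K * r ^+ n].
Proof.
move=> ip_inv temp om x0 fx.
have Q0 := q_gt0 R q_prime; have QV1 := qV_lt1 R q_prime; have QV0 := qV_gt0 R q_prime.
have ipx : ip x x != 0 by have [_ _ h _] := ip_inv; rewrite gt_eqF // h.
pose M0 := complex.Re `|ip x x|.
have M0_gt0 : 0 < M0.
  rewrite lt_def Re_normr_ge0 andbT; apply: contra ipx => /eqP e.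
  by rewrite -normr_eq0 Re_normr -/M0 e rmorph0.
pose N (g : G) := complex.Re `|ip (rep_act pi g x) x|.
have NE g : N g = complex.Re `|normalized_coeff ip x g| * M0.
  by rewrite /N /M0 -Re_normrM /normalized_coeff mulfVK.
pose h (g : G) : \bar R := ((N g) `^ (2 + 1))%:E.
have IwK k : Iw k -> rep_act pi k x = x by case=> hk _; apply: fx; apply/K2_0E.
have h_scalm a g : a != 0 -> h (scalm a * g)%g = h g.
  move=> a0; rewrite /h !NE (coeff_scalm ip_inv x0 om) // Re_normrM.
  by rewrite (Re_normr_conj1 (omega_unitary ip_inv x0 om a0)) mul1r.
have h_r k g : Iw k -> h (g * k)%g = h g.
  by move=> hk; rewrite /h !NE (coeff_fixr ip_inv) // IwK.
have h_l k g : Iw k -> h (k * g)%g = h g.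
  by move=> hk; rewrite /h !NE (coeff_fixl ip_inv) // IwK.
have h_meas : measurable_fun setT (h : ZmodG F -> \bar R) by exact: invariant_measurable.
have h_ge0 g : (0 <= h g)%E by rewrite lee_fin powR_ge0.
have int_fin : (\int[mu]_g h (g : G) < +oo)%E by exact: temp.
pose M := fine (\int[mu]_g h (g : G))%E.
have ME : (\int[mu]_g h (g : G) = M%:E)%E.
  by rewrite fineK // ge0_fin_numE // integral_ge0.
have bound n : (N (tpow F n)) ^+ 3 * (Q ^+ n / (Q + 1)) <= M.
  have mD : measurable (cell_d n : set (ZmodG F)) by apply: ZI_measurable; exact: cell_d_ZI.
  rewrite -lee_fin EFinM -(mu_cell_d q_prime mu_haar) -ME.
  rewrite -(integral_cst mu mD).
  rewrite (eq_integral (h : ZmodG F -> \bar R)).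
    by apply: ge0_subset_integral.
  move=> g; rewrite inE => Dg; rewrite (value_cell_d q_prime h_scalm h_l h_r Dg) /h /=.
  by rewrite (_ : 2 + 1 = 3%:R) ?powR_mulrn ?Re_normr_ge0 //; ring.
pose K0 := M * (Q + 1) / M0 ^+ 3.
have q1 : 0 < Q + 1 by rewrite addr_gt0.
have M_ge0 : 0 <= M.
  by apply: le_trans (bound 0%N); rewrite mulr_ge0 ?divr_ge0 ?exprn_ge0 ?Re_normr_ge0 ?ltW.
have K0_ge0 : 0 <= K0 by rewrite !(mulr_ge0, invr_ge0, exprn_ge0) // ltW.
pose r := (Q^-1) `^ (3^-1).
have r3 : r ^+ 3 = Q^-1.
  by rewrite -powR_mulrn ?powR_ge0 // -powRrM mulVf ?pnatr_eq0 // powRr1 // ltW.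
have r_ge0 : 0 <= r by exact: powR_ge0.
(* The cube of 1 + K0 dominates K0, which avoids a cube root of K0. *)
exists (1 + K0), r; split=> //.
  rewrite ltNge; apply/negP => r1; move: QV1; rewrite -r3 ltNge => /negP; apply.
  exact: exprn_ege1.
move=> n; have K1 : 0 <= 1 + K0 by rewrite addr_ge0.
rewrite -(@ler_pXn2r _ 3) ?nnegrE ?Re_normr_ge0 ?mulr_ge0 ?exprn_ge0 //.
rewrite exprMn -exprM mulnC exprM r3.
apply: (@le_trans _ _ (K0 * Q^-1 ^+ n)); last first.
  rewrite ler_wpM2r ?exprn_ge0 ?(ltW QV0) //.
  apply: (@le_trans _ _ (1 + K0)); first by rewrite lerDr.
  by rewrite -[leLHS]expr1; apply: ler_weXn2l; rewrite // lerDl.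
have := bound n; rewrite NE exprMn => b.
have M3 : 0 < M0 ^+ 3 by rewrite exprn_gt0.
have Qn : 0 < Q ^+ n by rewrite exprn_gt0.
have -> : K0 * Q^-1 ^+ n = M / (M0 ^+ 3 * (Q ^+ n / (Q + 1))).
  by rewrite /K0 exprVn; field; rewrite !gt_eqF.
by rewrite ler_pdivlMr ?mulr_gt0 ?invr_gt0 // mulrA.
Qed.

End Decay.

(** * Central characters, conductors and newvectors of principal series *)

Section RamifiedNewvector.
Variables (R : realType) (q : nat) (F : padicField R q).
Hypothesis q_prime : prime q.
Local Notation C := (R[i]).
Local Notation G := (GL2 F).
Local Notation "`| x |_q" := (padic_abs x) (format "`| x |_q").
Local Notation w := (q%:R : F).

(** A scalar acts in the induced model by chi.1 chi.2, the modulus factor being 1; comparison at a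
    point where some T v is nonzero gives omega. *)
Lemma principal_series_central (pi : smoothRep F) (chi : (F -> C) * (F -> C)) (omega : F -> C) :
  principal_series pi chi -> central_character pi omega -> (exists v : pi, v != 0) ->
  forall z, z != 0 -> omega z = chi.1 z * chi.2 z.
Proof.
case=> qc1 qc2 [T [T_lin T_inj T_range T_act]] om [v v0] z z0.
have [h hv] : exists h, T v h != 0.
  apply: contrapT => nex; move/eqP: v0; apply.
  apply: (model_eq T_inj) => g; rewrite (model0 T_lin).
  by apply/eqP/negPn/negP => nz; apply: nex; exists g.
apply: (mulIf hv); rewrite -(modelZ T_lin) -(act_scalm om z0) T_act -scC //.
rewrite (model_ind T_range) ?entry_mx2 ?diagm_det_neq0 //.
by rewrite mulfV // delta1 mulr1.
Qed.

Lemma conductor_zero (pi : smoothRep F) (chi : (F -> C) * (F -> C)) :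
  principal_series pi chi -> unramified chi.1 -> unramified chi.2 -> rep_conductor pi = 0%N.
Proof.
case=> qc1 qc2 [T [T_lin T_inj T_range T_act]] un1 un2.
by apply: least_eq => //; exact: (spherical_exists qc1 qc2 T_lin T_inj T_range T_act un1 un2).
Qed.

Lemma spherical_newvector (pi : smoothRep F) (chi : (F -> C) * (F -> C)) (x : pi) :
  principal_series pi chi -> unramified chi.1 -> unramified chi.2 -> newvector x ->
  [/\ x != 0, forall k, K2 0 k -> rep_act pi k x = x &
    \sum_j rep_act pi (s_hecke F j) x = ((sqrt_qV R q)^-1 * (chi.1 w + chi.2 w)) *: x].
Proof.
move=> ps un1 un2 [x0]; rewrite (conductor_zero ps un1 un2) => fx; split=> //.
have [qc1 qc2 [T [T_lin T_inj T_range T_act]]] := ps.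
exact: (spherical_eigen q_prime qc1 qc2 T_lin T_inj T_range T_act fx).
Qed.

(** Conductor exponent 1 rules out two unramified characters, since these would produce a spherical
    vector. A nonzero value of the newvector at 1 or at [weyl] then decides which character is
    unramified and shows the other to be trivial on 1 + q Z_q. *)
Lemma ramified_newvector (pi : smoothRep F) (chi : (F -> C) * (F -> C)) (x : pi) :
  principal_series pi chi -> rep_conductor pi = 1%N -> newvector x ->
  exists cu cr : F -> C,
    [/\ chi = (cu, cr) \/ chi = (cr, cu),
        [/\ quasicharacter cu, quasicharacter cr, unramified cu, ~ unramified cr &
            forall d, `|d|_q = 1 -> `|d - 1|_q < 1 -> cr d = 1],
        x != 0 /\ forall k, K2 1 k -> rep_act pi k x = x &
        \sum_(j < q) rep_act pi (ucoset j%:R) x = ((sqrt_qV R q)^-1 * cu w) *: x /\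
        \sum_(j < q) rep_act pi (lcoset j%:R) x = ((sqrt_qV R q)^-1 * (cu w)^-1) *: x].
Proof.
case=> qc1 qc2 [T [T_lin T_inj T_range T_act]] cond [x0]; rewrite cond => fx.
have [_ min] := least_neq0 cond isT.
have nun : ~ (unramified chi.1 /\ unramified chi.2).
  case=> un1 un2; have := min 0%N; rewrite ltnn => h; suff: false by [].
  by apply: h; exact: (spherical_exists qc1 qc2 T_lin T_inj T_range T_act un1 un2).
have [h1|h1] := eqVneq (T x 1%g) 0; last first.
  have un1 := model_one_unramified q_prime qc2 T_range T_act fx h1.
  have nun2 : ~ unramified chi.2 by move=> un2; apply: nun.
  exists chi.1, chi.2; split=> //.
  - by left; case: (chi).
  - by split=> //; move=> d; exact: (model_one_unit q_prime qc1 T_range T_act fx h1).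
  - by split; [exact: (upper_eigen1 q_prime qc1 qc2 T_lin T_inj T_range T_act nun2 fx)|
               exact: (lower_eigen1 q_prime qc1 qc2 T_lin T_inj T_range T_act nun2 fx)].
have [h2|h2] := eqVneq (T x (weyl F)) 0.
  by move/eqP: x0; case; exact: (model_fixed_eq0 q_prime T_lin T_inj T_range T_act fx h1 h2).
have un2 := model_weyl_unramified q_prime qc1 T_range T_act fx h2.
have nun1 : ~ unramified chi.1 by move=> un1; apply: nun.
exists chi.2, chi.1; split=> //.
- by right; case: (chi).
- by split=> //; move=> d; exact: (model_weyl_unit q_prime qc2 T_range T_act fx h2).
- by split; [exact: (upper_eigen2 q_prime qc1 qc2 T_lin T_inj T_range T_act nun1 fx)|
             exact: (lower_eigen2 q_prime qc1 qc2 T_lin T_inj T_range T_act nun1 fx)].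
Qed.

End RamifiedNewvector.

Lemma conjcM (R : rcfType) (x y : R[i]) : conjc (x * y) = conjc x * conjc y.
Proof. exact: rmorphM. Qed.

(** * The integral as a sum over the cells *)

Section LocalIntegral.
Variables (R : realType) (q : nat) (F : padicField R q).
Hypothesis q_prime : prime q.
Local Notation C := (R[i]).
Local Notation G := (GL2 F).
Local Notation "`| x |_q" := (padic_abs x) (format "`| x |_q").
Local Notation Q := (q%:R : R).
Local Notation w := (q%:R : F).
Local Notation u := (sqrt_qV R q).
Variables (mu : {measure set (ZmodG F) -> \bar R}) (mu_haar : haar_measure mu).
Variables (pi1 pi2 pi3 : smoothRep F).
Variables (ip1 : pi1 -> pi1 -> C) (ip2 : pi2 -> pi2 -> C) (ip3 : pi3 -> pi3 -> C).
Hypotheses (ip1_inv : invariant_inner_product ip1) (ip2_inv : invariant_inner_product ip2)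
  (ip3_inv : invariant_inner_product ip3).
Hypothesis temp1 : tempered mu ip1.
Variables omega1 omega2 omega3 : F -> C.
Hypotheses (om1 : central_character pi1 omega1) (om2 : central_character pi2 omega2)
  (om3 : central_character pi3 omega3).
Hypothesis om_prod : forall z : F, z != 0 -> omega1 z * omega2 z * omega3 z = 1.
Variables (x1 : pi1) (x2 : pi2) (x3 : pi3).
Hypotheses (x1_neq0 : x1 != 0) (x2_neq0 : x2 != 0) (x3_neq0 : x3 != 0).
Hypotheses (fx1 : forall k, K2 0 k -> rep_act pi1 k x1 = x1)
  (fx2 : forall k, K2 1 k -> rep_act pi2 k x2 = x2)
  (fx3 : forall k, K2 1 k -> rep_act pi3 k x3 = x3).
Variables t al be : C.
Hypotheses (al0 : al != 0) (be0 : be != 0).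
Hypothesis eig1 : \sum_j rep_act pi1 (s_hecke F j) x1 = (u^-1 * t) *: x1.
Hypothesis up2 : \sum_(j < q) rep_act pi2 (ucoset j%:R) x2 = (u^-1 * al) *: x2.
Hypothesis lo2 : \sum_(j < q) rep_act pi2 (lcoset j%:R) x2 = (u^-1 * al^-1) *: x2.
Hypothesis up3 : \sum_(j < q) rep_act pi3 (ucoset j%:R) x3 = (u^-1 * be) *: x3.
Hypothesis lo3 : \sum_(j < q) rep_act pi3 (lcoset j%:R) x3 = (u^-1 * be^-1) *: x3.
Variable e0 : F.
Hypotheses (e0_unit : `|e0|_q = 1) (e0_ram : omega2 e0 != 1).

Local Notation Phi1 := (normalized_coeff ip1 x1).
Local Notation Phi2 := (normalized_coeff ip2 x2).
Local Notation Phi3 := (normalized_coeff ip3 x3).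
Local Notation om := (omega1 w).

Let w0 := natF_neq0 F q_prime.
Let u0 := sqrt_qV_neq0 R q_prime.
Let q_u : (q%:R : C) = u ^- 2. Proof. by rewrite sqrt_qV_sqr // invrK. Qed.

Let conj_uq : conjc (u ^- 2 + 1) = u ^- 2 + 1.
Proof. by rewrite -q_u natr1; exact: conjc_nat. Qed.

Let Nal : al * conjc al = 1.
Proof. exact: (newvector_unitary q_prime ip2_inv x2_neq0 fx2 al0 up2 lo2). Qed.
Let Nbe : be * conjc be = 1.
Proof. exact: (newvector_unitary q_prime ip3_inv x3_neq0 fx3 be0 up3 lo3). Qed.

Let f (g : G) : C := Phi1 g * Phi2 g * Phi3 g.

Let om1_unit d : `|d|_q = 1 -> omega1 d = 1.
Proof.
move=> hd; have d0 : d != 0 by rewrite -abs_gt0 hd.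
have : rep_act pi1 (scalm d) x1 = x1.
  apply: fx1; apply/K2_0E/GL2_intE;
    rewrite dt_scalm // !entry_mx2 ?diagm_det_neq0 // abs0 padic_absM hd mulr1.
  by split.
rewrite (act_scalm om1) // => /eqP; rewrite -subr_eq0 -[X in _ - X]scale1r -scalerBl scaler_eq0.
by rewrite (negbTE x1_neq0) orbF subr_eq0 => /eqP.
Qed.

Let f_scalm a g : a != 0 -> f (scalm a * g)%g = f g.
Proof.
move=> a0; rewrite /f (coeff_scalm ip1_inv x1_neq0 om1) // (coeff_scalm ip2_inv x2_neq0 om2) //.
rewrite (coeff_scalm ip3_inv x3_neq0 om3) //.
by rewrite -[RHS]mul1r -(om_prod a0); ring.
Qed.

(** The last clause is the cancellation behind bi-invariance: omega1 is trivial on units, so omega2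
    omega3 is trivial there too. *)
Let Iw_act k : Iw k -> [/\ rep_act pi1 k x1 = x1, rep_act pi2 k x2 = omega2 (md k) *: x2,
   rep_act pi3 k x3 = omega3 (md k) *: x3 & omega2 (md k) * omega3 (md k) = 1].
Proof.
move=> hk; have [_ d1] := Iw_diag hk; have d0 : md k != 0 by rewrite -abs_gt0 d1.
split.
- by case: hk => h _; apply: fx1; apply/K2_0E.
- exact: newvector_Iw.
- exact: newvector_Iw.
- by rewrite -[LHS]mul1r -{1}(om1_unit d1) mulrA om_prod.
Qed.

Let f_l k g : Iw k -> f (k * g)%g = f g.
Proof.
move/Iw_act => [h1 h2 h3 e]; rewrite /f (coeff_fixl ip1_inv) // (coeffMl ip2_inv x2_neq0 _ h2) //.
rewrite (coeffMl ip3_inv x3_neq0 _ h3) //.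
by rewrite -[RHS]mul1r -e; ring.
Qed.

Let f_r k g : Iw k -> f (g * k)%g = f g.
Proof.
move/Iw_act => [h1 h2 h3 e]; rewrite /f (coeff_fixr ip1_inv) // (coeffMr ip2_inv _ h2) //.
rewrite (coeffMr ip3_inv _ h3) //.
by rewrite -[RHS]mul1r -e; ring.
Qed.

Let fV g : f (g^-1)%g = conjc (f g).
Proof. by rewrite /f !coeffV // !rmorphM. Qed.

Let f_antidiag b c : b != 0 -> c != 0 -> f (antidiag b c) = 0.
Proof.
move=> b0 c0; rewrite /f (newvector_antidiag q_prime ip2_inv x2_neq0 om2 fx2 e0_unit e0_ram) //.
by rewrite mulr0 mul0r.
Qed.

Let phi n := Phi1 (tpow F n).
Let f_tpow n : f (tpow F n) = phi n * ((u * al) ^+ n * (u * be) ^+ n).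
Proof.
by rewrite /f (newvector_tpow q_prime ip2_inv x2_neq0 fx2 up2) (newvector_tpow q_prime ip3_inv
  x3_neq0 fx3 up3) mulrA.
Qed.

Let m n : R := Q ^+ n / (Q + 1).

Let mC n : ((m n)%:C)%C = (u ^- 2) ^+ n / (u ^- 2 + 1).
Proof. by rewrite /m fmorph_div rmorphD rmorphXn rmorph1 /= rmorph_nat q_u. Qed.

(** The two factors u^n from the ramified coefficients cancel the growth u^(-2n) of the cell. *)
Let f_m n : f (tpow F n) * ((m n)%:C)%C = (u ^- 2 + 1)^-1 * (phi n * (al * be) ^+ n).
Proof.
rewrite f_tpow mC !exprMn exprVn -exprM mulnC exprM.
have q1C : (u ^- 2 + 1) != 0 by rewrite -q_u natr1 pnatr_eq0.
have : u ^+ n != 0 by rewrite expf_neq0.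
move: (u ^+ n) (u ^- 2 + 1) q1C => y y1 y10 y0.
by field; rewrite y0 y10.
Qed.

(* The witness is the integral over the cells cell_d n; the cells cell_a n
   contribute the conjugates, and n = 0 is counted twice.  The antidiagonal cells
   contribute nothing because omega2 is ramified.  The second equation sums the Hecke recursion of phi. *)
Lemma normalized_product_integral : exists I : C,
  I_local mu ip1 ip2 ip3 x1 x2 x3 = I + conjc I - (u ^- 2 + 1)^-1 /\
  I * (1 - u * (al * be) * t + u ^+ 2 * (al * be) ^+ 2 * om) =
    (u ^- 2 + 1)^-1 * (1 + u * (al * be) * t / (1 + u ^+ 2) - u * (al * be) * t).
Proof.
have [K [r [r0 r1 bnd]]] := tempered_decay q_prime mu_haar ip1_inv temp1 om1 x1_neq0 fx1.
have Q0 := q_gt0 R q_prime.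
have q1 : 0 < Q + 1 by rewrite addr_gt0.
have q1C : (u ^- 2 + 1) != 0 by rewrite -q_u natr1 pnatr_eq0.
have Nab : complex.Re `|al * be| = 1.
  by rewrite Re_normrM !Re_normr_conj1 // mulr1.
have bnd' n : complex.Re `|f (tpow F n)| * m n <= K / (Q + 1) * r ^+ n.
  have -> : complex.Re `|f (tpow F n)| * m n = complex.Re `|f (tpow F n) * ((m n)%:C)%C|.
    rewrite Re_normrM [X in _ = _ * X](_ : _ = m n) //=.
    by rewrite expr0n /= addr0 sqrtr_sqr ger0_norm // divr_ge0 ?exprn_ge0 ?ltW.
  rewrite f_m Re_normrM (Re_normrM (phi n)) Re_normrX Nab expr1n mulr1.
  have -> : complex.Re `|(u ^- 2 + 1)^-1| = (Q + 1)^-1.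
    have -> : (u ^- 2 + 1)^-1 = (((Q + 1)^-1)%:C)%C by rewrite fmorphV rmorphD rmorph1 /=
      rmorph_nat q_u.
    by rewrite /= expr0n /= addr0 sqrtr_sqr ger0_norm // invr_ge0 ltW.
  by rewrite [leLHS]mulrC [leRHS]mulrAC ler_wpM2r ?invr_ge0 ?(ltW q1) //; exact: bnd.
pose P1 := \bigcup_n (cell_d n : set G); pose P2 := \bigcup_n (cell_a n.+1 : set G).
pose f1 (g : G) := if `[< P1 g >] then f g else 0.
pose f2 (g : G) := if `[< P2 g >] then f g else 0.
have f12 g : f g = f1 g + f2 g.
  rewrite /f1 /f2; case: asboolP => [[n _ h]|h1]; case: asboolP => [[n' _ h']|h2].
  - by have [_] := cell_d_cell_a_disjoint q_prime h h'.
  - by rewrite addr0.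
  - by rewrite add0r.
  - have [||b [c [b0 c0 ->]]] := value_antidiag q_prime f_l f_r (g := g).
    + by move=> n h; apply: h1; exists n.
    + by move=> n h; apply: h2; exists n.
    by rewrite f_antidiag // addr0.
have [iR1 iI1 s1] : [/\ mu.-integrable setT (EFin \o (fun g : ZmodG F => complex.Re (f1 g))),
      mu.-integrable setT (EFin \o (fun g : ZmodG F => complex.Im (f1 g))) &
      csum (fun n => f (tpow F n) * ((m n)%:C)%C) (complex_integral mu f1)].
  apply: (complex_integral_step (D := fun n => cell_d n) (K := K / (Q + 1)) (r := r)) => //.
  - by move=> n; apply: ZI_measurable; exact: cell_d_ZI.
  - by move=> i j _ _ [g [hi hj]]; exact: (cell_d_disjoint q_prime hi hj).
  - by move=> n; exact: mu_cell_d.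
  - move=> n g h; rewrite /f1 asboolT; last by exists n.
    exact: (value_cell_d q_prime f_scalm f_l f_r h).
  - by move=> g h; rewrite /f1 asboolF // => -[n _]; exact: h.
have [iR2 iI2 s2] : [/\ mu.-integrable setT (EFin \o (fun g : ZmodG F => complex.Re (f2 g))),
      mu.-integrable setT (EFin \o (fun g : ZmodG F => complex.Im (f2 g))) &
      csum (fun n => conjc (f (tpow F n.+1)) * ((m n.+1)%:C)%C) (complex_integral mu f2)].
  (* The extra factor [r] in the constant absorbs the shift of the exponent by one. *)
  apply: (complex_integral_step (D := fun n => cell_a n.+1) (K := K / (Q + 1) *
    r) (r := r)) => //.
  - by move=> n; apply: ZI_measurable; exact: cell_a_ZI.
  - by move=> i j _ _ [g [hi hj]]; have [] := cell_a_disjoint q_prime hi hj.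
  - by move=> n; exact: mu_cell_a.
  - move=> n g h; rewrite /f2 asboolT; last by exists n.
    by rewrite (value_cell_a q_prime f_scalm f_l f_r h) fV.
  - by move=> g h; rewrite /f2 asboolF // => -[n _]; exact: h.
  - move=> n; rewrite -mulrA -exprS; apply: le_trans (bnd' n.+1).
    by case: (f _) => a b /=; rewrite sqrrN.
have e2 : complex_integral mu f2 = conjc (complex_integral mu f1) - (u ^- 2 + 1)^-1.
  (* The term of exponent 0, equal to 1 / (q + 1), already belongs to the first family and is
     dropped from the conjugate series. *)
  have := csum_shift (csum_conj s1); rewrite f_m expr0 mulr1 /phi.
  have -> : tpow F 0 = 1%g by apply: GL2_ext;
    rewrite !entry_mx2 ?diagm_det_neq0 ?expr0 ?oner_neq0 ?ma1 ?mb1 ?mc1 ?md1.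
  rewrite coeff1 // mulr1 => h.
  have := csum_uniq _ h => /(_ (complex_integral mu f2)) ->.
    by congr (_ - _); rewrite conjc_inv conj_uq.
  have -> : (fun n => conjc (f (tpow F n.+1) * ((m n.+1)%:C)%C)) =
    (fun n => conjc (f (tpow F n.+1)) * ((m n.+1)%:C)%C).
    by apply/funext => n; rewrite conjcM; congr (_ * _); exact: conjc_real.
  exact: s2.
exists (complex_integral mu f1); split.
  rewrite -addrA -e2 /I_local /complex_integral; apply/eqP; rewrite eq_complex /=.
  have -> : (fun g : GL2 F => complex.Re (Phi1 g * Phi2 g * Phi3 g)) =
    (fun g => complex.Re (f1 g) + complex.Re (f2 g)).
    by apply/funext => g; rewrite -[_ * _ * _]/(f g) f12; case: (f1 g) (f2 g) => [? ?] [].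
  have -> : (fun g : GL2 F => complex.Im (Phi1 g * Phi2 g * Phi3 g)) =
    (fun g => complex.Im (f1 g) + complex.Im (f2 g)).
    by apply/funext => g; rewrite -[_ * _ * _]/(f g) f12; case: (f1 g) (f2 g) => [? ?] [].
  by rewrite !RintegralD // !eqxx.
have phi0 : phi 0 = 1.
  by rewrite /phi -(coeff1 ip1_inv x1_neq0); congr Phi1; apply: GL2_ext;
    rewrite !entry_mx2 ?diagm_det_neq0 ?expr0 ?oner_neq0 ?ma1 ?mb1 ?mc1 ?md1.
have phi1 : (u ^- 2 + 1) * phi 1 = u^-1 * t.
  by rewrite -q_u; exact: (spherical_rec0 q_prime ip1_inv x1_neq0 fx1 eig1).
have rec n : u^-1 * t * phi n.+1 = u ^- 2 * phi n.+2 + om * phi n.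
  by rewrite -q_u; exact: (spherical_rec q_prime ip1_inv x1_neq0 om1 fx1 eig1).
have uq : 1 + u ^+ 2 != 0.
  have -> : 1 + u ^+ 2 = u ^+ 2 * (u ^- 2 + 1) by rewrite mulrDr mulr1 mulfV ?expf_neq0.
  by rewrite mulf_neq0 ?expf_neq0.
have phi1' : phi 1 = u * t / (1 + u ^+ 2).
  by apply: (mulfI q1C); rewrite phi1; field; rewrite uq u0.
have rec' n : phi n.+2 = u * t * phi n.+1 - u ^+ 2 * om * phi n.
  have u2 : u ^- 2 != 0 by rewrite invr_eq0 expf_neq0.
  apply: (mulfI u2); have := rec n => h.
  have -> : u ^- 2 * phi n.+2 = u^-1 * t * phi n.+1 - om * phi n by rewrite h addrK.
  by field.
(* Twisting by (al be)^n scales the two coefficients of the recursion by al be and its square. *)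
have := csum_linear_rec s1 (s := u * (al * be) * t) (p := u ^+ 2 * (al * be) ^+ 2 * om).
move=> ->; last first.
  by move=> n; rewrite !f_m rec' !exprS; ring.
rewrite !f_m phi0 phi1' expr0 expr1 mulr1.
by field; rewrite ?uq ?u0 ?andbT.
Qed.

(** t is a real multiple of phi(diag(q, 1)), so the symmetry of phi under inversion passes to it. *)
Lemma central_value_conj : conjc t = t / om.
Proof.
have q1C : (u ^- 2 + 1) != 0 by rewrite -q_u natr1 pnatr_eq0.
have phi1 : (u ^- 2 + 1) * phi 1 = u^-1 * t.
  by rewrite -q_u; exact: (spherical_rec0 q_prime ip1_inv x1_neq0 fx1 eig1).
have := spherical_conj1 q_prime ip1_inv x1_neq0 om1 fx1; rewrite -/(phi 1) => h.
have tE : t = u * (u ^- 2 + 1) * phi 1 by rewrite -mulrA phi1 mulVKf.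
move: (phi 1) tE h => p1 -> h.
rewrite (conjcM _ p1) (conjcM u) h conj_uq.
have -> : conjc u = u by exact: conjc_real.
by ring.
Qed.

(* The decay of phi 1, phi 2, ... excludes the parameters of one-dimensional
   representations, for which phi n has modulus 1. *)
Lemma tempered_ratio a b : t = a + b -> om = a * b -> b != 0 -> 1 - u ^+ 2 * (a / b) != 0.
Proof.
move=> tab oab b0; apply/negP => /eqP h.
have bE : b = u ^+ 2 * a.
  by move: h => /eqP; rewrite subr_eq0 mulrA => /eqP e; rewrite -[b]mul1r {1}e mulfVK.
have q1C : (u ^- 2 + 1) != 0 by rewrite -q_u natr1 pnatr_eq0.
have phi0 : phi 0 = 1.
  by rewrite /phi -(coeff1 ip1_inv x1_neq0); congr Phi1; apply: GL2_ext;
    rewrite !entry_mx2 ?diagm_det_neq0 ?expr0 ?oner_neq0 ?ma1 ?mb1 ?mc1 ?md1.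
have phi1 : (u ^- 2 + 1) * phi 1 = u^-1 * t.
  by rewrite -q_u; exact: (spherical_rec0 q_prime ip1_inv x1_neq0 fx1 eig1).
have rec n : u^-1 * t * phi n.+1 = u ^- 2 * phi n.+2 + om * phi n.
  by rewrite -q_u; exact: (spherical_rec q_prime ip1_inv x1_neq0 om1 fx1 eig1).
(* The recursion has roots u a and u b; for b = a / q the initial values select u a alone. *)
have phiE n : phi n = (u * a) ^+ n /\ phi n.+1 = (u * a) ^+ n.+1.
  elim: n => [|n [IH IH1]].
    rewrite expr0 phi0 expr1; split=> //; apply: (mulfI q1C); rewrite phi1 tab bE.
    by field.
  split=> //; have u2 : u ^- 2 != 0 by rewrite invr_eq0 expf_neq0.
  apply: (mulfI u2); have := rec n; rewrite IH IH1 => hr.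
  have -> : u ^- 2 * phi n.+2 = u^-1 * t * (u * a) ^+ n.+1 - om * (u *
    a) ^+ n by rewrite hr addrK.
  rewrite tab oab bE !exprS; field.
  by [].
(* The square of u a is a b, the value at q of a unitary central character. *)
have N1 : complex.Re `|u * a| = 1.
  have /eqP : complex.Re `|u * a| ^+ 2 = 1.
    rewrite -Re_normrX (_ : (u * a) ^+ 2 = om); last by rewrite oab bE; ring.
    by rewrite Re_normr_conj1 // (omega_unitary ip1_inv x1_neq0 om1).
  rewrite sqrf_eq1 => /orP[/eqP //|/eqP e].
  by have := Re_normr_ge0 (u * a); rewrite e ler0N1.
have [K [r [r0 r1 bnd]]] := tempered_decay q_prime mu_haar ip1_inv temp1 om1 x1_neq0 fx1.
have b1 n : 1 <= K * r ^+ n.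
  by apply: le_trans (bnd n); rewrite -/(phi n) (phiE n).1 Re_normrX N1 expr1n.
have : geometric K r @ \oo --> (0 : R) by apply: cvg_geometric; rewrite ger0_norm.
move=> /cvgr_lt /(_ 1 ltr01) [N _ /(_ N (leqnn N))] /=.
by rewrite ltNge b1.
Qed.

End LocalIntegral.

(** * L-factors *)

Section LFactors.
Variables (R : realType) (q : nat) (F : padicField R q).
Hypothesis q_prime : prime q.
Local Notation C := (R[i]).
Local Notation "`| x |_q" := (padic_abs x) (format "`| x |_q").
Local Notation Q := (q%:R : R).
Local Notation w := (q%:R : F).
Local Notation u := (sqrt_qV R q).
Implicit Types a b c : F -> C.

Lemma qpowN1 : qpow q (- 1 : R) = u ^+ 2.
Proof.
by rewrite sqrt_qV_sqr // /qpow powR_inv1 ?ler0n // fmorphV /= rmorph_nat.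
Qed.

Lemma qpowN2 : qpow q (- 2 : R) = u ^+ 4.
Proof.
rewrite (exprM u 2 2) sqrt_qV_sqr // /qpow powRN -[2]/(2%:R) powR_mulrn ?ler0n //.
by rewrite fmorphV rmorphXn /= rmorph_nat exprVn.
Qed.

Lemma qpow_half : qpow q (- 2^-1 : R) = u.
Proof. by rewrite /qpow /sqrt_qV powRN powR12_sqrt ?ler0n // sqrtrV ?ler0n. Qed.

Lemma zeta1 : zeta q (1 : R) = (1 - u ^+ 2)^-1. Proof. by rewrite /zeta qpowN1. Qed.
Lemma zeta2 : zeta q (2 : R) = (1 - u ^+ 4)^-1. Proof. by rewrite /zeta qpowN2. Qed.

Lemma L_char_unramified a s : unramified a -> L_char a s = (1 - a w * qpow q (- s))^-1.
Proof. by move=> h; rewrite /L_char asboolT. Qed.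

Lemma L_char_ramified a s : ~ unramified a -> L_char a s = 1.
Proof. by move=> h; rewrite /L_char asboolF. Qed.

Lemma L_ad_unramified a b : unramified a -> unramified b ->
  L_ad (a, b) 1 = (1 - a w / b w * u ^+ 2)^-1 * (1 - u ^+ 2)^-1 * (1 - b w / a w * u ^+ 2)^-1.
Proof.
move=> ha hb; rewrite /L_ad zeta1 !L_char_unramified ?qpowN1 //.
  by move=> x hx /=; rewrite ha // hb // divr1.
by move=> x hx /=; rewrite ha // hb // divr1.
Qed.

(** The ratio of an unramified and a ramified character is ramified, so only the zeta factor
    survives. *)
Lemma L_ad_ramified (chi : (F -> C) * (F -> C)) a b : unramified a -> ~ unramified b ->
  chi = (a, b) \/ chi = (b, a) -> L_ad chi 1 = (1 - u ^+ 2)^-1.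
Proof.
move=> ha hb; have r1 : ~ unramified (fun x : F => a x / b x).
  move=> h; apply: hb => x hx; apply: invr_inj.
  by rewrite invr1 -(h x hx) ha // mul1r.
have r2 : ~ unramified (fun x : F => b x / a x).
  by move=> h; apply: hb => x hx; rewrite -(h x hx) ha // divr1.
by case=> ->; rewrite /L_ad /= zeta1 !L_char_ramified // mul1r mulr1.
Qed.

(** Of the eight products, the four with exactly one of b2, c2 are ramified and contribute 1; in the
    two containing both, the ramification cancels. *)
Lemma L_triple_value a1 a2 b1 b2 c1 c2 (chi2 chi3 : (F -> C) * (F -> C)) :
  unramified a1 -> unramified a2 -> unramified b1 -> unramified c1 ->
  ~ unramified b2 -> ~ unramified c2 -> unramified (fun x : F => b2 x * c2 x) ->
  chi2 = (b1, b2) \/ chi2 = (b2, b1) -> chi3 = (c1, c2) \/ chi3 = (c2, c1) ->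
  L_triple (a1, a2) chi2 chi3 2^-1 =
    ((1 - a1 w * (b1 w * c1 w) * u) * (1 - a2 w * (b1 w * c1 w) * u) *
     ((1 - a1 w * (b2 w * c2 w) * u) * (1 - a2 w * (b2 w * c2 w) * u)))^-1.
Proof.
rewrite !(mulrA (a1 w)) !(mulrA (a2 w)).
move=> ha1 ha2 hb1 hc1 hb2 hc2 hbc e2 e3.
have uu a b c : unramified a -> unramified b -> unramified c ->
    L_char (fun x : F => a x * b x * c x) 2^-1 = (1 - a w * b w * c w * u)^-1.
  by move=> ha hb hc; rewrite L_char_unramified ?qpow_half // => x hx;
    rewrite ha // hb // hc // !mulr1.
have rr a : unramified a -> L_char (fun x : F => a x * b2 x * c2 x) 2^-1 =
  (1 - a w * b2 w * c2 w * u)^-1.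
  by move=> ha; rewrite L_char_unramified ?qpow_half // => x hx; rewrite ha // mul1r hbc.
have rr' a : unramified a -> L_char (fun x : F => a x * b2 x * c1 x) 2^-1 = 1.
  by move=> ha; apply: L_char_ramified => h; apply: hb2 => x hx;
    rewrite -(h x hx) ha // hc1 // mul1r mulr1.
have rr'' a : unramified a -> L_char (fun x : F => a x * b1 x * c2 x) 2^-1 = 1.
  by move=> ha; apply: L_char_ramified => h; apply: hc2 => x hx;
    rewrite -(h x hx) ha // hb1 // !mul1r.
by rewrite /L_triple; case: e2 => ->; case: e3 => ->; rewrite !big_cons !big_nil /=
  (uu a1 b1 c1) // (uu a2 b1 c1) // (rr a1) // (rr a2) // (rr' a1) // (rr' a2) // (rr'' a1) //
    (rr'' a2) //
  !invfM ?(mulr1, mul1r); ring.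
Qed.

End LFactors.

(** J and J' stand for the sum over n >= 0 and its conjugate, g and g' for the values at q of the
    products of the unramified and of the ramified characters of pi2 and pi3. The coefficients of J
    and J' in the two equations are the inverse factors of the triple product for g and for g' = (a
    b g)^-1. *)
Lemma triple_product_identity (C : fieldType) (u a b g g' J J' : C) :
  u != 0 -> a != 0 -> b != 0 -> g != 0 -> a * b * (g * g') = 1 ->
  1 - u ^+ 2 != 0 -> 1 + u ^+ 2 != 0 ->
  1 - u ^+ 2 * (a / b) != 0 -> 1 - u ^+ 2 * (b / a) != 0 ->
  J * (1 - u * g * (a + b) + u ^+ 2 * g ^+ 2 * (a * b)) =
    (u ^- 2 + 1)^-1 * (1 + u * g * (a + b) / (1 + u ^+ 2) - u * g * (a + b)) ->
  J' * (1 - u * g^-1 * ((a + b) / (a * b)) + u ^+ 2 * g^-1 ^+ 2 * (a * b)^-1) =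
    (u ^- 2 + 1)^-1 * (1 + u * g^-1 * ((a + b) / (a * b)) / (1 + u ^+ 2) - u * g^-1 *
      ((a + b) / (a * b))) ->
  (1 - a / b * u ^+ 2)^-1 * (1 - u ^+ 2)^-1 * (1 - b / a * u ^+ 2)^-1 * (1 - u ^+ 2)^-1 *
    (1 - u ^+ 2)^-1 *
  ((1 - a * g * u) * (1 - b * g * u) * ((1 - a * g' * u) * (1 - b * g' * u)) *
    (1 - u ^+ 4) ^+ 2) *
  (J + J' - (u ^- 2 + 1)^-1) = u ^+ 2.
Proof.
move=> u0 a0 b0 g0 abg n1 n2 n3 n4 hJ hJ'.
have g'E : g' = (a * b * g)^-1.
  have abg0 : a * b * g != 0 by rewrite !mulf_neq0.
  by apply: (mulfI abg0); rewrite mulfV // -abg; ring.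
have n3' : b - a * u ^+ 2 != 0.
  by apply: contra n3 => /eqP h; apply/eqP; apply: (mulIf b0); rewrite mul0r -h; field.
have n4' : a - b * u ^+ 2 != 0.
  by apply: contra n4 => /eqP h; apply/eqP; apply: (mulIf a0); rewrite mul0r -h; field.
pose D := 1 - u * g * (a + b) + u ^+ 2 * g ^+ 2 * (a * b).
pose D' := 1 - u * g^-1 * ((a + b) / (a * b)) + u ^+ 2 * g^-1 ^+ 2 * (a * b)^-1.
have eD : (1 - a * g * u) * (1 - b * g * u) = D by rewrite /D; ring.
have eD' : (1 - a * g' * u) * (1 - b * g' * u) = D'.
  by rewrite /D' g'E; field; rewrite g0 a0 b0.
have e4 : 1 - u ^+ 4 = (1 - u ^+ 2) * (1 + u ^+ 2) by ring.
have ek : (u ^- 2 + 1)^-1 = u ^+ 2 / (1 + u ^+ 2) by field; rewrite u0 n2.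
rewrite eD eD'.
(* Multiplying by D D' eliminates J and J' even where D or D' vanishes. *)
have key : D * D' * (J + J' - (u ^- 2 + 1)^-1) =
    D' * ((u ^- 2 + 1)^-1 * (1 + u * g * (a + b) / (1 + u ^+ 2) - u * g * (a + b))) +
    D * ((u ^- 2 + 1)^-1 * (1 + u * g^-1 * ((a + b) / (a * b)) / (1 + u ^+ 2) - u * g^-1 *
      ((a + b) / (a * b)))) -
    D * D' * (u ^- 2 + 1)^-1.
  by rewrite -hJ -hJ' -/D -/D'; ring.
have assoc (x y z t : C) : x * (y * z) * t = x * z * (y * t) by ring.
rewrite assoc key /D /D' e4 ek.
field.
by rewrite n1 n2 n3' n4' a0 b0 g0.
Qed.

(** * Conductors and L^H-factors of the ramified representations *)

Section RamifiedConductor.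
Variables (R : realType) (q : nat) (F : padicField R q).
Hypothesis q_prime : prime q.
Local Notation C := (R[i]).

(** Step 0 of the unit filtration is all of Z_q^*, on which b is nontrivial; step 1 is 1 + q Z_q, on
    which b is trivial. *)
Lemma char_conductor_one (omega a b : F -> C) :
  (forall z, z != 0 -> omega z = a z * b z) -> unramified a -> ~ unramified b ->
  (forall d, padic_abs d = 1 -> padic_abs (d - 1) < 1 -> b d = 1) -> char_conductor omega = 1%N.
Proof.
move=> om ha hb hb1; have unit0 (x : F) : padic_abs x = 1 -> x != 0.
  by move=> hx; rewrite -abs_gt0 hx.
apply: least_eq => [x [hx hx1]|[|n] // P].
  rewrite om ?unit0 // ha // hb1 // ?mulr1 //.
  by apply: le_lt_trans hx1 _; rewrite expr1 qV_lt1.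
exfalso; apply: hb => x hx; have x0 := unit0 x hx.
have : omega x = 1.
  by apply: P; split=> //; rewrite expr0 invr1 absB_le ?abs1 ?hx.
by rewrite om // ha // mul1r.
Qed.

Lemma LH_ad_ramified (pi : smoothRep F) (omega : F -> C) (chi : (F -> C) * (F -> C)) :
  rep_conductor pi = 1%N -> char_conductor omega = 1%N ->
  LH_ad pi omega chi = (1 - (sqrt_qV R q) ^+ 4)^-1.
Proof.
move=> e1 e2; rewrite /LH_ad e1 e2 /=.
by rewrite (exprM _ 2 2) sqrt_qV_sqr // exprVn.
Qed.

End RamifiedConductor.

(** * Conjugation of the series equation, and the conclusion *)

Lemma invM_eq1_r (C : fieldType) (x y : C) : x * y = 1 -> y = x^-1.
Proof.
move=> h; have x0 : x != 0 by apply: contra_eq_neq h => ->; rewrite mul0r eq_sym oner_eq0.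
by apply: (mulfI x0); rewrite h mulfV.
Qed.

(** Applied to complex conjugation: u is real, and unitarity turns g, t and o into g^-1, t / o and
    o^-1, which yields the equation for the negative exponents. *)
Lemma hecke_series_morph (C : fieldType) (f : {rmorphism C -> C}) (u g g' t t' o o' J : C) :
  f u = u -> f g = g' -> f t = t' -> f o = o' ->
  J * (1 - u * g * t + u ^+ 2 * g ^+ 2 * o) =
    (u ^- 2 + 1)^-1 * (1 + u * g * t / (1 + u ^+ 2) - u * g * t) ->
  f J * (1 - u * g' * t' + u ^+ 2 * g' ^+ 2 * o') =
    (u ^- 2 + 1)^-1 * (1 + u * g' * t' / (1 + u ^+ 2) - u * g' * t').
Proof.
move=> fu fg ft fo /(congr1 f).
by rewrite !(rmorphM, rmorphB, rmorphD, rmorph1, rmorphXn, fmorphV) /= fu fg ft fo.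
Qed.

Theorem proposition2p2p3 (R : realType) (q : nat) (q_prime : prime q)
  (F : padicField R q)
  (mu : {measure set (ZmodG F) -> \bar R}) (mu_haar : haar_measure mu)
  (pi1 pi2 pi3 : smoothRep F)
  (irr1 : irreducible pi1) (irr2 : irreducible pi2) (irr3 : irreducible pi3)
  (ip1 : pi1 -> pi1 -> R[i]) (ip2 : pi2 -> pi2 -> R[i])
  (ip3 : pi3 -> pi3 -> R[i])
  (ip1_inv : invariant_inner_product ip1)
  (ip2_inv : invariant_inner_product ip2)
  (ip3_inv : invariant_inner_product ip3)
  (temp1 : tempered mu ip1) (temp2 : tempered mu ip2) (temp3 : tempered mu ip3)
  (omega1 omega2 omega3 : F -> R[i])
  (omega1_pi1 : central_character pi1 omega1)
  (omega2_pi2 : central_character pi2 omega2)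
  (omega3_pi3 : central_character pi3 omega3)
  (omega_prod : forall z : F, z != 0 -> omega1 z * omega2 z * omega3 z = 1)
  (chi1 chi2 chi3 : (F -> R[i]) * (F -> R[i]))
  (ps1 : principal_series pi1 chi1)
  (unr1 : unramified chi1.1 /\ unramified chi1.2)
  (ps2 : principal_series pi2 chi2) (cond2 : rep_conductor pi2 = 1%N)
  (ps3 : principal_series pi3 chi3) (cond3 : rep_conductor pi3 = 1%N)
  (x1 : pi1) (x2 : pi2) (x3 : pi3)
  (new1 : newvector x1) (new2 : newvector x2) (new3 : newvector x3) :
  I_star mu chi1 chi2 chi3 ip1 ip2 ip3 x1 x2 x3 = q%:R^-1 /\
  E_factor pi1 pi2 pi3 omega1 omega2 omega3 chi1 chi2 chi3 =
    (1 + q%:R^-1) ^- 2.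
Proof.
have [un1 un1'] := unr1.
have [x1_neq0 fx1 eig1] := spherical_newvector q_prime ps1 un1 un1' new1.
have [b1 [b2 [e2 [qb1 qb2 ub1 rb2 tb2] [x2_neq0 fx2] [up2 lo2]]]] := ramified_newvector q_prime
  ps2 cond2 new2.
have [c1 [c2 [e3 [qc1 qc2 uc1 rc2 tc2] [x3_neq0 fx3] [up3 lo3]]]] := ramified_newvector q_prime
  ps3 cond3 new3.
have [qa1 qa2 _] := ps1.
set w : F := q%:R; have w0 : w != 0 := natF_neq0 F q_prime.
have nz (chi : F -> R[i]) z : quasicharacter chi -> z != 0 -> chi z != 0.
  by case=> h _ _; exact: h.
have om1 z : z != 0 -> omega1 z = chi1.1 z * chi1.2 z.
  by apply: principal_series_central ps1 omega1_pi1 _ _; exists x1.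
have om2 z : z != 0 -> omega2 z = b1 z * b2 z.
  move=> z0; rewrite (principal_series_central ps2 omega2_pi2) //; last by exists x2.
  by case: e2 => -> //=; rewrite mulrC.
have om3 z : z != 0 -> omega3 z = c1 z * c2 z.
  move=> z0; rewrite (principal_series_central ps3 omega3_pi3) //; last by exists x3.
  by case: e3 => -> //=; rewrite mulrC.
have unit0 (x : F) : padic_abs x = 1 -> x != 0 by move=> hx; rewrite -abs_gt0 hx.
have ubc : unramified (fun x : F => b2 x * c2 x).
  move=> x hx; have := omega_prod x (unit0 x hx).
  by rewrite om1 ?om2 ?om3 ?unit0 // un1 // un1' // ub1 // uc1 // !mul1r.
(* A unit detecting the ramification of omega2, required for the vanishing on antidiagonal cells. *)
have [e0 [e0_unit e0_ram]] : exists e : F, padic_abs e = 1 /\ omega2 e != 1.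
  apply: contrapT => h; apply: rb2 => x hx; apply/eqP/negPn/negP => hn; apply: h.
  by exists x; split=> //; rewrite om2 ?unit0 // ub1 // mul1r.
set u := sqrt_qV R q.
have u0 : u != 0 := sqrt_qV_neq0 R q_prime.
have q_u : (q%:R : R[i]) = u ^- 2 by rewrite sqrt_qV_sqr // invrK.
have q0 : (q%:R : R[i]) != 0 by rewrite pnatr_eq0 -lt0n prime_gt0.
have n2 : 1 + u ^+ 2 != 0.
  have -> : 1 + u ^+ 2 = u ^+ 2 * (q%:R + 1) by rewrite q_u mulrDr mulr1 mulfV ?expf_neq0.
  by rewrite mulf_neq0 ?expf_neq0 // natr1 pnatr_eq0.
have n1 : 1 - u ^+ 2 != 0.
  rewrite sqrt_qV_sqr // subr_eq0 eq_sym invr_eq1 -[1]/(1%:R) eqr_nat.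
  by rewrite gtn_eqF // prime_gt1.
set a := chi1.1 w in eig1 *; set b := chi1.2 w in eig1.
have a0 : a != 0 by exact: nz.
have b0 : b != 0 by exact: nz.
have b1w : b1 w != 0 by exact: nz.
have c1w : c1 w != 0 by exact: nz.
have [J [IE JE]] := normalized_product_integral q_prime mu_haar ip1_inv ip2_inv ip3_inv temp1
  omega1_pi1 omega2_pi2 omega3_pi3 omega_prod x1_neq0 x2_neq0 x3_neq0 fx1 fx2 fx3 b1w c1w
  eig1 up2 lo2 up3 lo3 e0_unit e0_ram.
have tconj := central_value_conj q_prime ip1_inv omega1_pi1 x1_neq0 fx1 eig1.
have omw : omega1 w = a * b by exact: om1.
(* The two possible poles of L(ad pi1, 1) are exchanged by swapping a and b, so one lemma excludes
   both. *)
have n3 := tempered_ratio q_prime mu_haar ip1_inv temp1 omega1_pi1 x1_neq0 fx1 eig1 (erefl (a +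
  b)) omw b0.
have n4 := tempered_ratio q_prime mu_haar ip1_inv temp1 omega1_pi1 x1_neq0 fx1 eig1 (addrC a b)
  (etrans omw (mulrC a b)) a0.
have Nb1 := newvector_unitary q_prime ip2_inv x2_neq0 fx2 b1w up2 lo2.
have Nc1 := newvector_unitary q_prime ip3_inv x3_neq0 fx3 c1w up3 lo3.
have Nom := omega_unitary ip1_inv x1_neq0 omega1_pi1 w0.
have chi1E : chi1 = (chi1.1, chi1.2) by case: (chi1).
split.
  rewrite /I_star IE [in LHS]chi1E L_ad_unramified //.
  rewrite (L_ad_ramified q_prime ub1 rb2 e2) (L_ad_ramified q_prime uc1 rc2 e3).
  rewrite (L_triple_value un1 un1' ub1 uc1 rb2 rc2 ubc e2 e3) zeta2 //.
  rewrite exprVn [(_^-1 * _^-1)^-1]invfM !invrK -sqrt_qV_sqr // -/u -/w -/a -/b.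
  have cg : conjc (b1 w * c1 w) = (b1 w * c1 w)^-1.
    by rewrite conjcM invfM; congr (_ * _); apply: invM_eq1_r.
  have co : conjc (omega1 w) = (a * b)^-1.
    by rewrite -omw; apply: invM_eq1_r.
  have ct : conjc (a + b) = (a + b) / (a * b) by rewrite -omw.
  have JE' := hecke_series_morph (f := @conjc R) (conjc_real _) cg ct co JE.
  rewrite omw in JE.
  (* Here g' is the value of b2 c2 at q; the condition on the central characters ties it to a, b and
     g. *)
  apply: triple_product_identity => //; rewrite ?mulf_neq0 //.
  by have := omega_prod w w0; rewrite om1 // om2 // om3 // => <-; rewrite -/a -/b; ring.
have E2 : LH_ad pi2 omega2 chi2 = (1 - u ^+ 4)^-1.
  by apply: LH_ad_ramified => //; exact: char_conductor_one om2 ub1 rb2 tb2.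
have E3 : LH_ad pi3 omega3 chi3 = (1 - u ^+ 4)^-1.
  by apply: LH_ad_ramified => //; exact: char_conductor_one om3 uc1 rc2 tc2.
rewrite /E_factor E2 E3.
rewrite /LH_ad (conductor_zero ps1 un1 un1') eqxx.
rewrite (L_ad_ramified q_prime ub1 rb2 e2) (L_ad_ramified q_prime uc1 rc2 e3).
have n3' : 1 - a / b * u ^+ 2 != 0 by rewrite mulrC.
have n4' : 1 - b / a * u ^+ 2 != 0 by rewrite mulrC.
(* The factor of pi1 is L / L, which is 1 because the inverse L-factors are nonzero; a pole would
   make L equal to 0 by the convention for inverses. *)
rewrite divff; last first.
  by rewrite chi1E L_ad_unramified // -/w -/a -/b -/u !mulf_neq0 ?invr_eq0.
rewrite -sqrt_qV_sqr // -/u mul1r.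
(* Each ramified representation contributes (1 - u^2) / (1 - u^4) = (1 + u^2)^-1. *)
have -> : 1 - u ^+ 4 = (1 - u ^+ 2) * (1 + u ^+ 2) by ring.
by field; rewrite n1 n2.
Qed.
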